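(* Let $d\ge 2$, let $\mathbb{F}$ be a non-zero locally finite measure concentrated on $(0,\infty)$ with distribution function $F(z)=\mathbb{F}((0,z])$, $z\ge 0$, let $\eta$ be a Poisson process on $\mathbb{R}^d\times(0,\infty)$ with intensity measure $\nu_d\times\mathbb{F}$, and let $(W_n)_{n\ge1}$ be a convex averaging sequence in $\mathbb{R}^d$. Let $\hat{F}_n^0$ be the unique function in $\mathcal{F}_+$ satisfying $G_{\hat{F}_n^0}(z)=\hat{G}_n(z)$ for all $z\ge 0$. Then, with probability one, $\lim_{n\to\infty}\hat{F}_n^0(z)=F(z)$ for all $z\ge 0$.
   Context: $\nu_d$ is Lebesgue measure on $\mathbb{R}^d$; $\kappa_d=\nu_d(\{x\in\mathbb{R}^d:\|x\|\le 1\})$ is the volume of the unit ball. Locally finite means finite on bounded Borel sets; in particular $\mathbb{F}((0,z])<\infty$ for all $z$. $\mathcal{F}_+$ is the space of all (not necessarily bounded) distribution functions on $(0,\infty)$, i.e. functions $F:[0,\infty)\to[0,\infty)$ of the form $F(z)=\mu((0,z])$ with $\mu$ a locally finite measure on $(0,\infty)$ (non-decreasing, right-continuous, $F(0)=0$); $\int_0^z\cdot\,\mathrm{d}F$ denotes the Lebesgue–Stieltjes integral over $(0,z]$. A convex averaging sequence $(W_n)_{n\ge1}$ is an increasing sequence ($W_n\subset W_{n+1}$) of compact convex subsets of $\mathbb{R}^d$ with $\sup\{r\ge 0: B(x,r)\subset W_n\text{ for some }x\in W_n\}\to\infty$ as $n\to\infty$, where $B(x,r)$ is the open ball (so $\nu_d(W_n)>0$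 for all large $n$). The (a.s. simple) point process $\eta$ is identified with its random set of points $(x,h)$, $x\in\mathbb{R}^d$, $h>0$. The Laguerre cell of $(x,h)\in\eta$ is $$C((x,h),\eta)=\{y\in\mathbb{R}^d:\|y-x\|^2+h\le\|y-x'\|^2+h'\ \text{for all }(x',h')\in\eta\}.$$ For $F\in\mathcal{F}_+$ define $G_F:[0,\infty)\to[0,\infty)$ by $$G_F(z)=\int_0^z\exp\left(-\kappa_d\int_0^h(h-t)^{d/2}\,\mathrm{d}F(t)\right)\mathrm{d}F(h),$$ and define the estimator $$\hat{G}_n(z)=\frac{1}{\nu_d(W_n)}\sum_{(x,h)\in\eta}\mathbf{1}_{W_n}(x)\,\mathbf{1}_{(0,z]}(h)\,\mathbf{1}\{x\in C((x,h),\eta)\}.$$ The function $\hat{F}_n^0$ exists and is unique: it is piecewise constant, and if $h_1\le\dots\le h_k$ are the sorted weights of the points $(x,h)\in\eta$ with $x\in W_n$ and $x\in C((x,h),\eta)$, it is given recursively (with $h_0=0$, $\hat F_n^0(h_0)=0$) by $$\hat F_n^0(h_i)=\hat F_n^0(h_{i-1})+(\hat G_n(h_i)-\hat G_n(h_{i-1}))\exp\Big(\kappa_d\sum_{j=1}^{i-1}(h_i-h_j)^{d/2}(\hat F_n^0(h_j)-\hat F_n^0(h_{j-1}))\Big).$$ *)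

(* Defs.v *)
From HB Require Import structures.
From mathcomp Require Import all_boot all_order all_algebra.
From mathcomp Require Import all_classical all_reals all_analysis.
From mathcomp Require Import measurable_realfun.

Set Implicit Arguments.
Unset Strict Implicit.
Unset Printing Implicit Defensive.

Import Order.TTheory GRing.Theory Num.Theory.
Import numFieldNormedType.Exports.

Local Open Scope classical_set_scope.
Local Open Scope ring_scope.

(* R^d is 'rV[R]_d with the product sigma-algebra, as the library does for
   n.-tuple T. *)
Section borel_rV.
Context {R : realType} (d : nat).

Let coord (i : 'I_d) (x : 'rV[R]_d) : R := x ord0 i.

Let rV_set0 : g_sigma_preimage coord set0.
Proof. exact: sigma_algebra0. Qed.

Let rV_setC A : g_sigma_preimage coord A -> g_sigma_preimage coord (~` A).
Proof. exact: sigma_algebraC. Qed.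

Let rV_bigcup (F : (set 'rV[R]_d)^nat) :
  (forall i, g_sigma_preimage coord (F i)) ->
  g_sigma_preimage coord (\bigcup_i F i).
Proof. exact: sigma_algebra_bigcup. Qed.

HB.instance Definition _ := @isMeasurable.Build
  (measure_tuple_display default_measure_display)
  'rV[R]_d (g_sigma_preimage coord) rV_set0 rV_setC rV_bigcup.

Lemma measurable_coord (i : 'I_d) : measurable_fun setT (coord i).
Proof.
move=> _ Y mY; rewrite setTI; apply: sub_sigma_algebra => /=.
rewrite -bigcup_seq/=; exists i => /=; first by rewrite mem_index_enum.
by exists Y => //; rewrite setTI.
Qed.

Lemma measurable_fun_coordP d' (T : measurableType d') (f : T -> 'rV[R]_d) :
  (forall i, measurable_fun setT (coord i \o f)) -> measurable_fun setT f.
Proof.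
move=> mf _ A mA.
suff : g_sigma_preimage coord `<=` [set B | measurable (f @^-1` B)].
  by rewrite setTI; exact.
apply: smallest_sub.
  split => /=.
  - by rewrite preimage_set0.
  - by move=> B mB; rewrite setTD preimage_setC; exact: measurableC.
  - by move=> F mF; rewrite preimage_bigcup; exact: bigcup_measurable.
move=> B; rewrite -bigcup_seq => -[i _ [C mC <-]] /=.
by rewrite setTI -comp_preimage -[X in measurable X]setTI; exact: mf.
Qed.

End borel_rV.

Section lebesgue_rV.
Context {R : realType}.
Local Open Scope ereal_scope.

Definition cons_rV d (p : measurableTypeR R * 'rV[R]_d) : 'rV[R]_d.+1 :=
  row_mx (const_mx p.1 : 'rV_1) p.2.

Definition uncons_rV d (x : 'rV[R]_d.+1) : measurableTypeR R * 'rV[R]_d :=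
  (x ord0 ord0, rsubmx (x : 'rV_(1 + d))).

Lemma cons_rVK d : cancel (@cons_rV d) (@uncons_rV d).
Proof.
move=> [y x]; rewrite /uncons_rV /cons_rV /= row_mxKr; congr pair.
rewrite (_ : ord0 = lshift d (ord0 : 'I_1)); last exact/val_inj.
by rewrite (row_mxEl (const_mx y : 'rV_1)) mxE.
Qed.

Lemma measurable_cons_rV d : measurable_fun setT (@cons_rV d).
Proof.
apply: measurable_fun_coordP => i.
have [j ij|j ij] := split_ordP (i : 'I_(1 + d)).
  rewrite (_ : _ \o _ = fst); first exact: measurable_fst.
  apply/funext => x; rewrite /= ij.
  by rewrite (row_mxEl (const_mx x.1 : 'rV_1)) mxE.
rewrite (_ : _ \o _ = (fun x : 'rV[R]_d => x ord0 j) \o snd).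
  by apply: measurableT_comp; [exact: measurable_coord|exact: measurable_snd].
apply/funext => x; rewrite /= ij.
by rewrite (row_mxEr (const_mx x.1 : 'rV_1)).
Qed.

Lemma measurable_uncons_rV d : measurable_fun setT (@uncons_rV d).
Proof.
apply/measurable_fun_pairP; split; first exact: measurable_coord.
apply: measurable_fun_coordP => i.
rewrite (_ : _ \o _ = fun x : 'rV[R]_(d.+1) => x ord0 (rshift 1 i)).
  exact: measurable_coord.
by apply/funext => x; rewrite /= mxE.
Qed.

Definition cons_measure d (m : set 'rV[R]_d -> \bar R) :
    set 'rV[R]_d.+1 -> \bar R :=
  pushforward (lebesgue_measure \x m) (@cons_rV d).

Section cons_measure.
Variables (d : nat) (m : {sigma_finite_measure set 'rV[R]_d -> \bar R}).

Let mpre A : measurable A -> measurable (@cons_rV d @^-1` A).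
Proof.
move=> mA; rewrite -[X in measurable X]setTI.
exact: measurable_cons_rV.
Qed.

Let cons_measure0 : cons_measure m set0 = 0.
Proof. by rewrite /cons_measure /pushforward preimage_set0 measure0. Qed.

Let cons_measure_ge0 A : 0 <= cons_measure m A.
Proof. by rewrite /cons_measure /pushforward measure_ge0. Qed.

Let cons_measure_sigma_additive : semi_sigma_additive (cons_measure m).
Proof.
move=> F mF tF mUF; rewrite /cons_measure /pushforward preimage_bigcup.
apply: measure_semi_sigma_additive => [n||]; first exact: mpre.
  apply/trivIsetP => /= i j _ _ ij; rewrite -preimage_setI.
  by move/trivIsetP : tF => /(_ _ _ _ _ ij) ->//; rewrite preimage_set0.
by rewrite -preimage_bigcup; exact: mpre.
Qed.

HB.instance Definition _ := isMeasure.Build _ _ _ (cons_measure m)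
  cons_measure0 cons_measure_ge0 cons_measure_sigma_additive.

Let cons_measure_sigma_finite : sigma_finite setT (cons_measure m).
Proof.
have /sigma_finiteP[F [TF ndF Foo]] := sigma_finiteT (@lebesgue_measure R).
have /sigma_finiteP[G [TG ndG Goo]] := sigma_finiteT m.
exists (fun n => @uncons_rV d @^-1` (F n `*` G n)).
  rewrite -preimage_bigcup -[LHS](preimage_setT (@uncons_rV d)).
  congr preimage; rewrite -setXTT TF TG predeqE => -[x y]; split.
    move=> [/= [n _ Fnx] [k _ Gky]]; exists (maxn n k) => //; split.
    - by move: x Fnx; exact/subsetPset/ndF/leq_maxl.
    - by move: y Gky; exact/subsetPset/ndG/leq_maxr.
  by move=> [n _ []/= ? ?]; split; exists n.
move=> n; have [? ?] := Foo n; have [? ?] := Goo n; split.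
  rewrite -[X in measurable X]setTI.
  by apply: measurable_uncons_rV => //; exact: measurableX.
rewrite /cons_measure /pushforward -comp_preimage.
rewrite (_ : _ \o _ = id) ?preimage_id.
  by rewrite /= product_measure1E// lte_mul_pinfty// ge0_fin_numE.
by apply/funext => x; exact: cons_rVK.
Qed.

HB.instance Definition _ := @Measure_isSigmaFinite.Build _ _ _
  (cons_measure m) cons_measure_sigma_finite.

End cons_measure.

(* The d-fold product of the Lebesgue measure on R. *)
Fixpoint lebesgue_rV d : set 'rV[R]_d -> \bar R :=
  match d return set 'rV[R]_d -> \bar R with
  | 0%N => dirac (0%R : 'rV[R]_0)
  | d'.+1 => cons_measure (@lebesgue_rV d')
  end.

Let lebesgue_rV_measure d :
  exists mu : {sigma_finite_measure set 'rV[R]_d -> \bar R},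
    @lebesgue_rV d = mu.
Proof.
elim: d => [|d [mu IH]]; first by exists (dirac (0%R : 'rV[R]_0)).
by rewrite /= IH; exists (cons_measure mu).
Qed.

Let lebesgue_rV0 d : @lebesgue_rV d set0 = 0.
Proof. by have [mu ->] := lebesgue_rV_measure d; rewrite measure0. Qed.

Let lebesgue_rV_ge0 d A : 0 <= @lebesgue_rV d A.
Proof. by have [mu ->] := lebesgue_rV_measure d; exact: measure_ge0. Qed.

Let lebesgue_rV_sigma_additive d : semi_sigma_additive (@lebesgue_rV d).
Proof.
by have [mu ->] := lebesgue_rV_measure d; exact: measure_semi_sigma_additive.
Qed.

HB.instance Definition _ d := isMeasure.Build _ _ _ (@lebesgue_rV d)
  (@lebesgue_rV0 d) (@lebesgue_rV_ge0 d) (@lebesgue_rV_sigma_additive d).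

Let lebesgue_rV_sigma_finite d : sigma_finite setT (@lebesgue_rV d).
Proof. by have [mu ->] := lebesgue_rV_measure d; exact: sigma_finiteT. Qed.

HB.instance Definition _ d := @Measure_isSigmaFinite.Build _ _ _
  (@lebesgue_rV d) (@lebesgue_rV_sigma_finite d).

End lebesgue_rV.

Section geometry.
Context {R : realType} {d : nat}.
Implicit Types (x y : 'rV[R]_d) (W : set 'rV[R]_d).

(* The library's norm on 'rV[R]_d is the sup norm; its topology is the
   Euclidean one. *)
Definition enorm x : R := Num.sqrt (\sum_(i < d) x ord0 i ^+ 2).

Definition open_eball x (r : R) : set 'rV[R]_d := [set y | enorm (y - x) < r].

Definition inradius W : \bar R :=
  ereal_sup [set r%:E | r in
    [set r : R | 0 <= r /\ exists2 x, W x & open_eball x r `<=` W]].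

Definition convex_averaging_sequence (W : (set 'rV[R]_d)^nat) : Prop :=
  [/\ forall n, W n `<=` W n.+1,
      forall n, compact (W n),
      forall n, convex_set (W n) &
      inradius (W n) @[n --> \oo] --> +oo%E].

(* A point (x, h) is a pair p, with position p.1 and weight p.2. *)
Definition laguerre_cell (p : 'rV[R]_d * R) (eta : set ('rV[R]_d * R)) :
    set 'rV[R]_d :=
  [set y | forall q, eta q ->
     enorm (y - p.1) ^+ 2 + p.2 <= enorm (y - q.1) ^+ 2 + q.2].

End geometry.

Section poisson.
Context {R : realType} d d' (Omega : measurableType d) (E : measurableType d').
Variable P : probability Omega R.
Implicit Types (eta : Omega -> set E) (Lambda : set E -> \bar R).

Definition point_count eta (B : set E) (w : Omega) : \bar R :=
  counting (eta w `&` B).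

(* A simple point process is given by its random set of points.
   In poisson_prob the second argument is a dummy; poisson_prob 0 is the Dirac
   mass at 0, whereas poisson_pmf 0 is not a probability mass function. *)
Definition poisson_process eta Lambda : Prop :=
  [/\ forall B, measurable B -> measurable_fun setT (point_count eta B),
      forall B, measurable B -> (Lambda B < +oo)%E -> forall k : nat,
        P [set w | point_count eta B w = k%:R%:E] =
          poisson_prob (fine (Lambda B)) 0%N [set k],
      forall B, measurable B -> Lambda B = +oo%E ->
        P [set w | point_count eta B w = +oo%E] = 1%E &
      forall (m : nat) (B : 'I_m -> set E),
        (forall i, measurable (B i)) -> trivIset setT B ->
        forall A : 'I_m -> set (\bar R), (forall i, measurable (A i)) ->
        P (\bigcap_i (point_count eta (B i) @^-1` A i)) =
          (\prod_(i < m) P (point_count eta (B i) @^-1` A i))%E].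

End poisson.

Section estimator.
Context {R : realType}.

Definition locally_finite (mu : set R -> \bar R) : Prop :=
  forall A : set R, measurable A -> bounded_set A -> (mu A < +oo)%E.

Definition unit_ball_volume d : R :=
  fine (lebesgue_rV [set x : 'rV[R]_d | enorm x <= 1]).

(* Functions on [0, +oo[ are extended by 0 to R; the Lebesgue-Stieltjes measure
   of the extension has no mass on ]-oo, 0]. *)
Definition distribution_function (F : cumulative R R) : Prop :=
  forall z, z <= 0 -> F z = 0.

Definition G_of d (F : cumulative R R) (z : R) : R :=
  let dF := lebesgue_stieltjes_measure F in
  \int[dF]_(h in `]0, z])
    expR (- unit_ball_volume d *
          \int[dF]_(t in `]0, h]) ((h - t) `^ (d%:R / 2))).

Definition G_hat d (W : set 'rV[R]_d) (eta : set ('rV[R]_d * R)) (z : R) : R :=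
  (fine (lebesgue_rV W))^-1 *
  fine (\esum_(p in eta)
    (\1_W p.1 * \1_(`]0, z]) p.2 * \1_(laguerre_cell p eta) p.1)%:E).

Definition solves_G d (g : R -> R) (F : cumulative R R) : Prop :=
  distribution_function F /\ forall z, 0 <= z -> G_of d F z = g z.

Definition F0_hat d (W : set 'rV[R]_d) (eta : set ('rV[R]_d * R)) : R -> R :=
  get [set f : R -> R | exists F : cumulative R R,
    [/\ f = F, solves_G d (G_hat W eta) F &
        forall F' : cumulative R R, solves_G d (G_hat W eta) F' -> F' =1 F]].

End estimator.

(* Main.v *)
(* Let V(h) = kappa_d * int_0^h (h - t)^(d/2) dF(t), the mean number of points of
   eta that keep a point of weight h out of its own cell, so that
   G_F(z) = int_0^z exp(- V) dF.

   Almost surely G_hat_n(z) --> G_F(z). Cut W_n into cubes of side delta and fix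
   weights a < b. That a cube carries one point with weight in ]a, b] and that a
   paraboloid slightly larger than the one below weight b is otherwise empty
   are events of finite range of dependence which force an exposed point;
   likewise, a point in a slightly smaller paraboloid below weight a forces a
   hidden one. Chebyshev's inequality and the Borel-Cantelli lemma, applied
   along geometrically growing volumes, bound the numbers of exposed and of
   hidden points below, by mu(]a, b]) exp(- V(b)) and mu(]a, b])(1 - exp(- V(a)))
   per unit volume. A Poisson tail bound controls their sum from above, so
   both bounds are sharp as b - a --> 0. Monotonicity in z yields all z at once.

   The map G_F |-> F is continuous for pointwise convergence: if G_(F_n) --> G_F,
   then int exp(V) dG_(F_n) --> F, and |V_n - V| is bounded by a multiple of
   int |F_n - F|, so that Gronwall's argument applies. *)
From HB Require Import structures.
Require Import Defs.
From mathcomp Require Import all_boot all_order all_algebra.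
From mathcomp Require Import all_classical all_reals all_analysis.
From mathcomp Require Import measurable_realfun.
From mathcomp Require Import ring lra zify.

Set Implicit Arguments.
Unset Strict Implicit.
Unset Printing Implicit Defensive.

Import Order.TTheory GRing.Theory Num.Theory.
Import numFieldNormedType.Exports.

Local Open Scope classical_set_scope.
Local Open Scope ring_scope.

(** * Lebesgue measure on R^d *)

(** Of a Poisson process only the counts [point_count eta B] are known to be measurable, and
    independent over disjoint sets. The number of exposed points of a window is not such a count and
    is never integrated: it is bounded below by sums of indicators of count events, one per cube.
    Chebyshev's inequality leaves a failure probability of order 1 / v_n, v_n being the volume of
    W_n; volumes may grow slowly, so this need not be summable in n, whereas it is along geometric
    levels.

    On the analytic side dF_n and dF may charge different points and cannot be compared as measures.
    Integration by parts writes V as a Lebesgue integral of F against the derivative of (h -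
    t)^(d/2), bounded because d >= 2. The inequality obtained for D(h) = int_0^h |F_n - F| is linear
    only while D <= 1, as exp(V_n - V) has to be controlled; D is continuous even where F_n jumps,
    so an intermediate value argument closes the bootstrap.

    [F0_hat] is a choice, so its defining property has to be established: existence by adding atoms
    in increasing order of weight, uniqueness by stability applied to a constant sequence. *)

Section lebesgue_rV_affine.
Context {R : realType}.
Implicit Type d : nat.
Local Open Scope ereal_scope.

Lemma measurable_affineR (r s : R) :
  measurable_fun setT (fun y : measurableTypeR R => (r * y + s)%R : measurableTypeR R).
Proof. by apply: measurable_funD => //; exact: measurable_funM. Qed.

Lemma measurable_affine_rV d (r : R) (v : 'rV[R]_d) :
  measurable_fun setT (fun x : 'rV[R]_d => (r *: x + v)%R).
Proof.
apply: measurable_fun_coordP => i.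
rewrite (_ : _ \o _ = fun x : 'rV[R]_d => (r * x ord0 i + v ord0 i)%R).
  apply: measurable_funD => //; apply: measurable_funM => //.
  exact: measurable_coord.
by apply/funext => x; rewrite /= !mxE.
Qed.

(** Uniqueness of Lebesgue measure: [r] times the image measure gives every half-open interval its
    length. *)
Lemma lebesgue_measure_affine (r s : R) (A : set (measurableTypeR R)) :
  (0 < r)%R -> measurable A ->
  lebesgue_measure ((fun y : R => (r * y + s)%R) @^-1` A) =
  (r^-1)%:E * lebesgue_measure A.
Proof.
move=> r0 mA.
pose r' := NngNum (ltW r0).
have H := @lebesgue_measure_unique R (mscale r' (pushforward lebesgue_measure
  (fun y : measurableTypeR R => (r * y + s)%R : measurableTypeR R))).
rewrite [in RHS](H (measurable_affineR r s))//; last first.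
  move=> _ [[a b]] _ <-; change (lebesgue_measure `]a, b]%classic = r%:E * lebesgue_measure
    ((fun y : R => (r * y + s)%R) @^-1` `]a, b]%classic)).
  rewrite (_ : _ @^-1` _ = `]((a - s) / r)%R, ((b - s) / r)%R]%classic); last first.
    apply/seteqP; split => y /=; rewrite !in_itv/=;
      by rewrite ltr_pdivrMr// ler_pdivlMr// ltrBlDr lerBrDr (mulrC y).
  rewrite !lebesgue_measure_itv/= !lte_fin ltr_pM2r ?invr_gt0// ltrBlDr subrK.
  case: ifPn => ab; last by rewrite mule0.
  by rewrite -!EFinB -EFinM; congr EFin; field; rewrite gt_eqF.
change (lebesgue_measure ((fun y : R => (r * y + s)%R) @^-1` A) =
  (r^-1)%:E * (r%:E * lebesgue_measure ((fun y : R => (r * y + s)%R) @^-1` A))).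
by rewrite muleA -EFinM mulVf ?gt_eqF// mul1e.
Qed.

Lemma ge0_integral_affine (r s : R) (f : R -> \bar R) :
  (0 < r)%R -> measurable_fun setT f -> (forall y, 0 <= f y) ->
  \int[lebesgue_measure]_y f (r * y + s)%R =
  (r^-1)%:E * \int[lebesgue_measure]_y f y.
Proof.
move=> r0 mf f0.
have r0' : (0 <= r^-1)%R by rewrite invr_ge0 ltW.
pose r' := NngNum r0'.
rewrite -(@ge0_integral_mscale _ _ _ (@lebesgue_measure R) setT measurableT r' f)//.
rewrite -[X in integral _ X _](preimage_setT
  (fun y : measurableTypeR R => (r * y + s)%R : measurableTypeR R)).
rewrite -(@ge0_integral_pushforward _ _ _ _ R
    (fun y : measurableTypeR R => (r * y + s)%R : measurableTypeR R)
    (measurable_affineR r s))//.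
apply: eq_measure_integral; first exact: measurable_affineR.
by move=> mphi A mA _; exact: lebesgue_measure_affine.
Qed.

Lemma cons_rV_lshift d (p : measurableTypeR R * 'rV[R]_d) (j : 'I_1) :
  cons_rV p ord0 (lshift d j : 'I_(1 + d)) = p.1.
Proof. by rewrite /cons_rV (row_mxEl (const_mx p.1 : 'rV_1)) mxE. Qed.

Lemma cons_rV_rshift d (p : measurableTypeR R * 'rV[R]_d) (j : 'I_d) :
  cons_rV p ord0 (rshift 1 j : 'I_(1 + d)) = p.2 ord0 j.
Proof. by rewrite /cons_rV (row_mxEr (const_mx p.1 : 'rV_1)). Qed.

Lemma cons_rV_affine d (r y : R) (u : 'rV[R]_d) (v : 'rV[R]_d.+1) :
  cons_rV ((r * y + v ord0 ord0)%R, (r *: u + rsubmx (v : 'rV_(1 + d)))%R) =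
  (r *: cons_rV (y, u) + v)%R.
Proof.
apply/rowP => i; rewrite 2![in RHS]mxE.
have [j ->|j ->] := split_ordP (i : 'I_(1 + d)).
  by rewrite !cons_rV_lshift/=; congr (_ + v _ _)%R; apply/val_inj; rewrite /= ord1.
by rewrite !cons_rV_rshift/= !mxE.
Qed.

(** Induction on [d]: the induction hypothesis rescales each section, and the substitution in the
    outer integral supplies the last factor [r^-1]. *)
Lemma lebesgue_rV_affine d (r : R) (v : 'rV[R]_d) (A : set 'rV[R]_d) :
  (0 < r)%R -> measurable A ->
  lebesgue_rV ((fun x => (r *: x + v)%R) @^-1` A) =
  ((r^-1) ^+ d)%:E * lebesgue_rV A.
Proof.
move=> r0; elim: d => [|d ih] in v A *.
  move=> mA; rewrite /= expr0 mul1e !diracE.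
  by congr ((_ : bool)%:R%:E); rewrite (_ : (_ @^-1` A) = A)//;
    apply/seteqP; split => x /=; rewrite (thinmx0 x) (thinmx0 v) scaler0 addr0.
move=> mA /=; rewrite /cons_measure /pushforward /=.
pose v0 := v ord0 ord0; pose v' := rsubmx (v : 'rV_(1 + d)).
have mcA : measurable (@cons_rV R d @^-1` A).
  by rewrite -[X in measurable X]setTI; exact: measurable_cons_rV.
rewrite /product_measure1.
transitivity (\int[lebesgue_measure]_y
    (((r^-1) ^+ d)%:E * lebesgue_rV (xsection (@cons_rV R d @^-1` A) (r * y + v0)%R))).
  apply: eq_integral => y _ /=.
  rewrite -(ih v'); last exact: measurable_xsection.
  congr lebesgue_rV; apply/seteqP; split => u /=;
    by rewrite !xsectionP/= cons_rV_affine.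
have mphi : measurable_fun setT (fun y : measurableTypeR R =>
    lebesgue_rV (xsection (@cons_rV R d @^-1` A) y)).
  exact: measurable_fun_xsection.
rewrite ge0_integralZl//; last by rewrite lee_fin exprn_ge0// invr_ge0 ltW.
  rewrite (@ge0_integral_affine r v0 (fun y => lebesgue_rV (xsection (@cons_rV R d @^-1` A) y)))//.
  by rewrite muleA -EFinM -exprSr.
exact: (measurableT_comp mphi (measurable_affineR r v0)).
Qed.

Lemma measurable_cube d (J : 'I_d -> set R) : (forall i, measurable (J i)) ->
  measurable [set x : 'rV[R]_d | forall i, J i (x ord0 i)].
Proof.
move=> mJ.
rewrite (_ : [set x | _] = \bigcap_(i in [set: 'I_d]) ((fun x : 'rV[R]_d => x ord0 i) @^-1` J i)).
  apply: fin_bigcap_measurable => // i _; rewrite -[X in measurable X]setTI.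
  exact: measurable_coord.
by apply/seteqP; split => x /= H i; [move=> _; exact: H|exact: H].
Qed.

Lemma lebesgue_rV_cube d (J : set (measurableTypeR R)) : measurable J ->
  @lebesgue_rV R d [set x | forall i, J (x ord0 i)] = lebesgue_measure J ^+ d.
Proof.
move=> mJ; elim: d => [|d ih].
  by rewrite /= diracE mem_set//= => -[].
have mC := @measurable_cube d (fun=> J) (fun=> mJ).
rewrite expeS -ih -(product_measure1E _ _ mJ mC)/=.
rewrite /cons_measure /pushforward/=.
congr (_ \x _); apply/seteqP; split => -[y u]/=.
  move=> H; split => [|i].
    by have := H (lshift d (ord0 : 'I_1)); rewrite cons_rV_lshift.
  by have := H (rshift 1 i); rewrite cons_rV_rshift.
move=> [Jy Ju] i; have [j ->|j ->] := split_ordP (i : 'I_(1 + d)).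
  by rewrite cons_rV_lshift.
by rewrite cons_rV_rshift.
Qed.

End lebesgue_rV_affine.

(** * Euclidean norm and volumes of balls *)

Section euclidean_norm.
Context {R : realType} {d : nat}.
Implicit Types (x y : 'rV[R]_d) (r : R).

Lemma sumsq_ge0 x : 0 <= \sum_(i < d) x ord0 i ^+ 2.
Proof. by apply: sumr_ge0 => i _; exact: sqr_ge0. Qed.

Lemma enorm_ge0 x : 0 <= enorm x.
Proof. exact: sqrtr_ge0. Qed.

Lemma sqr_enorm x : enorm x ^+ 2 = \sum_(i < d) x ord0 i ^+ 2.
Proof. by rewrite sqr_sqrtr// sumsq_ge0. Qed.

Lemma enorm_le x r : 0 <= r -> (enorm x <= r) = (\sum_(i < d) x ord0 i ^+ 2 <= r ^+ 2).
Proof. by move=> r0; rewrite -sqr_enorm ler_sqr ?nnegrE ?enorm_ge0. Qed.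

(** Cauchy-Schwarz from Lagrange's identity: twice the defect is the sum over i, j of (x_i y_j - x_j
    y_i)^2. *)
Lemma dot_le x y : \sum_(i < d) x ord0 i * y ord0 i <= enorm x * enorm y.
Proof.
rewrite -sqrtrM ?sumsq_ge0//; apply: le_trans (ler_norm _) _.
rewrite -sqrtr_sqr ler_wsqrtr// expr2 !big_distrlr/= -subr_ge0.
suff : 0 <= 2 * (\sum_(i < d) \sum_(j < d) x ord0 i ^+ 2 * y ord0 j ^+ 2 -
  \sum_(i < d) \sum_(j < d) x ord0 i * y ord0 i * (x ord0 j * y ord0 j)).
  by rewrite pmulr_rge0.
have -> : 2 * (\sum_(i < d) \sum_(j < d) x ord0 i ^+ 2 * y ord0 j ^+ 2 -
  \sum_(i < d) \sum_(j < d) x ord0 i * y ord0 i * (x ord0 j * y ord0 j)) =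
  \sum_(i < d) \sum_(j < d) (x ord0 i * y ord0 j - x ord0 j * y ord0 i) ^+ 2.
  rewrite mulr2n mulrDl mul1r {1}exchange_big/= addrACA -opprD -!big_split/= -sumrB.
  apply: eq_bigr => i _; rewrite -!big_split/= -sumrB; apply: eq_bigr => j _.
  by ring.
by apply: sumr_ge0 => i _; apply: sumr_ge0 => j _; exact: sqr_ge0.
Qed.

Lemma enormD x y : enorm (x + y) <= enorm x + enorm y.
Proof.
rewrite enorm_le ?addr_ge0 ?enorm_ge0// sqrrD !sqr_enorm.
rewrite (eq_bigr (fun i => x ord0 i ^+ 2 + (x ord0 i * y ord0 i) *+ 2 + y ord0 i ^+ 2)); last first.
  by move=> i _; rewrite mxE sqrrD.
rewrite 2!big_split/= lerD2r lerD2l sumrMnl lerMn2r; apply/orP; right; exact: dot_le.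
Qed.

Lemma enormZ r x : enorm (r *: x) = `|r| * enorm x.
Proof.
rewrite /enorm -sqrtr_sqr -sqrtrM ?sqr_ge0// mulr_sumr; congr Num.sqrt.
by apply: eq_bigr => i _; rewrite mxE exprMn.
Qed.

Lemma enormN x : enorm (- x) = enorm x.
Proof. by rewrite -scaleN1r enormZ normrN normr1 mul1r. Qed.

Lemma enorm_distC x y : enorm (x - y) = enorm (y - x).
Proof. by rewrite -enormN opprB. Qed.

Lemma enorm_dist_triangle y x z : enorm (x - z) <= enorm (x - y) + enorm (y - z).
Proof. by apply: le_trans (enormD _ _); rewrite addrA subrK. Qed.

Lemma coord_le_enorm x i : `|x ord0 i| <= enorm x.
Proof.
rewrite /enorm -sqrtr_sqr ler_wsqrtr// (bigD1 i)//= lerDl.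
by apply: sumr_ge0 => j _; exact: sqr_ge0.
Qed.

Lemma enorm_le_coord x r : (forall i, `|x ord0 i| <= r) -> enorm x <= d%:R * r.
Proof.
move=> xr; case: (posnP d) => [d0|d0].
  rewrite /enorm big1 ?sqrtr0 ?d0 ?mul0r// => i _.
  by have := ltn_ord i; rewrite {2}d0.
have r0 : 0 <= r by rewrite (le_trans _ (xr (Ordinal d0))).
rewrite enorm_le ?mulr_ge0//.
apply: (@le_trans _ _ (\sum_(i < d) r ^+ 2)).
  by apply: ler_sum => i _; rewrite -real_normK ?num_real// lerXn2r ?nnegrE.
rewrite sumr_const card_ord -[leLHS]mulr_natl exprMn ler_wpM2r ?sqr_ge0//.
by rewrite expr2 -natrM ler_nat leq_pmulr.
Qed.

Lemma measurable_enorm : measurable_fun setT (@enorm R d).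
Proof.
apply: (measurableT_comp (f := @Num.sqrt R) (g := fun x : 'rV[R]_d => \sum_(i < d) x ord0 i ^+ 2)).
  by apply: continuous_measurable_fun; exact: sqrt_continuous.
by apply: measurable_sum => i; apply: measurable_funX; exact: measurable_coord.
Qed.

Lemma measurable_rV_fun_add y : measurable_fun setT (fun x : 'rV[R]_d => x + y).
Proof.
have := @measurable_affine_rV R d 1 y.
by under eq_fun do rewrite scale1r.
Qed.

Definition ceball x r : set 'rV[R]_d := [set y | enorm (y - x) <= r].

Lemma measurable_ceball x r : measurable (ceball x r).
Proof.
have mf : measurable_fun setT (fun y : 'rV[R]_d => enorm (y - x)).
  by apply: measurableT_comp; [exact: measurable_enorm|exact: measurable_rV_fun_add].
rewrite (_ : ceball _ _ = (fun y : 'rV[R]_d => enorm (y - x)) @^-1` `]-oo, r]).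
  by rewrite -[X in measurable X]setTI; apply: mf => //.
by apply/seteqP; split => y /=; rewrite in_itv/=.
Qed.

Lemma lebesgue_ball_lty : (lebesgue_rV (ceball (0 : 'rV[R]_d) 1%R) < +oo)%E.
Proof.
apply: (@le_lt_trans _ _ (@lebesgue_rV R d [set x | forall i, `[-1, 1]%classic (x ord0 i)])).
  apply: le_measure; rewrite ?inE.
  - exact: measurable_ceball.
  - exact: (@measurable_cube R d (fun=> `[-1, 1]%classic)).
  - move=> x; rewrite /ceball/= subr0 => x1 i; rewrite in_itv/= -ler_norml.
    exact: le_trans (coord_le_enorm _ _) x1.
by rewrite lebesgue_rV_cube// lebesgue_measure_itv/= lte_fin gtrN// -EFinB -EFin_expe ltry.
Qed.

Lemma lebesgue_ball1 : lebesgue_rV (ceball (0 : 'rV[R]_d) 1%R) = (unit_ball_volume d)%:E.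
Proof.
rewrite /unit_ball_volume.
rewrite (_ : [set x | _] = ceball 0 1%R); last by apply/seteqP; split => x; rewrite /ceball/= subr0.
by rewrite fineK// ge0_fin_numE// lebesgue_ball_lty.
Qed.

Lemma lebesgue_ceball_gt0 c r : 0 < r ->
  lebesgue_rV (ceball c r) = (unit_ball_volume d * r ^+ d)%:E.
Proof.
move=> r0; have := @lebesgue_rV_affine R d (r^-1) (- (r^-1 *: c)) (ceball 0 1%R).
rewrite invr_gt0 invrK => /(_ r0 (measurable_ceball _ _)).
rewrite lebesgue_ball1 -EFinM mulrC => <-; congr lebesgue_rV.
apply/seteqP; split => x; rewrite /ceball/= subr0 -scalerBr enormZ ger0_norm ?invr_ge0 ?(ltW r0)//;
by rewrite ler_pdivrMl// mulr1.
Qed.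

Hypothesis d_gt0 : (0 < d)%N.

(** Scaling only covers positive radii; a ball of radius 0 lies in balls of arbitrarily small
    volume. *)
Lemma lebesgue_ceball c r : 0 <= r ->
  lebesgue_rV (ceball c r) = (unit_ball_volume d * r ^+ d)%:E.
Proof.
rewrite le_eqVlt => /predU1P[<-{r}|]; last exact: lebesgue_ceball_gt0.
rewrite expr0n gtn_eqF// mulr0; apply/eqP; rewrite eq_le measure_ge0 andbT.
apply/lee_addgt0Pr => e e0; rewrite add0e.
(* The bound 1 gives [r ^+ d <= r]; the added 1 in the denominator keeps it visibly positive. *)
pose r := Num.min 1 (e / (unit_ball_volume d + 1)).
have v0 : 0 <= @unit_ball_volume R d.
  by rewrite -lee_fin -lebesgue_ball1 measure_ge0.
have r0 : 0 < r by rewrite lt_min ltr01 divr_gt0// ltr_wpDl.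
apply: (@le_trans _ _ (lebesgue_rV (ceball c r))).
  apply: le_measure; rewrite ?inE; [exact: measurable_ceball..|].
  by move=> x; rewrite /ceball/= => /le_trans; apply; exact: ltW.
rewrite lebesgue_ceball_gt0// lee_fin.
have rr : r ^+ d <= r.
  rewrite -(prednK d_gt0) exprS ler_piMr ?(ltW r0)// exprn_ile1 ?(ltW r0)//.
  by rewrite ge_min lexx.
apply: (@le_trans _ _ ((unit_ball_volume d + 1) * r)).
  by rewrite ler_pM// ?exprn_ge0 ?(ltW r0)// lerDl.
by rewrite -ler_pdivlMl ?ltr_wpDl// mulrC ge_min lexx orbT.
Qed.

(** The cube of half-side 1/d fits into the unit ball. *)
Lemma unit_ball_volume_gt0 : 0 < @unit_ball_volume R d.
Proof.
pose s : R := d%:R^-1.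
have s0 : 0 < s by rewrite invr_gt0 ltr0n.
rewrite -lte_fin -lebesgue_ball1.
apply: (@lt_le_trans _ _ (@lebesgue_rV R d [set x | forall i, `[-s, s]%classic (x ord0 i)])).
  rewrite lebesgue_rV_cube// lebesgue_measure_itv/= lte_fin gtrN// -EFinB -EFin_expe lte_fin.
  by rewrite exprn_gt0// opprK addr_gt0.
apply: le_measure; rewrite ?inE.
- exact: (@measurable_cube R d (fun=> `[-s, s]%classic)).
- exact: measurable_ceball.
- move=> x /= xs; rewrite /ceball/= subr0.
  apply: (@le_trans _ _ (d%:R * s)).
    by apply: enorm_le_coord => i; rewrite ler_norml; have := xs i; rewrite in_itv.
  by rewrite mulfV// pnatr_eq0 -lt0n.
Qed.

End euclidean_norm.

(** * Borel sets of R^d *)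

Section closed_measurable.
Context {R : realType} {d : nat}.
Implicit Types (x y : 'rV[R]_d) (W : set 'rV[R]_d).

(** The sigma-algebra is generated by the coordinates, so an open set has to be exhibited as a
    countable union of boxes: those with rational centre and half-side 1/(k+1) that it contains. *)
Lemma open_measurable_rV W : open W -> measurable W.
Proof.
move=> oW.
pose box (p : 'rV[rat]_d * nat) : set 'rV[R]_d :=
  [set y | forall i, `](ratr (p.1 ord0 i) - p.2.+1%:R^-1),
    (ratr (p.1 ord0 i) + p.2.+1%:R^-1)[%classic (y ord0 i)].
have mbox p : measurable (box p).
  exact: (@measurable_cube R d (fun i => `](ratr (p.1 ord0 i) - p.2.+1%:R^-1),
    (ratr (p.1 ord0 i) + p.2.+1%:R^-1)[%classic)).
pose F n : set 'rV[R]_d :=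
  if unpickle n is Some p then (if `[< box p `<=` W >] then box p else set0) else set0.
suff -> : W = \bigcup_n F n.
  apply: bigcupT_measurable => n; rewrite /F; case: unpickle => // p.
  by case: ifP.
apply/seteqP; split => [x Wx|x [n _]]; last first.
  by rewrite /F; case: unpickle => // p; case: ifPn => // /asboolP; exact.
have : nbhs x W by exact: open_nbhs_nbhs.
move=> /nbhs_ballP[e /= e0 xeW].
(* Half of [e]: the rational centre is within 1/(k+1) of [x], and the box reaches another 1/(k+1)
   from it. *)
have [k ke] : exists k : nat, k.+1%:R^-1 < e / 2.
  have [k _ kP] := near_infty_natSinv_lt (PosNum (divr_gt0 e0 (ltr0n R 2))).
  by exists k; exact: kP (leqnn k).
have qP i : {q : rat | ratr q \in `](x ord0 i - k.+1%:R^-1), (x ord0 i + k.+1%:R^-1)[}.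
  have k0 : 0 < k.+1%:R^-1 :> R by rewrite invr_gt0.
  apply: cid; by apply: rat_in_itvoo; rewrite ltrD2l gtrN.
pose q : 'rV[rat]_d := \row_i sval (qP i).
exists (pickle (q, k)) => //; rewrite /F pickleK.
have -> : `[< box (q, k) `<=` W >].
  apply/asboolP => y yq; apply: xeW; split => // a i; rewrite (ord1 a) /ball/=.
  have := yq i; have := svalP (qP i); rewrite /box/= !in_itv/= mxE => /andP[h1 h2] /andP[h3 h4].
  move: ke h1 h2 h3 h4; rewrite /=; move: (ratr (sval (qP i)) : R) => u.
  move: (k.+1%:R^-1 : R) => t ke h1 h2 h3 h4.
  by rewrite ltr_norml; apply/andP; split; lra.
move=> i; have := svalP (qP i); rewrite /= !in_itv/= mxE => /andP[].
rewrite /=; move: (ratr (sval (qP i)) : R) => u.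
move: (k.+1%:R^-1 : R) => t h1 h2.
by apply/andP; split; lra.
Qed.

Lemma closed_measurable_rV W : closed W -> measurable W.
Proof.
move=> cW; rewrite -[W]setCK; apply: measurableC.
by apply: open_measurable_rV; exact: closed_openC.
Qed.

Lemma compact_measurable_rV W : compact W -> measurable W.
Proof.
by move=> cW; apply: closed_measurable_rV; apply: compact_closed => //; exact: norm_hausdorff.
Qed.

Lemma compact_coord_bounded W : compact W ->
  exists M : R, 0 < M /\ forall x, W x -> forall i, `|x ord0 i| <= M.
Proof.
move=> /compact_bounded[M [Mr MW]].
exists (`|M| + 1); split; first by rewrite ltr_wpDl.
move=> x Wx i; apply: (@le_trans _ _ `|x|).
  rewrite [leRHS]mx_normrE.
  exact: (le_bigmax (0 : R) (fun ij : 'I_1 * 'I_d => `|x ij.1 ij.2|) (ord0, i)).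
by apply: MW Wx; rewrite (le_lt_trans (ler_norm _))// ltrDl.
Qed.

Lemma coord_bounded_lty W (M : R) : measurable W ->
  (forall x, W x -> forall i, `|x ord0 i| <= M) -> (lebesgue_rV W < +oo)%E.
Proof.
move=> mW WM.
apply: (@le_lt_trans _ _ (@lebesgue_rV R d [set x | forall i, `[-M, M]%classic (x ord0 i)])).
  apply: le_measure; rewrite ?inE//.
    exact: (@measurable_cube R d (fun=> `[-M, M]%classic)).
  by move=> x Wx i; rewrite /= in_itv/= -ler_norml; exact: WM.
rewrite lebesgue_rV_cube// lebesgue_measure_itv/=.
by case: ifPn => _; rewrite -?EFinB -EFin_expe ltry.
Qed.

Lemma compact_lty W : compact W -> (lebesgue_rV W < +oo)%E.
Proof.
move=> cW; have [M [M0 WM]] := compact_coord_bounded cW.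
exact: coord_bounded_lty (compact_measurable_rV cW) WM.
Qed.

End closed_measurable.

Section volume_cvg.
Context {R : realType} {d : nat}.
Hypothesis d_gt0 : (0 < d)%N.
Local Open Scope ereal_scope.

Lemma inradius_volume (W : set 'rV[R]_d) (r : R) : (0 < r)%R -> measurable W ->
  r%:E < inradius W -> (unit_ball_volume d * (r / 2) ^+ d)%R%:E <= lebesgue_rV W.
Proof.
move=> r0 mW /ereal_sup_gt[_ [s [s0 [x Wx xsW]] <-]]; rewrite lte_fin => rs.
have r20 : (0 <= r / 2)%R by rewrite divr_ge0// ltW.
rewrite -(lebesgue_ceball d_gt0 x r20); apply: le_measure; rewrite ?inE//.
  exact: measurable_ceball.
move=> y; rewrite /ceball/= => yr; apply: xsW; rewrite /open_eball/=.
by rewrite (le_lt_trans yr)// (lt_trans _ rs)// ltr_pdivrMr// ltr_pMr// ltrDl.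
Qed.

Lemma volume_cvgy (W : (set 'rV[R]_d)^nat) : convex_averaging_sequence W ->
  forall M : R, \forall n \near \oo, M%:E <= lebesgue_rV (W n).
Proof.
move=> [_ cW _ rW] M.
have v0 := @unit_ball_volume_gt0 R d d_gt0.
(* Since [r / 2 >= 1], its power of exponent [d] is at least [r / 2], hence at least
   [M / unit_ball_volume d]. *)
pose r := (2 * Num.max 1 (M / unit_ball_volume d))%R.
have r0 : (0 < r)%R by rewrite mulr_gt0// lt_max ltr01.
have /cvgeyPgt/(_ r) := rW.
apply: filterS => n rn.
apply: le_trans (inradius_volume r0 (compact_measurable_rV (cW n)) rn).
rewrite lee_fin -ler_pdivrMl// mulrC.
have -> : (r / 2 = Num.max 1 (M / unit_ball_volume d))%R by rewrite /r mulrC mulKf.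
set m := Num.max _ _.
apply: (@le_trans _ _ m); first by rewrite /m le_max lexx orbT.
rewrite -(prednK d_gt0) exprS ler_peMr ?exprn_ege1// /m ?le_max ?lexx//.
by rewrite ler01.
Qed.

End volume_cvg.

(** * The exponent of G_F *)

Section stieltjes_integral.
Context {R : realType}.
Implicit Types (F : cumulative R R) (a b c : R) (f g : R -> R).
Local Notation mu := lebesgue_stieltjes_measure.

Lemma stieltjes_ocitv F a b : a <= b -> mu F `]a, b]%classic = (F b - F a)%:E.
Proof.
move=> ab; rewrite /lebesgue_stieltjes_measure/= /measure_extension/=.
by rewrite measurable_mu_extE/=; [exact: wlength_itv_bnd|exact: is_ocitv].
Qed.

Lemma stieltjes_ocitv_lty F a b : (mu F `]a, b]%classic < +oo)%E.
Proof.
have [ab|ba] := leP a b; first by rewrite stieltjes_ocitv// ltry.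
by rewrite set_itv_ge ?measure0 ?ltry// -leNgt bnd_simp ltW.
Qed.

Lemma bounded_integrable d (T : measurableType d) (m : {measure set T -> \bar R})
    (D : set T) (f : T -> R) (M : R) : measurable D -> (m D < +oo)%E ->
  measurable_fun D f -> (forall t, D t -> `|f t| <= M) ->
  m.-integrable D (EFin \o f).
Proof.
move=> mD mDoo mf fM; apply: measurable_bounded_integrable => //.
by exists M; split; [exact: num_real|move=> x Mx t /fM/le_trans; apply; exact: ltW].
Qed.

Lemma stieltjes_integrable F a b f M : measurable_fun setT f ->
  (forall t, a < t <= b -> `|f t| <= M) ->
  (mu F).-integrable `]a, b] (EFin \o f).
Proof.
move=> mf fM; apply: (@bounded_integrable _ _ _ _ _ M).
- exact: measurable_itv.
- exact: stieltjes_ocitv_lty.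
- exact: measurable_funTS.
- by move=> t /=; rewrite in_itv; exact: fM.
Qed.

Lemma stieltjes_cst F a b c : a <= b -> \int[mu F]_(t in `]a, b]) c = c * (F b - F a).
Proof.
move=> ab; transitivity (c * fine (mu F `]a, b]%classic)); first exact: Rintegral_cst.
by rewrite stieltjes_ocitv.
Qed.

Lemma stieltjes_itv_split F a b c f : a <= b -> b <= c ->
  (mu F).-integrable `]a, c] (EFin \o f) ->
  \int[mu F]_(t in `]a, c]) f t =
  \int[mu F]_(t in `]a, b]) f t + \int[mu F]_(t in `]b, c]) f t.
Proof.
move=> ab bc intf.
have E : `]a, c]%classic = `]a, b] `|` `]b, c].
  by rewrite (@itv_bndbnd_setU _ _ (BRight a) (BRight b) (BRight c))// bnd_simp.
rewrite E Rintegral_setU//; first by rewrite -E.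
rewrite disj_set2E; apply/eqP/seteqP; split => t //=; rewrite !in_itv/= => -[/andP[_ tb] /andP[bt _]].
by move: (lt_le_trans bt tb); rewrite ltxx.
Qed.

Lemma stieltjes_le F a b f g M : measurable_fun setT f -> measurable_fun setT g ->
  (forall t, a < t <= b -> `|f t| <= M) -> (forall t, a < t <= b -> `|g t| <= M) ->
  (forall t, a < t <= b -> f t <= g t) ->
  \int[mu F]_(t in `]a, b]) f t <= \int[mu F]_(t in `]a, b]) g t.
Proof.
move=> mf mg fM gM fg.
have intf := stieltjes_integrable F mf fM; have intg := stieltjes_integrable F mg gM.
apply: le_Rintegral => // t /=; rewrite in_itv; exact: fg.
Qed.

Lemma cumulative_nd F a b : a <= b -> F a <= F b.
Proof. exact: cumulative_is_nondecreasing. Qed.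

End stieltjes_integral.

Lemma lipschitz_expr (R : realFieldType) (n : nat) (x y M : R) : 0 <= x -> x <= y -> y <= M ->
  y ^+ n - x ^+ n <= n%:R * M ^+ n.-1 * (y - x).
Proof.
move=> x0 xy yM; have y0 := le_trans x0 xy.
rewrite subrXX mulrC ler_wpM2r ?subr_ge0// mulr_natl.
rewrite -[X in _ *+ X](card_ord n) -sumr_const; apply: ler_sum => i _.
have -> : M ^+ n.-1 = M ^+ (n.-1 - i) * M ^+ i.
  by rewrite -exprD subnK//; case: n i => [[]//|n i]; rewrite -ltnS.
by rewrite ler_pM ?exprn_ge0// lerXn2r ?nnegrE// ?(le_trans _ yM)// (le_trans xy).
Qed.

(* [Num.sqrt] vanishes on negative numbers, so [cone_kernel d h] is
   [(h - t)_+ `^ (d / 2)] on the whole line. *)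
Definition cone_kernel {R : realType} (d : nat) (h t : R) : R := Num.sqrt (h - t) ^+ d.

(** This is the exponent V of the overview: the intensity of the solid paraboloid of all (x, t) with
    0 < t <= h and |x|^2 <= h - t. *)
HB.lock Definition cone_volume (R : realType) (d : nat) (F : cumulative R R) (h : R) : R :=
  unit_ball_volume d *
    \int[lebesgue_stieltjes_measure F]_(t in `]0, h]) cone_kernel d h t.
Arguments cone_volume {R} d F h.

Section potential.
Context {R : realType}.
Variable d : nat.
Implicit Types (F : cumulative R R) (h t : R).
Local Notation mu := lebesgue_stieltjes_measure.

Local Notation cone_kernel := (cone_kernel d).
Local Notation cone_volume := (cone_volume d).

Lemma cone_volumeE F h : cone_volume F h =
  unit_ball_volume d * \int[mu F]_(t in `]0, h]) cone_kernel h t.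
Proof. by rewrite unlock. Qed.

Lemma powR_half_cone_kernel h t : t <= h -> (h - t) `^ (d%:R / 2) = cone_kernel h t.
Proof.
move=> th; rewrite mulrC powRrM powR_mulrn ?powR_ge0// powR12_sqrt//.
by rewrite subr_ge0.
Qed.

Lemma G_ofE F z : G_of d F z = \int[mu F]_(h in `]0, z]) expR (- cone_volume F h).
Proof.
rewrite /G_of; apply: eq_Rintegral => h _; rewrite cone_volumeE mulNr; congr (expR (- (_ * _))).
apply: eq_Rintegral => t; rewrite inE/= in_itv/= => /andP[_ th].
exact: powR_half_cone_kernel.
Qed.

Lemma measurable_cone_kernel h : measurable_fun setT (cone_kernel h).
Proof.
apply: measurable_funX; apply: (measurableT_comp (f := @Num.sqrt R) (g := fun t => h - t)).
  by apply: continuous_measurable_fun; exact: sqrt_continuous.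
exact: measurable_funB.
Qed.

Lemma cone_kernel_ge0 h t : 0 <= cone_kernel h t.
Proof. by rewrite exprn_ge0 ?sqrtr_ge0. Qed.

Lemma cone_kernel_le h h' t t' : h - t <= h' - t' -> cone_kernel h t <= cone_kernel h' t'.
Proof. by move=> hh; rewrite lerXn2r ?nnegrE ?sqrtr_ge0// ler_wsqrtr. Qed.

Hypothesis d_gt0 : (0 < d)%N.

Lemma cone_kernel0 h t : h <= t -> cone_kernel h t = 0.
Proof. by move=> ht; rewrite /cone_kernel ler0_sqrtr ?subr_le0// expr0n gtn_eqF. Qed.

Lemma cone_kernel_norm_le h t z : 0 <= t -> h <= z -> `|cone_kernel h t| <= cone_kernel z 0.
Proof.
move=> t0 hz; rewrite ger0_norm ?cone_kernel_ge0// cone_kernel_le//.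
by rewrite lerB.
Qed.

Lemma cone_kernel_integrable F h z :
  (mu F).-integrable `]0, z] (EFin \o cone_kernel h).
Proof.
apply: (@stieltjes_integrable _ F 0 z (cone_kernel h) (cone_kernel h 0)).
  exact: measurable_cone_kernel.
by move=> t /andP[t0 _]; exact: cone_kernel_norm_le (ltW t0) _.
Qed.

(** The kernel vanishes beyond [h], so values of the exponent at different weights can be compared
    under one integral over []0, z]]. *)
Lemma cone_volume_widen F h z : 0 <= h -> h <= z ->
  cone_volume F h = unit_ball_volume d * \int[mu F]_(t in `]0, z]) cone_kernel h t.
Proof.
move=> h0 hz; rewrite cone_volumeE; congr (_ * _).
rewrite (stieltjes_itv_split h0 hz).
  rewrite [X in _ = _ + X](_ : _ = 0) ?addr0//.
  transitivity (\int[mu F]_(t in `]h, z]) (0 : R)); last by rewrite Rintegral_cst ?mul0r.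
  apply: eq_Rintegral => t.
  by rewrite inE/= in_itv/= => /andP[ht _]; rewrite cone_kernel0// ltW.
exact: cone_kernel_integrable.
Qed.

Lemma unit_ball_volume_ge0 : 0 <= @unit_ball_volume R d.
Proof. exact: ltW (unit_ball_volume_gt0 d_gt0). Qed.

Lemma cone_volume_ge0 F h : 0 <= cone_volume F h.
Proof.
rewrite cone_volumeE mulr_ge0 ?unit_ball_volume_ge0//.
by apply: Rintegral_ge0 => t _; exact: cone_kernel_ge0.
Qed.

Lemma cone_volume_nd F h h' : 0 <= h -> h <= h' -> cone_volume F h <= cone_volume F h'.
Proof.
move=> h0 hh; rewrite (cone_volume_widen F h0 hh) cone_volumeE ler_wpM2l ?unit_ball_volume_ge0//.
apply: (@stieltjes_le _ _ _ _ _ _ (cone_kernel h' 0)).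
- exact: measurable_cone_kernel.
- exact: measurable_cone_kernel.
- by move=> t /andP[t0 th]; exact: cone_kernel_norm_le (ltW t0) _.
- by move=> t /andP[t0 th]; exact: cone_kernel_norm_le (ltW t0) _.
- by move=> t _; rewrite cone_kernel_le// lerB.
Qed.

(** Subadditivity of the square root, followed by the Lipschitz bound for the power [d] on the
    interval from 0 to [Num.sqrt z]. *)
Lemma cone_kernel_sub h r t z : 0 <= t -> 0 <= r -> h + r <= z ->
  cone_kernel (h + r) t <= cone_kernel h t + d%:R * Num.sqrt z ^+ d.-1 * Num.sqrt r.
Proof.
move=> t0 r0 hrz; rewrite -lerBlDl.
apply: le_trans (@lipschitz_expr R d (Num.sqrt (h - t)) (Num.sqrt (h + r - t)) (Num.sqrt z) _ _ _) _.
- exact: sqrtr_ge0.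
- by rewrite ler_wsqrtr// lerB// lerDl.
- by rewrite ler_wsqrtr// (le_trans _ hrz)// gerBl.
rewrite ler_wpM2l ?mulr_ge0 ?exprn_ge0 ?sqrtr_ge0//.
rewrite lerBlDl; have [ht|th] := leP h t.
  by rewrite (ler0_sqrtr (a := h - t)) ?subr_le0// add0r ler_wsqrtr// lerBlDl lerD2r.
rewrite -[leRHS]ger0_norm ?addr_ge0 ?sqrtr_ge0// -sqrtr_sqr ler_wsqrtr//.
rewrite sqrrD !sqr_sqrtr ?subr_ge0 ?(ltW th)// mulr2n.
have : 0 <= Num.sqrt (h - t) * Num.sqrt r by rewrite mulr_ge0 ?sqrtr_ge0.
by move: (_ * _) => X X0; lra.
Qed.

(** A Hölder modulus of order 1/2 with explicit constant; it determines how fine a grid is needed,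
    both for the inversion of G and for the exposed points. *)
Lemma cone_volume_sub F h r z : 0 <= h -> 0 <= r -> h + r <= z ->
  cone_volume F (h + r) <= cone_volume F h +
    unit_ball_volume d * (d%:R * Num.sqrt z ^+ d.-1 * (F z - F 0)) * Num.sqrt r.
Proof.
move=> h0 r0 hrz.
have hz : h <= z by rewrite (le_trans _ hrz)// lerDl.
have z0 : 0 <= z by rewrite (le_trans h0).
rewrite (cone_volume_widen F _ hrz) ?addr_ge0// (cone_volume_widen F h0 hz).
rewrite -mulrA -mulrDr ler_wpM2l ?unit_ball_volume_ge0//.
set C := d%:R * _.
have C0 : 0 <= C by rewrite mulr_ge0// exprn_ge0// sqrtr_ge0.
rewrite mulrAC -(stieltjes_cst F (C * Num.sqrt r) z0) -RintegralD//; last 2 first.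
- exact: cone_kernel_integrable.
- by apply: (@stieltjes_integrable _ _ _ _ _ (C * Num.sqrt r)) => // t _; rewrite ger0_norm// mulr_ge0 ?sqrtr_ge0.
apply: (@stieltjes_le _ _ _ _ _ _ (cone_kernel z 0 + C * Num.sqrt r)).
- exact: measurable_cone_kernel.
- by apply: measurable_funD => //; exact: measurable_cone_kernel.
- move=> t /andP[t0 tz]; rewrite (le_trans (cone_kernel_norm_le (ltW t0) hrz))// lerDl.
  by rewrite mulr_ge0 ?sqrtr_ge0.
- move=> t /andP[t0 tz]; rewrite (le_trans (ler_normD _ _))// lerD//.
    exact: cone_kernel_norm_le (ltW t0) hz.
  by rewrite ger0_norm// mulr_ge0 ?sqrtr_ge0.
- by move=> t /andP[t0 _]; apply: cone_kernel_sub => //; exact: ltW.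
Qed.

End potential.

(** * Integration by parts for the exponent *)

Section potential_integral.
Context {R : realType}.
Variable d : nat.
Implicit Types (F : cumulative R R) (h t s : R).
Local Notation mu := lebesgue_stieltjes_measure.
Hypothesis d_ge2 : (2 <= d)%N.

Let d_gt0 : (0 < d)%N := ltnW d_ge2.

(** For [s < h], minus the derivative in [s] of (h - s)^(d/2). With d >= 2 the exponent d/2 - 1 is
    nonnegative, so it stays bounded up to [h]. *)
Definition cone_kernel' h s : R := d%:R / 2 * Num.sqrt (h - s) ^+ d.-2.

Lemma cone_kernel'_ge0 h s : 0 <= cone_kernel' h s.
Proof. by rewrite mulr_ge0 ?exprn_ge0 ?sqrtr_ge0// divr_ge0. Qed.

Lemma continuous_sqrt_sub h : continuous (fun s : R => Num.sqrt (h - s)).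
Proof.
move=> s; apply: (@continuous_comp _ _ _ (fun s => h - s) (@Num.sqrt R)).
  by apply: cvgB; [exact: cvg_cst|exact: cvg_id].
exact: sqrt_continuous.
Qed.

Lemma continuous_cone_kernel n h : continuous (fun s : R => Num.sqrt (h - s) ^+ n).
Proof.
move=> s; apply: (@continuous_comp _ _ _ (fun s => Num.sqrt (h - s)) (fun x : R => x ^+ n)).
  exact: continuous_sqrt_sub.
exact: exprn_continuous.
Qed.

Lemma continuous_cone_kernel' h : continuous (cone_kernel' h).
Proof.
by move=> s; apply: cvgM; [exact: cvg_cst|exact: continuous_cone_kernel].
Qed.

Lemma is_derive_cone_kernel h s : s < h ->
  is_derive s 1 (fun s => - cone_kernel d h s) (cone_kernel' h s).
Proof.
move=> sh; have hs0 : 0 < h - s by rewrite subr_gt0.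
have sq0 : Num.sqrt (h - s) != 0 by rewrite gt_eqF// sqrtr_gt0.
have D1 : is_derive s (1 : R) (fun s => h - s) (- 1).
  by have := is_deriveB (is_derive_cst h s (1 : R)) (is_derive_id s (1 : R)); rewrite sub0r.
have D2 : is_derive s (1 : R) (fun s => Num.sqrt (h - s)) (- (2 * Num.sqrt (h - s))^-1).
  have D3 := is_derive1_sqrt hs0.
  have := @is_derive1_comp _ (@Num.sqrt R) (fun s => h - s) s _ _ D3 D1.
  by rewrite mulrN1.
have D4 : is_derive (Num.sqrt (h - s)) (1 : R) (fun x => x ^+ d)
    (d%:R * Num.sqrt (h - s) ^+ d.-1).
  apply: DeriveDef; first exact: exprn_derivable.
  by rewrite exp_derive scaler1.
have D5 := @is_derive1_comp _ (fun x : R => x ^+ d) (fun s => Num.sqrt (h - s)) s _ _ D4 D2.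
have := is_deriveN D5; rewrite (_ : - (_ * _) = cone_kernel' h s)// /cone_kernel'.
have -> : Num.sqrt (h - s) ^+ d.-1 = Num.sqrt (h - s) ^+ d.-2 * Num.sqrt (h - s).
  by rewrite -exprSr prednK// -subn1 subn_gt0.
by rewrite -mulr_natl invfM; field.
Qed.

(** Differentiability of the kernel is used only below [h]; continuity at [h] suffices for the
    fundamental theorem at that end. *)
Lemma integral_cone_kernel' h t : t <= h ->
  (\int[lebesgue_measure]_(s in `[t, h]) (cone_kernel' h s)%:E = (cone_kernel d h t)%:E)%E.
Proof.
rewrite le_eqVlt => /predU1P[->|th].
  by rewrite set_itv1 integral_set1 cone_kernel0.
rewrite (@continuous_FTC2 _ _ (fun s => - cone_kernel d h s))//.
- by rewrite (cone_kernel0 d_gt0 (lexx h)) oppr0 sub0e -EFinN opprK.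
- by apply: continuous_subspaceT; exact: continuous_cone_kernel'.
- have cF : continuous (fun s => - cone_kernel d h s).
    by move=> s; apply: cvgN; exact: continuous_cone_kernel.
  split.
  + move=> s; rewrite in_itv/= => /andP[_ sh].
    by have [] := is_derive_cone_kernel sh.
  + by apply: cvg_at_right_filter; exact: cF.
  + by apply: cvg_at_left_filter; exact: cF.
- move=> s; rewrite in_itv/= => /andP[_ sh]; rewrite derive1E.
  by have [] := is_derive_cone_kernel sh.
Qed.

Lemma measurable_cone_kernel' h : measurable_fun setT (cone_kernel' h).
Proof. exact: continuous_measurable_fun (@continuous_cone_kernel' h). Qed.

Lemma measurable_cumulative F : measurable_fun setT F.
Proof. exact: nondecreasing_measurable (@cumulative_nd _ F). Qed.

(** Integration by parts through Tonelli: the kernel is the integral of [cone_kernel' h] over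
    [[t, h]], and exchanging the integrals over the triangle 0 < t <= s <= h leaves the mass [F s]
    of []0, s]]. *)
Lemma integral_cone_kernelE F h : distribution_function F -> 0 <= h ->
  (\int[mu F]_(t in `]0%R, h]) (cone_kernel d h t)%:E =
   \int[lebesgue_measure]_(s in `[0%R, h]) (cone_kernel' h s * F s)%:E)%E.
Proof.
move=> F0 h0.
pose A := [set p : R * R | [&& 0 < p.1, p.1 <= p.2 & p.2 <= h]].
have mA : measurable A.
  rewrite (_ : A = (fst @^-1` `]0, +oo[) `&` ((fun p : R * R => p.2 - p.1) @^-1` `[0, +oo[)
    `&` (snd @^-1` `]-oo, h])).
    apply: measurableI; first apply: measurableI; rewrite -[X in measurable X]setTI.
    - by apply: measurable_fst.
    - by apply: measurable_funB.
    - by apply: measurable_snd.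
  apply/seteqP; split => [[t s]|[t s]] /=; rewrite !in_itv/= !andbT subr_ge0.
    by move=> /and3P[].
  by move=> [[? ?] ?]; apply/and3P; split.
have inA t s : ((t, s) \in A) = [&& 0 < t, t <= s & s <= h].
  by apply/idP/idP; rewrite inE.
pose g : R * R -> \bar R := (EFin \o (cone_kernel' h \o snd)) \_ A.
have mg : measurable_fun setT g.
  apply/(measurable_restrictT _ mA); apply: measurable_funTS.
  apply/measurable_EFinP; apply: measurableT_comp; last exact: measurable_snd.
  exact: measurable_cone_kernel'.
have g0 x : (0 <= g x)%E.
  by rewrite /g patchE; case: ifP => // _; rewrite lee_fin cone_kernel'_ge0.
transitivity (\int[mu F]_t \int[lebesgue_measure]_s g (t, s))%E.
  rewrite integral_mkcond.
  apply: eq_integral => t _; rewrite patchE.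
  case: ifPn => [|].
    rewrite inE/= in_itv/= => /andP[t0 th]; rewrite -integral_cone_kernel'// integral_mkcond.
    apply: eq_integral => s _; rewrite /g !patchE; congr (if _ then _ else _).
    rewrite inA t0/=; by apply/idP/idP; rewrite inE/= in_itv.
  rewrite notin_setE/= in_itv/= => /negP th.
  rewrite integral0_eq// => s _; rewrite /g patchE; case: ifPn => //.
  rewrite inA => /and3P[t0 ts sh]; case: th; by rewrite t0 (le_trans ts).
have -> : (\int[mu F]_t \int[lebesgue_measure]_s g (t, s) =
    \int[lebesgue_measure]_s \int[mu F]_t g (t, s))%E by exact: fubini_tonelli.
rewrite [RHS]integral_mkcond.
apply: eq_integral => s _; rewrite patchE.
case: ifPn => [|].
  rewrite inE/= in_itv/= => /andP[s0 sh].
  transitivity (\int[mu F]_(t in `]0%R, s]) (cone_kernel' h s)%:E)%E.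
    rewrite [RHS]integral_mkcond; apply: eq_integral => t _; rewrite /g !patchE.
    congr (if _ then _ else _).
    rewrite inA sh andbT; by apply/idP/idP; rewrite inE/= in_itv.
  transitivity ((cone_kernel' h s)%:E * mu F `]0%R, s]%classic)%E; first exact: integral_cst.
  by rewrite stieltjes_ocitv// (F0 0)// subr0 EFinM.
rewrite notin_setE/= in_itv/= => /negP th.
rewrite integral0_eq// => t _; rewrite /g patchE; case: ifPn => //.
rewrite inA => /and3P[t0 ts sh]; case: th; by rewrite sh (le_trans (ltW t0)).
Qed.

Lemma cone_volume_integral F h : distribution_function F -> 0 <= h ->
  cone_volume d F h = unit_ball_volume d *
    \int[lebesgue_measure]_(s in `[0, h]) (cone_kernel' h s * F s).
Proof. by move=> F0 h0; rewrite cone_volumeE /Rintegral integral_cone_kernelE. Qed.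

Lemma distribution_function_ge0 F s : distribution_function F -> 0 <= F s.
Proof.
move=> F0; have [s0|s0] := leP 0 s; last by rewrite F0// ltW.
by rewrite -(F0 0)//; exact: cumulative_nd.
Qed.

Lemma lebesgue_itv_lty (a b : R) : (lebesgue_measure `[a, b]%classic < +oo)%E.
Proof. by rewrite lebesgue_measure_itv/=; case: ifP => _; rewrite -?EFinB ltry. Qed.

Lemma lebesgue_integrable_itv (a b M : R) (f : R -> R) : measurable_fun setT f ->
  (forall s, a <= s <= b -> `|f s| <= M) ->
  (@lebesgue_measure R).-integrable `[a, b] (EFin \o f).
Proof.
move=> mf fM; apply: (@bounded_integrable _ _ _ _ _ _ M); [exact: measurable_itv|
  exact: lebesgue_itv_lty|exact: measurable_funTS|].
by move=> t /=; rewrite in_itv; exact: fM.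
Qed.

Lemma cumulative_norm_le F s z : distribution_function F -> s <= z -> `|F s| <= F z.
Proof.
by move=> F0 sz; rewrite ger0_norm ?distribution_function_ge0//; exact: cumulative_nd.
Qed.

Lemma cumulative_dist_le F F' s z : distribution_function F -> distribution_function F' ->
  s <= z -> `|F s - F' s| <= F z + F' z.
Proof.
by move=> F0 F'0 sz; rewrite (le_trans (ler_normB _ _))// lerD// cumulative_norm_le.
Qed.

Lemma integrable_cumulative_dist F F' a b :
  distribution_function F -> distribution_function F' ->
  (@lebesgue_measure R).-integrable `[a, b] (EFin \o (fun s => `|F s - F' s|)).
Proof.
move=> F0 F'0; apply: (@lebesgue_integrable_itv _ _ (F b + F' b)).
  apply: measurableT_comp => //; apply: measurable_funB; exact: measurable_cumulative.
by move=> s /andP[_ sb]; rewrite normr_id cumulative_dist_le.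
Qed.

Lemma cone_kernel'_le h z s : 0 <= s -> h <= z ->
  `|cone_kernel' h s| <= d%:R / 2 * Num.sqrt z ^+ d.-2.
Proof.
move=> s0 hz; rewrite ger0_norm ?cone_kernel'_ge0//.
rewrite ler_wpM2l ?divr_ge0// lerXn2r ?nnegrE ?sqrtr_ge0// ler_wsqrtr//.
by rewrite (le_trans _ hz)// gerBl.
Qed.

Lemma integrable_cone_kernel'M F h : distribution_function F ->
  (@lebesgue_measure R).-integrable `[0, h] (EFin \o (fun s => cone_kernel' h s * F s)).
Proof.
move=> F0; apply: (@lebesgue_integrable_itv _ _ (d%:R / 2 * Num.sqrt h ^+ d.-2 * F h)).
  by apply: measurable_funM; [exact: measurable_cone_kernel'|exact: measurable_cumulative].
move=> s /andP[s0 sh]; rewrite normrM ler_pM//; first exact: cone_kernel'_le.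
exact: cumulative_norm_le.
Qed.

Lemma cone_volume_dist F F' h z :
  distribution_function F -> distribution_function F' -> 0 <= h -> h <= z ->
  `|cone_volume d F h - cone_volume d F' h| <=
  unit_ball_volume d * (d%:R / 2 * Num.sqrt z ^+ d.-2) *
    \int[lebesgue_measure]_(s in `[0, h]) `|F s - F' s|.
Proof.
move=> F0 F'0 h0 hz; rewrite !cone_volume_integral// -mulrBr normrM.
rewrite ger0_norm ?unit_ball_volume_ge0// -mulrA ler_wpM2l ?unit_ball_volume_ge0//.
have iF := integrable_cone_kernel'M h F0; have iF' := integrable_cone_kernel'M h F'0.
rewrite -RintegralB//.
have iB : (@lebesgue_measure R).-integrable `[0, h]
    (EFin \o (fun s => cone_kernel' h s * F s - cone_kernel' h s * F' s)).
  rewrite (_ : _ \o _ = ((EFin \o (fun s => (cone_kernel' h s * F s)%R)) \-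
    (EFin \o (fun s => (cone_kernel' h s * F' s)%R)))%E)//.
  exact: (integrableB _ iF iF').
apply: le_trans (le_normr_Rintegral _ iB) _ => //.
have iD := integrable_cumulative_dist 0 h F0 F'0.
rewrite -RintegralZl//; apply: le_Rintegral => //.
- exact: integrable_norm iB.
- apply: (@lebesgue_integrable_itv _ _ (d%:R / 2 * Num.sqrt z ^+ d.-2 * (F h + F' h))).
    apply: measurable_funM => //; apply: measurableT_comp => //.
    by apply: measurable_funB; exact: measurable_cumulative.
  move=> s /andP[_ sh]; rewrite normrM normr_id ger0_norm; last first.
    by rewrite mulr_ge0 ?exprn_ge0 ?sqrtr_ge0// divr_ge0.
  apply: ler_wpM2l; last exact: cumulative_dist_le.
  by rewrite mulr_ge0 ?exprn_ge0 ?sqrtr_ge0// divr_ge0.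
- move=> s /=; rewrite in_itv/= => /andP[s0 sh].
  by rewrite -mulrBr normrM ler_wpM2r// cone_kernel'_le.
Qed.

End potential_integral.

(** * Continuity of the inverse of G *)

Section gronwall.
Context {R : realType}.

(** On a step no longer than 1/(2C), half of [D c] is absorbed by the left side, which gives D c <=
    2 D h + 2 eta. The inequality is available only while D <= 1, so it is applied at a point where
    a violation of the bound first has to be caught below that threshold. *)
Lemma gronwall_step (D : R -> R) (C eta B h h' : R) : h <= h' ->
  {within `[h, h'], continuous D} ->
  C * (h' - h) <= 2^-1 -> 0 <= C -> D h <= B -> 2 * B + 2 * eta < 1 -> B <= 2 * B + 2 * eta ->
  (forall c, h <= c <= h' -> 0 <= D c -> D c <= 1 -> D c <= D h + C * D c * (c - h) + eta) ->
  0 <= D h -> D h' <= 2 * B + 2 * eta.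
Proof.
move=> hh cD Ch C0 DhB B1 BB H Dh0; rewrite leNgt; apply/negP => DB.
(* Capping at 1 keeps the inequality applicable at the point where [D] takes the value [v]; such a
   point exists by continuity. *)
pose v := Num.min (D h') 1.
have vB : 2 * B + 2 * eta < v by rewrite lt_min DB.
have Dhv : D h <= v by rewrite ltW// (le_lt_trans _ vB)// (le_trans DhB).
have [c + Dc] : exists2 c, c \in `[h, h'] & D c = v.
  have vD : v <= D h' by rewrite /v ge_min lexx.
  by apply: IVT => //; rewrite ge_min Dhv/= le_max vD orbT.
rewrite in_itv/= => /andP[hc ch].
have v0 : 0 <= v by rewrite (le_trans Dh0).
have := H c; rewrite hc ch Dc => /(_ isT v0); rewrite {1}/v ge_min lexx orbT => /(_ isT) Hv.
have C1 : C * v * (c - h) <= 2^-1 * v.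
  rewrite mulrAC ler_wpM2r// (le_trans _ Ch)// ler_wpM2l// lerB//.
lra.
Qed.

(** [N] steps of length z/N. The bound (2^(i+1) - 2) eta solves the recursion b_(i+1) = 2 b_i + 2
    eta with b_0 = 0. *)
Lemma gronwall (D : R -> R) (C eta z : R) (N : nat) : (0 < N)%N -> 0 <= z -> 0 <= C ->
  2 * C * z <= N%:R -> 0 <= eta -> 2 ^+ N.+1 * eta < 1 ->
  {within `[0, z], continuous D} -> D 0 = 0 -> (forall h, 0 <= h <= z -> 0 <= D h) ->
  (forall h h', 0 <= h -> h <= h' -> h' <= z -> D h' <= 1 ->
     D h' <= D h + C * D h' * (h' - h) + eta) ->
  D z <= 2 ^+ N.+1 * eta.
Proof.
move=> N0 z0 C0 CN eta0 eta1 cD D0 Dge0 H.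
have N0' : N%:R != 0 :> R by rewrite pnatr_eq0 -lt0n.
pose s (i : nat) := z * (i%:R / N%:R).
have s_ge0 i : 0 <= s i by rewrite /s mulr_ge0// divr_ge0.
have s_le i : (i <= N)%N -> s i <= z.
  by move=> iN; rewrite ler_piMr// ler_pdivrMr ?ltr0n// mul1r ler_nat.
have s_nd i : s i <= s i.+1 by rewrite /s ler_wpM2l// ler_wpM2r ?invr_ge0// ler_nat.
suff S i : (i <= N)%N -> D (s i) <= (2 ^+ i.+1 - 2) * eta.
  have := S N (leqnn N); rewrite /s mulfV// mulr1 mulrBl => /le_trans; apply.
  by rewrite gerBl mulr_ge0.
elim: i => [_|i ih iN]; first by rewrite /s mul0r mulr0 D0 expr1 subrr mul0r.
have p1 : 1 <= 2 ^+ i.+1 :> R by rewrite exprn_ege1// ler1n.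
have pN : 2 ^+ i.+1 <= 2 ^+ N :> R by rewrite ler_eXn2l// ltr1n.
have E : (2 ^+ i.+2 - 2) * eta = 2 * ((2 ^+ i.+1 - 2) * eta) + 2 * eta.
  by rewrite (exprS 2 i.+1); ring.
rewrite E; apply: (@gronwall_step D C eta _ (s i)) => //.
- apply: continuous_subspaceW cD => t /=; rewrite !in_itv/= => /andP[st ts].
  by rewrite (le_trans (s_ge0 i))//= (le_trans ts)// s_le.
- have -> : s i.+1 - s i = z / N%:R by rewrite /s -natr1; field.
  rewrite mulrA ler_pdivrMr ?ltr0n//; lra.
- exact: ih (ltnW iN).
- rewrite -E; apply: le_lt_trans eta1; rewrite ler_wpM2r//.
  rewrite lerBlDr (le_trans (_ : _ <= 2 ^+ N.+1))// ?lerDl//.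
  by rewrite ler_eXn2l ?ltr1n// !ltnS.
- have : 0 <= (2 ^+ i.+1 - 2) * eta.
    by rewrite mulr_ge0// subr_ge0 exprS ler_peMr// exprn_ege1// ler1n.
  lra.
- move=> c /andP[sc cs] _; apply: H => //.
  by rewrite (le_trans cs)// s_le.
- by apply: Dge0; rewrite s_ge0 s_le// ltnW.
Qed.

End gronwall.

Lemma cvg_sum_ord (R : realType) (m : nat) (f : nat -> 'I_m -> R) (l : 'I_m -> R) :
  (forall i, f n i @[n --> \oo] --> l i) ->
  \sum_(i < m) f n i @[n --> \oo] --> \sum_(i < m) l i.
Proof.
elim: m f l => [|m ih] f l fl.
  by under eq_fun do rewrite big_ord0; rewrite big_ord0; exact: cvg_cst.
under eq_fun do rewrite big_ord_recr/=.
rewrite big_ord_recr/=; apply: cvgD; last exact: fl.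
by apply: ih => i; exact: fl.
Qed.

(** * Reweighting the measure G_F by the limiting exponent *)

Section stability.
Context {R : realType}.
Variable d : nat.
Implicit Types (F : cumulative R R) (h t s z : R).
Local Notation mu := lebesgue_stieltjes_measure.
Local Notation V := (cone_volume d).
Hypothesis d_ge2 : (2 <= d)%N.

Let d_gt0 : (0 < d)%N := ltnW d_ge2.

Lemma cone_volume_le0 F h : h <= 0 -> V F h = 0.
Proof.
by move=> h0; rewrite cone_volumeE set_itv_ge ?Rintegral_set0 ?mulr0// -leNgt bnd_simp.
Qed.

Lemma cone_volume_ndT F h h' : h <= h' -> V F h <= V F h'.
Proof.
move=> hh; have [h0|h0] := leP 0 h; first exact: cone_volume_nd.
by rewrite cone_volume_le0 ?(ltW h0)// cone_volume_ge0.
Qed.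

Lemma measurable_cone_volumeT F : measurable_fun setT (V F).
Proof. by apply: nondecreasing_measurable => // h h'; exact: cone_volume_ndT. Qed.

Lemma measurable_expR_comp (f : R -> R) : measurable_fun setT f ->
  measurable_fun setT (fun t => expR (f t)).
Proof. by move=> mf; apply: measurableT_comp => //; exact: measurable_expR. Qed.

Lemma measurable_weight F F' : measurable_fun setT (fun t => expR (V F t - V F' t)).
Proof.
by apply: measurable_expR_comp; apply: measurable_funB; exact: measurable_cone_volumeT.
Qed.

Lemma weight_le F F' t h : t <= h -> `|expR (V F t - V F' t)| <= expR (V F h).
Proof.
move=> th; rewrite ger0_norm ?expR_ge0// ler_expR.
by rewrite lerBlDr (le_trans (cone_volume_ndT F th))// lerDl cone_volume_ge0.
Qed.

Lemma weight_integrable F F' a b :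
  (mu F').-integrable `]a, b] (EFin \o (fun t => expR (V F t - V F' t))).
Proof.
apply: (@stieltjes_integrable _ _ _ _ _ (expR (V F b))); first exact: measurable_weight.
by move=> t /andP[_ tb]; exact: weight_le.
Qed.

Lemma measurable_expN F : measurable_fun setT (fun t => expR (- V F t)).
Proof. by apply: measurable_expR_comp; apply: measurableT_comp => //; exact: measurable_cone_volumeT. Qed.

Lemma expN_le1 F t : `|expR (- V F t)| <= 1.
Proof. by rewrite ger0_norm ?expR_ge0// -expR0 ler_expR oppr_le0 cone_volume_ge0. Qed.

Lemma expN_integrable F a b : (mu F).-integrable `]a, b] (EFin \o (fun t => expR (- V F t))).
Proof. exact: (stieltjes_integrable _ (measurable_expN F) (fun t _ => expN_le1 F t)). Qed.

(* This is the integral of [expR (V F)] with respect to [G_of d F']. *)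
Definition weighted F F' h := \int[mu F']_(t in `]0, h]) expR (V F t - V F' t).

Lemma weighted_id F h : distribution_function F -> 0 <= h -> weighted F F h = F h.
Proof.
move=> F0 h0; rewrite /weighted.
transitivity (\int[mu F]_(t in `]0, h]) (1 : R)).
  by apply: eq_Rintegral => t _; rewrite subrr expR0.
by rewrite stieltjes_cst// (F0 0)// subr0 mul1r.
Qed.

Lemma G_of_diff F a b : 0 <= a -> a <= b ->
  G_of d F b - G_of d F a = \int[mu F]_(t in `]a, b]) expR (- V F t).
Proof.
move=> a0 ab; rewrite 2!G_ofE (stieltjes_itv_split a0 ab (expN_integrable F 0 b)).
by rewrite addrAC subrr add0r.
Qed.

Lemma G_of0 F : G_of d F 0 = 0.
Proof. by rewrite G_ofE set_itv_ge ?Rintegral_set0// -leNgt bnd_simp. Qed.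

Lemma G_of_diff_ge0 F a b : 0 <= a -> a <= b -> 0 <= G_of d F b - G_of d F a.
Proof. by move=> a0 ab; rewrite G_of_diff// Rintegral_ge0// => t _; exact: expR_ge0. Qed.

Lemma G_of_diff_le F a b : 0 <= a -> a <= b -> G_of d F b - G_of d F a <= F b - F a.
Proof.
move=> a0 ab; rewrite G_of_diff// -[leRHS]mul1r -stieltjes_cst//.
apply: (@stieltjes_le _ _ _ _ _ _ 1) => //; first exact: measurable_expN.
- by move=> t _; exact: expN_le1.
- by move=> t _; rewrite normr1.
- by move=> t _; rewrite (le_trans (ler_norm _))// expN_le1.
Qed.

(** [V F] is nondecreasing, so it may be frozen at the left end. What remains of [F'] is an
    increment of [G_of d F'], the quantity whose convergence is known. *)
Lemma weighted_itv_ge F F' a b : 0 <= a -> a <= b ->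
  expR (V F a) * (G_of d F' b - G_of d F' a) <=
  \int[mu F']_(t in `]a, b]) expR (V F t - V F' t).
Proof.
move=> a0 ab; rewrite G_of_diff// -RintegralZl//; last exact: expN_integrable.
apply: (@stieltjes_le _ _ _ _ _ _ (expR (V F b))).
- by apply: measurable_funM => //; exact: measurable_expN.
- exact: measurable_weight.
- move=> t /andP[at' tb]; rewrite normrM (ger0_norm (expR_ge0 _)) -[leRHS]mulr1.
  apply: ler_pM; [exact: expR_ge0|exact: normr_ge0| |exact: expN_le1].
  by rewrite ler_expR; exact: cone_volume_ndT.
- by move=> t /andP[_ tb]; exact: weight_le.
- move=> t /andP[at' tb]; rewrite expRD; apply: ler_wpM2r; first exact: expR_ge0.
  by rewrite ler_expR; exact/cone_volume_ndT/ltW.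
Qed.

Lemma weighted_itv_le F F' a b : 0 <= a -> a <= b ->
  \int[mu F']_(t in `]a, b]) expR (V F t - V F' t) <=
  expR (V F b) * (G_of d F' b - G_of d F' a).
Proof.
move=> a0 ab; rewrite G_of_diff// -RintegralZl//; last exact: expN_integrable.
apply: (@stieltjes_le _ _ _ _ _ _ (expR (V F b))).
- exact: measurable_weight.
- by apply: measurable_funM => //; exact: measurable_expN.
- by move=> t /andP[_ tb]; exact: weight_le.
- move=> t /andP[at' tb]; rewrite normrM (ger0_norm (expR_ge0 _)) -[leRHS]mulr1.
  by apply: ler_pM; [exact: expR_ge0|exact: normr_ge0|exact: lexx|exact: expN_le1].
- move=> t /andP[at' tb]; rewrite expRD; apply: ler_wpM2r; first exact: expR_ge0.
  by rewrite ler_expR; exact: cone_volume_ndT.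
Qed.

Lemma stieltjes_partition F (f : R -> R) (s : nat -> R) (m : nat) :
  (forall i, s i <= s i.+1) -> (forall a b, (mu F).-integrable `]a, b] (EFin \o f)) ->
  \int[mu F]_(t in `]s 0%N, s m]) f t = \sum_(i < m) \int[mu F]_(t in `]s i, s i.+1]) f t.
Proof.
move=> snd intf; elim: m => [|m ih].
  by rewrite big_ord0 set_itv_ge ?Rintegral_set0// bnd_simp ltxx.
rewrite big_ord_recr/= -ih (@stieltjes_itv_split _ F (s 0%N) (s m) (s m.+1))//.
by elim: m {ih} => // m /le_trans; exact.
Qed.

Lemma expR_sub_le (x y : R) : x <= y -> expR y - expR x <= expR y * (y - x).
Proof.
move=> xy; have -> : expR x = expR y * expR (x - y) by rewrite -expRD subrKC.
rewrite -{1}[expR y]mulr1 -mulrBr ler_wpM2l ?expR_ge0//.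
by have := expR_ge1Dx (x - y); lra.
Qed.

Definition grid (h : R) (m : nat) (i : nat) : R := h * (i%:R / m.+1%:R).

Lemma grid_ge0 h m i : 0 <= h -> 0 <= grid h m i.
Proof. by move=> h0; rewrite mulr_ge0// divr_ge0. Qed.

Lemma grid0 h m : grid h m 0 = 0.
Proof. by rewrite /grid mul0r mulr0. Qed.

Lemma grid_last h m : grid h m m.+1 = h.
Proof. by rewrite /grid mulfV ?mulr1. Qed.

Lemma gridS h m i : grid h m i.+1 = grid h m i + h / m.+1%:R.
Proof. by rewrite /grid -[i.+1%:R]natr1 mulrDl mulrDr mul1r. Qed.

Lemma grid_nd h m i : 0 <= h -> grid h m i <= grid h m i.+1.
Proof. by move=> h0; rewrite gridS lerDl divr_ge0. Qed.

Lemma grid_le h m i : 0 <= h -> (i <= m.+1)%N -> grid h m i <= h.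
Proof. by move=> h0 im; rewrite ler_piMr// ler_pdivrMr ?ltr0n// mul1r ler_nat. Qed.

Lemma stieltjes_grid F (f : R -> R) h m : 0 <= h ->
  (forall a b, (mu F).-integrable `]a, b] (EFin \o f)) ->
  \int[mu F]_(t in `]0, h]) f t =
  \sum_(i < m.+1) \int[mu F]_(t in `]grid h m i, grid h m i.+1]) f t.
Proof.
move=> h0 intf.
have := stieltjes_partition m.+1 (fun i => grid_nd m i h0) intf.
by rewrite grid_last grid0.
Qed.

Lemma cvg_sqrt_grid (C h e : R) : 0 <= h -> 0 < e ->
  exists m : nat, C * Num.sqrt (h / m.+1%:R) <= e.
Proof.
move=> h0 e0; pose x := (Num.max C 0 / e) ^+ 2 * h.
exists (Num.truncn x); have := truncnS_gt x; set m := Num.truncn x => xm.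
have m0 : 0 < m.+1%:R :> R by rewrite ltr0n.
apply: (@le_trans _ _ (Num.max C 0 * Num.sqrt (h / m.+1%:R))).
  by rewrite ler_wpM2r ?sqrtr_ge0// le_max lexx.
have c0 : 0 <= Num.max C 0 by rewrite le_max lexx orbT.
rewrite -[Num.max C 0]ger0_norm// -[in leLHS]sqrtr_sqr -sqrtrM ?sqr_ge0//.
rewrite -[leRHS]ger0_norm ?(ltW e0)// -[leRHS]sqrtr_sqr ler_wsqrtr//.
rewrite mulrA ler_pdivrMr// mulrC; apply: ltW.
rewrite mulrC [ltRHS]mulrC -ltr_pdivrMr ?exprn_gt0//.
by move: xm; rewrite /x expr_div_n mulrAC.
Qed.

Lemma weighted_ge F F' h m : 0 <= h ->
  \sum_(i < m.+1) expR (V F (grid h m i)) *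
    (G_of d F' (grid h m i.+1) - G_of d F' (grid h m i)) <= weighted F F' h.
Proof.
move=> h0; rewrite /weighted (stieltjes_grid m h0 (weight_integrable F F')).
by apply: ler_sum => i _; apply: weighted_itv_ge; rewrite ?grid_ge0 ?grid_nd.
Qed.

Lemma weighted_le F F' h m : 0 <= h ->
  weighted F F' h <= \sum_(i < m.+1) expR (V F (grid h m i.+1)) *
    (G_of d F' (grid h m i.+1) - G_of d F' (grid h m i)).
Proof.
move=> h0; rewrite /weighted (stieltjes_grid m h0 (weight_integrable F F')).
by apply: ler_sum => i _; apply: weighted_itv_le; rewrite ?grid_ge0 ?grid_nd.
Qed.

Lemma G_grid_telescope F h m :
  \sum_(i < m.+1) (G_of d F (grid h m i.+1) - G_of d F (grid h m i)) = G_of d F h.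
Proof.
rewrite -(big_mkord xpredT (fun i => G_of d F (grid h m i.+1) - G_of d F (grid h m i))).
by rewrite telescope_sumr// grid_last grid0 G_of0 subr0.
Qed.

Lemma cone_volume_grid F h m i : 0 <= h -> (i < m.+1)%N ->
  V F (grid h m i.+1) - V F (grid h m i) <=
  unit_ball_volume d * (d%:R * Num.sqrt h ^+ d.-1 * (F h - F 0)) * Num.sqrt (h / m.+1%:R).
Proof.
move=> h0 im; rewrite lerBlDl gridS cone_volume_sub ?grid_ge0 ?divr_ge0//.
by rewrite -gridS grid_le.
Qed.

(** On a fixed grid the lower and upper sums are finite combinations of values of G, hence converge;
    both enclose [F h] in the limit, because [weighted F F] is [F]. The Hölder modulus of [V F]
    makes their difference small. *)
Lemma weighted_cvg F (Fn : nat -> cumulative R R) h : distribution_function F -> 0 <= h ->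
  (forall z, 0 <= z -> G_of d (Fn n) z @[n --> \oo] --> G_of d F z) ->
  weighted F (Fn n) h @[n --> \oo] --> F h.
Proof.
move=> F0 h0 GG; apply/cvgrPdist_le => e e0.
(* Up to the factor [Num.sqrt (h / m.+1%:R)], this bounds the gap between the sums: increments of
   [expR (V F)] are at most [expR (V F h)] times those of [V F], and the increments of G add up to
   [G_of d F h]. *)
pose C := expR (V F h) *
  (unit_ball_volume d * (d%:R * Num.sqrt h ^+ d.-1 * (F h - F 0))) * G_of d F h.
have [m Cm] := cvg_sqrt_grid C h0 (divr_gt0 e0 (ltr0n R 2)).
pose L F' := \sum_(i < m.+1) expR (V F (grid h m i)) *
    (G_of d F' (grid h m i.+1) - G_of d F' (grid h m i)).
pose U F' := \sum_(i < m.+1) expR (V F (grid h m i.+1)) *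
    (G_of d F' (grid h m i.+1) - G_of d F' (grid h m i)).
have cvgS (c : nat -> R) :
   \sum_(i < m.+1) c i * (G_of d (Fn n) (grid h m i.+1) - G_of d (Fn n) (grid h m i)) @[n --> \oo] -->
   \sum_(i < m.+1) c i * (G_of d F (grid h m i.+1) - G_of d F (grid h m i)).
  apply: cvg_sum_ord => i; apply: cvgM; first exact: cvg_cst.
  by apply: cvgB; apply: GG; exact: grid_ge0.
have LU : U F - L F <= e / 2.
  apply: le_trans Cm; rewrite /U /L -sumrB.
  rewrite /C -(G_grid_telescope F h m) mulr_sumr mulr_suml.
  apply: ler_sum => i _; rewrite -mulrBl.
  rewrite [leRHS]mulrAC ler_wpM2r ?G_of_diff_ge0 ?grid_ge0 ?grid_nd//.
  apply: le_trans (expR_sub_le (cone_volume_ndT F (grid_nd m i h0))) _.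
  rewrite -[leRHS]mulrA; apply: ler_pM.
  - exact: expR_ge0.
  - by rewrite subr_ge0; apply: cone_volume_ndT; exact: grid_nd.
  - by rewrite ler_expR; apply: cone_volume_ndT; exact: grid_le.
  - exact: cone_volume_grid.
have e20 : 0 < e / 2 by rewrite divr_gt0.
have LF := weighted_ge F F m h0; have UF := weighted_le F F m h0.
rewrite weighted_id// -/(L F) in LF; rewrite weighted_id// -/(U F) in UF.
have HL : \forall n \near \oo, `|L F - L (Fn n)| <= e / 2.
  by have /cvgrPdist_le/(_ _ e20) := cvgS (fun i => expR (V F (grid h m i))); exact.
have HU : \forall n \near \oo, `|U F - U (Fn n)| <= e / 2.
  by have /cvgrPdist_le/(_ _ e20) := cvgS (fun i => expR (V F (grid h m i.+1))); exact.
have HW n := conj (weighted_ge F (Fn n) m h0) (weighted_le F (Fn n) m h0).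
have {}HW n : L (Fn n) <= weighted F (Fn n) h <= U (Fn n) by apply/andP; exact: HW.
move: (L) (U) LU LF UF HL HU HW => {}L {}U LU LF UF HL HU HW.
apply: filterS2 HL HU => n; move: (HW n).
move: (L _) (L _) (U _) (U _) (weighted _ _ _) LU LF UF => l1 l2 u1 u2 w LU LF UF.
rewrite !ler_norml => /andP[h1 h2] /andP[h3 h4] /andP[h5 h6].
by apply/andP; split; lra.
Qed.

End stability.

Section lebesgue_primitive.
Context {R : realType}.
Variables (g : R -> R) (z M : R).
Hypothesis mg : measurable_fun setT g.
Hypothesis g0 : forall s, 0 <= g s.
Hypothesis gM : forall s, 0 <= s <= z -> g s <= M.

Definition primitive h := \int[lebesgue_measure]_(s in `[0, h]) g s.

Lemma primitive_integrable h : h <= z ->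
  (@lebesgue_measure R).-integrable `[0, h] (EFin \o g).
Proof.
move=> hz; apply: (@lebesgue_integrable_itv _ _ _ M) => // s /andP[s0 sh].
by rewrite ger0_norm// gM// s0 (le_trans sh).
Qed.

Lemma primitive_ge0 h : 0 <= primitive h.
Proof. exact: Rintegral_ge0. Qed.

Lemma primitive_diff h h' : 0 <= h -> h <= h' -> h' <= z ->
  primitive h' - primitive h = \int[lebesgue_measure]_(s in `]h, h']) g s.
Proof.
move=> h0 hh hz; rewrite /primitive (@Rintegral_itvB _ g (BLeft 0) (BRight h') h)//.
exact: primitive_integrable.
Qed.

Lemma primitive_nd h h' : 0 <= h -> h <= h' -> h' <= z -> primitive h <= primitive h'.
Proof.
by move=> h0 hh hz; rewrite -subr_ge0 primitive_diff//; exact: Rintegral_ge0.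
Qed.

Lemma primitive0 : primitive 0 = 0.
Proof. by rewrite /primitive set_itv1 Rintegral_set1. Qed.

Lemma primitive_continuous : 0 <= z -> {within `[0, z], continuous primitive}.
Proof.
by move=> z0; apply: parameterized_integral_continuous => //; exact: primitive_integrable.
Qed.

Lemma primitive_diff_le c (eps : R -> R) h h' : 0 <= h -> h <= h' -> h' <= z ->
  (@lebesgue_measure R).-integrable `]h, h'] (EFin \o eps) ->
  (forall s, h < s <= h' -> g s <= c + eps s) ->
  primitive h' - primitive h <= c * (h' - h) + \int[lebesgue_measure]_(s in `]h, h']) eps s.
Proof.
move=> h0 hh hz ieps gc; rewrite primitive_diff//.
have ic : (@lebesgue_measure R).-integrable `]h, h'] (EFin \o cst c).
  exact: (@stieltjes_integrable _ idfun _ _ _ `|c|).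
have <- : \int[lebesgue_measure]_(s in `]h, h']) c = c * (h' - h).
  exact: (@stieltjes_cst _ idfun).
have ig : (@lebesgue_measure R).-integrable `]h, h'] (EFin \o g).
  apply: integrableS (primitive_integrable hz) => //.
  by move=> s /=; rewrite !in_itv/= => /andP[hs ->]; rewrite (ltW (le_lt_trans h0 hs)).
rewrite -RintegralD//; apply: le_Rintegral => //; exact: (integrableD _ ic ieps).
Qed.

End lebesgue_primitive.

Lemma norm_expR_sub1_le (R : realType) (x : R) : `|1 - expR x| <= `|x| * expR `|x|.
Proof.
have [x0|x0] := leP 0 x.
  rewrite distrC ger0_norm; last by rewrite subr_ge0 -expR0 ler_expR.
  rewrite ger0_norm// mulrC; have := expR_sub_le x0; rewrite expR0 subr0; exact.
rewrite ger0_norm; last by rewrite subr_ge0 -expR0 ler_expR ltW.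
have := expR_sub_le (ltW x0); rewrite expR0 sub0r mul1r => /le_trans; apply.
rewrite ltr0_norm// ler_peMr ?oppr_ge0 ?ltW//.
by rewrite -expR0 ltr_expR oppr_gt0.
Qed.

Lemma stieltjesZl (R : realType) (F : cumulative R R) (a b c : R) (f : R -> R) :
  (lebesgue_stieltjes_measure F).-integrable `]a, b] (EFin \o f) ->
  \int[lebesgue_stieltjes_measure F]_(t in `]a, b]) (c * f t) =
  c * \int[lebesgue_stieltjes_measure F]_(t in `]a, b]) f t.
Proof. by move=> intf; rewrite RintegralZl. Qed.

Lemma lower_shift (R : realDomainType) (a b c e C : R) :
  - e <= a - c -> e <= C -> a <= b -> 0 <= b + C + - c.
Proof. lra. Qed.

(** * Stability and uniqueness of the inverse *)

Section stability_theorem.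
Context {R : realType}.
Variable d : nat.
Implicit Types (F : cumulative R R) (h t s z : R).
Local Notation mu := lebesgue_stieltjes_measure.
Local Notation V := (cone_volume d).
Hypothesis d_ge2 : (2 <= d)%N.

Let d_gt0 : (0 < d)%N := ltnW d_ge2.

(** The L^1 distance on [[0, h]] as a function of [h]. It controls the difference of the exponents
    and is continuous in [h] even where [F] or [F'] jumps, as the bootstrap requires. *)
Definition cumulative_dist F F' : R -> R := primitive (fun s => `|F s - F' s|).

Definition dist_const z : R := unit_ball_volume d * (d%:R / 2 * Num.sqrt z ^+ d.-2).

Lemma dist_const_ge0 z : 0 <= dist_const z.
Proof.
by rewrite mulr_ge0 ?unit_ball_volume_ge0// mulr_ge0 ?divr_ge0.
Qed.

Lemma measurable_dist F F' : measurable_fun setT (fun s => `|F s - F' s|).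
Proof.
by apply: measurableT_comp => //; apply: measurable_funB; exact: measurable_cumulative.
Qed.

Lemma weighted_nd F F' h h' : h <= h' -> weighted d F F' h <= weighted d F F' h'.
Proof.
move=> hh; have [h0|h0] := leP 0 h; last first.
  rewrite {1}/weighted set_itv_ge; last by rewrite -leNgt bnd_simp ltW.
  by rewrite Rintegral_set0; apply: Rintegral_ge0 => t _; exact: expR_ge0.
rewrite /weighted (stieltjes_itv_split h0 hh (weight_integrable d_ge2 F F' 0 h')) lerDl.
by apply: Rintegral_ge0 => t _; exact: expR_ge0.
Qed.

Lemma measurable_weighted F F' : measurable_fun setT (weighted d F F').
Proof. by apply: nondecreasing_measurable => // h h'; exact: weighted_nd. Qed.

Lemma weighted_ge0 F F' h : 0 <= weighted d F F' h.
Proof. by apply: Rintegral_ge0 => t _; exact: expR_ge0. Qed.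

(** The part of [F - F'] not due to [F - weighted d F F'] is an integral of expR (V F - V F') - 1
    with respect to dF'. The exponent is at most C D(h) <= C in absolute value, so the integrand is
    at most C D(h) expR C; this is where D <= 1 enters. *)
Lemma cumulative_dist_bound F F' h z g :
  distribution_function F -> distribution_function F' -> 0 <= h -> h <= z ->
  cumulative_dist F F' h <= 1 -> G_of d F' z <= g ->
  `|F h - F' h| <= dist_const z * expR (dist_const z) * (expR (V F z + dist_const z) * g) *
     cumulative_dist F F' h + `|F h - weighted d F F' h|.
Proof.
move=> F0 F'0 h0 hz D1 Gg; set C := dist_const z; set D := cumulative_dist F F'.
have C0 : 0 <= C := dist_const_ge0 z.
have Dh0 : 0 <= D h by apply: primitive_ge0 => s.
have VV t : 0 < t <= h -> `|V F t - V F' t| <= C * D h.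
  move=> /andP[t0 th].
  apply: le_trans (cone_volume_dist d_ge2 F0 F'0 (ltW t0) (le_trans th hz)) _.
  rewrite ler_wpM2l//.
  apply: (@primitive_nd _ _ h (F h + F' h)) => //; last exact: ltW.
    exact: measurable_dist.
  by move=> s /andP[_ sh]; exact: cumulative_dist_le.
have CD : C * D h <= C by rewrite ler_piMr.
(* An a priori bound on the mass of dF': since V F' <= V F z + C, the density [expR (- V F' t)] of G
   with respect to dF' is bounded below. *)
have F'h : F' h <= expR (V F z + C) * g.
  have -> : F' h = \int[mu F']_(t in `]0, h]) 1.
    by rewrite stieltjes_cst// (F'0 0)// subr0 mul1r.
  apply: (@le_trans _ _ (expR (V F z + C) * G_of d F' h)); last first.
    apply: ler_wpM2l; first exact: expR_ge0.
    by apply: le_trans Gg; rewrite -subr_ge0; exact: G_of_diff_ge0.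
  rewrite G_ofE -(stieltjesZl _ (expN_integrable d_ge2 F' 0 h)).
  apply: (@stieltjes_le _ _ _ _ _ _ (Num.max 1 (expR (V F z + C)))) => //.
  - by apply: measurable_funM => //; exact: measurable_expN.
  - by move=> t _; rewrite normr1 le_max lexx.
  - move=> t _; rewrite normrM (ger0_norm (expR_ge0 _)) le_max; apply/orP; right.
    by apply: ler_piMr; [exact: expR_ge0|exact: expN_le1].
  - move=> t /[dup] th /andP[t0 th']; rewrite -expRD -expR0 ler_expR.
    have := VV _ th; rewrite ler_norml => /andP[h1 h2].
    have Vtz : V F t <= V F z by apply: (cone_volume_ndT d_ge2); exact: le_trans hz.
    exact: lower_shift h1 CD Vtz.
have -> : F h - F' h = (F h - weighted d F F' h) + (weighted d F F' h - F' h).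
  by rewrite addrA subrK.
apply: le_trans (ler_normD _ _) _; rewrite addrC lerD2r distrC.
have -> : F' h - weighted d F F' h =
    \int[mu F']_(t in `]0, h]) (1 - expR (V F t - V F' t)).
  rewrite RintegralB//; last exact: weight_integrable.
    by rewrite stieltjes_cst// (F'0 0)// subr0 mul1r.
  by apply: (@stieltjes_integrable _ _ _ _ _ 1) => // t _; rewrite normr1.
have m1 : measurable_fun setT (fun t => 1 - expR (V F t - V F' t)).
  by apply: measurable_funB => //; exact: measurable_weight.
have b1 t : 0 < t <= h -> `|1 - expR (V F t - V F' t)| <= C * D h * expR C.
  move=> th; apply: le_trans (norm_expR_sub1_le _) _; apply: ler_pM.
  - exact: normr_ge0.
  - exact: expR_ge0.
  - exact: VV.
  - by rewrite ler_expR; apply: le_trans (VV _ th) CD.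
apply: le_trans (le_normr_Rintegral _ (stieltjes_integrable _ m1 b1)) _ => //.
apply: (@le_trans _ _ (\int[mu F']_(t in `]0, h]) (C * D h * expR C))).
  have CDC0 : 0 <= C * D h * expR C by apply: mulr_ge0; [exact: mulr_ge0|exact: expR_ge0].
  apply: (@stieltjes_le _ _ _ _ _ _ (C * D h * expR C)) => //.
  - exact: measurableT_comp.
  - by move=> t th; rewrite normr_id b1.
  - by move=> t th; rewrite ger0_norm.
rewrite stieltjes_cst// (F'0 0)// subr0.
have -> : C * expR C * (expR (V F z + C) * g) * D h =
  C * D h * expR C * (expR (V F z + C) * g) by ring.
apply: ler_wpM2l => //.
by apply: mulr_ge0; [exact: mulr_ge0|exact: expR_ge0].
Qed.

(** The pointwise bound is integrated over []h, h']], with the distance at [s] replaced by the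
    larger one at [h']; the error terms are collected into their integral over all of [[0, z]]. *)
Lemma cumulative_dist_gronwall F F' z g :
  distribution_function F -> distribution_function F' -> 0 <= z -> 0 <= g ->
  G_of d F' z <= g ->
  let C := dist_const z * expR (dist_const z) * (expR (V F z + dist_const z) * g) in
  let eta := \int[lebesgue_measure]_(s in `[0, z]) `|F s - weighted d F F' s| in
  forall N : nat, (0 < N)%N -> 2 * C * z <= N%:R -> 2 ^+ N.+1 * eta < 1 ->
  cumulative_dist F F' z <= 2 ^+ N.+1 * eta.
Proof.
move=> F0 F'0 z0 g0 Gg C eta N N0 CN eta1.
have C0 : 0 <= C.
  rewrite /C; apply: mulr_ge0; first by apply: mulr_ge0; [exact: dist_const_ge0|exact: expR_ge0].
  by apply: mulr_ge0 => //; exact: expR_ge0.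
pose eps s := `|F s - weighted d F F' s|.
have meps : measurable_fun setT eps.
  apply: measurableT_comp => //; apply: measurable_funB.
    exact: measurable_cumulative.
  exact: measurable_weighted.
have eps0 s : 0 <= eps s by exact: normr_ge0.
have epsM s : 0 <= s <= z -> eps s <= F z + weighted d F F' z.
  move=> /andP[_ sz]; rewrite (le_trans (ler_normB _ _))// lerD ?cumulative_norm_le//.
  by rewrite ger0_norm ?weighted_ge0// weighted_nd.
have mD := measurable_dist F F'.
have DM s : 0 <= s <= z -> `|F s - F' s| <= F z + F' z.
  by move=> /andP[_ sz]; exact: cumulative_dist_le.
apply: (@gronwall _ _ C eta z N) => //.
- by apply: Rintegral_ge0 => s _.
- by apply: (@primitive_continuous _ _ z (F z + F' z)).
- exact: primitive0.
- by move=> h _; apply: primitive_ge0.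
- move=> h h' h0 hh hz D1.
  rewrite -addrA -lerBlDl.
  have h'0 : 0 <= h' by exact: le_trans hh.
  apply: (@le_trans _ _ (C * cumulative_dist F F' h' * (h' - h) +
      \int[lebesgue_measure]_(s in `]h, h']) eps s)); last first.
    rewrite lerD2l -(@primitive_diff _ _ z (F z + weighted d F F' z))//.
    apply: (@le_trans _ _ (primitive eps h')); first by rewrite gerBl; exact: (primitive_ge0 eps0).
    exact: (@primitive_nd _ _ z (F z + weighted d F F' z)).
  apply: (@primitive_diff_le _ _ z (F z + F' z)) => //.
    apply: integrableS (primitive_integrable meps eps0 epsM hz) => //.
    by move=> s /=; rewrite !in_itv/= => /andP[hs ->]; rewrite (ltW (le_lt_trans h0 hs)).
  move=> s /andP[hs sh].
  have s0 : 0 <= s := le_trans h0 (ltW hs).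
  have DD : cumulative_dist F F' s <= cumulative_dist F F' h'.
    by apply: (@primitive_nd _ _ z (F z + F' z)).
  apply: le_trans (cumulative_dist_bound F0 F'0 s0 (le_trans sh hz) (le_trans DD D1) Gg) _.
  by rewrite lerD2r; apply: ler_wpM2l.
Qed.

(** Gronwall's argument makes the L^1 distance at [z] vanish in the limit, and the pointwise bound
    then yields convergence at [z] itself, discontinuity points of [F] included. *)
Theorem cumulative_stability F (Fn : nat -> cumulative R R) :
  distribution_function F -> (forall n, distribution_function (Fn n)) ->
  (forall z, 0 <= z -> G_of d (Fn n) z @[n --> \oo] --> G_of d F z) ->
  forall z, 0 <= z -> Fn n z @[n --> \oo] --> F z.
Proof.
move=> F0 Fn0 GG z z0.
(* The slack 1 gives one bound for all large n, so that [C] and the number [N] of Gronwall steps do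
   not depend on n. *)
pose g := G_of d F z + 1.
have Gg : \forall n \near \oo, G_of d (Fn n) z <= g.
  have /cvgrPdist_le/(_ _ ltr01) := GG z z0; apply: filterS => n.
  by rewrite ler_distlC => /andP[].
have g0 : 0 <= g.
  by rewrite addr_ge0// G_ofE; apply: Rintegral_ge0 => t _; exact: expR_ge0.
pose C := dist_const z * expR (dist_const z) * (expR (V F z + dist_const z) * g).
pose N := (Num.truncn (2 * C * z)).+1.
have CN : 2 * C * z <= N%:R by exact: ltW (truncnS_gt _).
pose eps n s := `|F s - weighted d F (Fn n) s|.
pose eta n := \int[lebesgue_measure]_(s in `[0, z]) eps n s.
have eps_cvg s : 0 <= s -> eps n s @[n --> \oo] --> (0 : R).
  move=> s0; have := weighted_cvg d_ge2 F0 s0 GG.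
  move=> /cvgrPdist_le H; apply/cvgrPdist_le => e e0.
  by apply: filterS (H _ e0) => n; rewrite sub0r normrN normr_id.
have eta_cvg : eta n @[n --> \oo] --> (0 : R).
  (* Domination: a convergent sequence is bounded at [z], and [weighted] is monotone, so the bound
     holds on all of [[0, z]]. *)
  have [M HM] : exists M, forall n s, 0 <= s <= z -> eps n s <= M.
    have /cvg_ex/cvg_seq_bounded/pinfty_ex_gt0[M M0 HM] : exists l : R,
        weighted d F (Fn n) z @[n --> \oo] --> l.
      by exists (F z); exact: weighted_cvg.
    exists (F z + M) => n s /andP[_ sz]; rewrite (le_trans (ler_normB _ _))// lerD//.
      exact: cumulative_norm_le.
    have := HM n I; rewrite /= => /(le_trans (ler_norm _)); apply: le_trans.
    by rewrite ger0_norm ?weighted_ge0//; exact: weighted_nd.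
  have meps n : measurable_fun setT (eps n).
    apply: measurableT_comp => //; apply: measurable_funB.
      exact: measurable_cumulative.
    exact: measurable_weighted.
  have [] := @dominated_convergence _ _ _ (@lebesgue_measure R) `[0, z]%classic
      (measurable_itv _) (fun n => EFin \o eps n) (cst 0%E) (EFin \o cst M).
  - by move=> n; apply/measurable_EFinP; apply: measurable_funTS; exact: meps.
  - exact: measurable_cst.
  - apply: aeW => s /=; rewrite in_itv/= => /andP[s0 _].
    by apply: cvg_EFin; [by apply: nearW => n|exact: eps_cvg].
  - exact: (@lebesgue_integrable_itv _ _ _ `|M|).
  - apply: aeW => s n /=; rewrite in_itv/= => sz; rewrite lee_fin ger0_norm ?HM//.
    exact: normr_ge0.
  move=> _ _; rewrite integral0 => /fine_cvg; exact.
have : 2 ^+ N.+1 * eta n @[n --> \oo] --> (2 ^+ N.+1 * 0 : R).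
  by apply: cvgM => //; exact: cvg_cst.
rewrite mulr0 => Meta.
have D_small : \forall n \near \oo, cumulative_dist F (Fn n) z <= 2 ^+ N.+1 * eta n /\
    2 ^+ N.+1 * eta n < 1.
  have /cvgrPdist_lt/(_ _ ltr01) := Meta; apply: filterS2 Gg => n Ggn.
  rewrite sub0r normrN => /(le_lt_trans (ler_norm _)) H; split => //.
  exact: (@cumulative_dist_gronwall F (Fn n) z g).
have B_cvg : C * (2 ^+ N.+1 * eta n) + eps n z @[n --> \oo] --> (C * 0 + 0 : R).
  by apply: cvgD; [apply: cvgM => //; exact: cvg_cst|exact: eps_cvg].
rewrite mulr0 addr0 in B_cvg.
have C0 : 0 <= C.
  rewrite /C; apply: mulr_ge0; first by apply: mulr_ge0; [exact: dist_const_ge0|exact: expR_ge0].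
  by apply: mulr_ge0 => //; exact: expR_ge0.
apply/cvgrPdist_le => e e0.
have /cvgrPdist_le/(_ _ e0) := B_cvg.
apply: filterS3 Gg D_small => n Ggn [D1 eta1].
rewrite sub0r normrN => /(le_trans (ler_norm _)); apply: le_trans.
have D11 : cumulative_dist F (Fn n) z <= 1 by exact: le_trans D1 (ltW eta1).
apply: le_trans (cumulative_dist_bound F0 (Fn0 n) z0 (lexx z) D11 Ggn) _.
by rewrite lerD2r -/C; apply: ler_wpM2l.
Qed.

(** Stability applied to the constant sequence [F']. *)
Corollary G_of_inj F F' : distribution_function F -> distribution_function F' ->
  (forall z, 0 <= z -> G_of d F' z = G_of d F z) -> F' =1 F.
Proof.
move=> F0 F'0 GG z; have [z0|z0] := leP 0 z; last by rewrite F0 ?F'0// ltW.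
have := @cumulative_stability F (fun=> F') F0 (fun=> F'0) _ z z0.
have H : forall z, 0 <= z -> (fun=> G_of d F' z) n @[n --> \oo] --> G_of d F z.
  by move=> s s0; rewrite GG//; exact: cvg_cst.
move=> /(_ H) /cvg_lim <- //; by rewrite lim_cst.
Qed.

End stability_theorem.

(** * Solutions for step functions *)

Section add_atom.
Context {R : realType}.
Variables (F : cumulative R R) (h f : R).
Hypothesis f0 : 0 <= f.
Local Notation mu := lebesgue_stieltjes_measure.

Let F' (z : R) : R := F z + f * (h <= z)%R%:R.

Let F'_nd : nondecreasing F'.
Proof.
move=> x y xy; rewrite lerD ?cumulative_nd// ler_wpM2l// ler_nat.
by have [hx|] := leP h x; [rewrite (le_trans hx xy)|].
Qed.

Let F'_rc : right_continuous F'.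
Proof.
move=> x; apply: cvgD; first exact: cumulative_is_right_continuous.
apply: cvgM; first exact: cvg_cst.
apply: cvg_near_cst; have [hx|xh] := leP h x.
  near=> y; have -> : h <= y by rewrite (le_trans hx)// ltW//; near: y; exact: nbhs_right_gt.
  by [].
near=> y; suff : y < h by rewrite ltNge => /negbTE ->.
by near: y; exact: nbhs_right_lt.
Unshelve. all: by end_near. Qed.

HB.instance Definition _ := isCumulative.Build R _ R F' F'_nd F'_rc.

Definition add_atom : cumulative R R := F'.

Lemma add_atomE z : add_atom z = F z + f * (h <= z)%R%:R. Proof. by []. Qed.

Let f' : {nonneg R} := NngNum f0.

(** Both sides are measures that agree on half-open intervals, which determine a Lebesgue-Stieltjes
    measure. *)
Lemma add_atom_measure (A : set (measurableTypeR R)) : measurable A ->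
  mu add_atom A = (mu F A + f%:E * \d_h A)%E.
Proof.
pose m := measure_add (mu F) (mscale f' (@dirac _ (measurableTypeR R) h R)).
have mE B : m B = (mu F B + f%:E * \d_h B)%E by rewrite /m measure_addE.
move=> mA; rewrite -mE; apply: (@lebesgue_stieltjes_measure_unique R add_atom m) => //.
move=> X [[a b] _ <-]; apply: esym; apply: etrans (mE _) _ => /=.
have [ab|ba] := leP a b; last first.
  by rewrite set_itv_ge ?measure0 ?mule0 ?adde0// -leNgt bnd_simp ltW.
rewrite !stieltjes_ocitv// diracE -EFinM -EFinD; congr EFin.
rewrite !add_atomE; have -> : (h \in `]a, b]%classic) = (a < h <= b).
  by apply/idP/idP; rewrite inE/= in_itv.
have -> : (a < h <= b)%R%:R = (h <= b)%R%:R - (h <= a)%R%:R :> R.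
  have [ha|ah] := leP h a; first by rewrite (le_trans ha ab) subrr.
  by rewrite subr0.
ring.
Qed.

Lemma ge0_integral_add_atom (a b : R) (g : R -> R) : measurable_fun setT g -> (forall t, 0 <= g t) ->
  (forall M, (forall t, a < t <= b -> `|g t| <= M) ->
  \int[mu add_atom]_(t in `]a, b]) g t =
  \int[mu F]_(t in `]a, b]) g t + f * g h * (a < h <= b)%R%:R).
Proof.
move=> mg g0 M gM.
have mg' : measurable_fun `]a, b]%classic (EFin \o g : measurableTypeR R -> \bar R).
  by apply/measurable_EFinP; exact: measurable_funTS.
have E : (\int[mu add_atom]_(t in `]a, b]) (g t)%:E =
  \int[mu F]_(t in `]a, b]) (g t)%:E + (f * g h * (a < h <= b)%R%:R)%:E)%E.
  rewrite (@eq_measure_integral _ _ _ _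
    (measure_add (mu F) (mscale f' (@dirac _ (measurableTypeR R) h R)))); last first.
    move=> A mA _; apply: etrans (add_atom_measure mA) _; apply: esym.
    exact: etrans (measure_addE _ _ _) _.
  rewrite ge0_integral_measure_add//; last by move=> t _; rewrite lee_fin.
  congr (_ + _)%E; rewrite ge0_integral_mscale//; last by move=> t _; rewrite lee_fin.
  rewrite integral_dirac// diracE.
  have -> : (h \in `]a, b]%classic) = (a < h <= b).
    by apply/idP/idP; rewrite inE/= in_itv.
  by rewrite /= -!EFinM mulrAC mulrA.
have fin : (\int[mu F]_(t in `]a, b]) (g t)%:E)%E \is a fin_num.
  by apply: integrable_fin_num => //; exact: stieltjes_integrable mg gM.
by rewrite /Rintegral E fineD.
Qed.

End add_atom.

Section step_solution.
Context {R : realType}.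
Variable d : nat.
Hypothesis d_ge2 : (2 <= d)%N.
Local Notation mu := lebesgue_stieltjes_measure.
Local Notation V := (cone_volume d).

Let d_gt0 : (0 < d)%N := ltnW d_ge2.

(** The kernel vanishes at the atom as long as [t <= h], the case [t = h] included: an atom does not
    discount itself. *)
Lemma add_atom_cone_volume (F : cumulative R R) (h f : R) (f0 : 0 <= f) t :
  t <= h -> V (add_atom F h f0) t = V F t.
Proof.
move=> th; rewrite 2!cone_volumeE; congr (_ * _).
rewrite (@ge0_integral_add_atom _ _ _ _ _ _ _ _ _ _ (cone_kernel d t 0)).
- by rewrite cone_kernel0// mulr0 mul0r addr0.
- exact: measurable_cone_kernel.
- by move=> s; exact: cone_kernel_ge0.
- by move=> s /andP[s0 _]; apply: cone_kernel_norm_le; rewrite ?lexx// ltW.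
Qed.

(** The atom alters the exponent only beyond [h], where [F] has no mass; G therefore gains the
    discounted atom and nothing else. *)
Lemma G_of_add_atom (F : cumulative R R) (h f : R) (f0 : 0 <= f) z : 0 < h ->
  (forall z, h <= z -> F z = F h) ->
  G_of d (add_atom F h f0) z = G_of d F z + f * expR (- V F h) * (h <= z)%R%:R.
Proof.
move=> h0 Fcst; rewrite 2!G_ofE.
set F' := add_atom F h f0.
have VF'h : V F' h = V F h by exact: add_atom_cone_volume.
have -> : \int[mu F']_(t in `]0, z]) expR (- V F' t) =
    \int[mu F]_(t in `]0, z]) expR (- V F' t) + f * expR (- V F' h) * (0 < h <= z)%R%:R.
  apply: (@ge0_integral_add_atom _ F h f f0 0 z (fun t => expR (- V F' t)) _ _ 1).
  - exact: measurable_expN.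
  - by move=> t; exact: expR_ge0.
  - by move=> t _; exact: expN_le1.
have -> : (0 < h <= z) = (h <= z) by rewrite h0.
rewrite VF'h.
suff -> : \int[mu F]_(t in `]0, z]) expR (- V F' t) =
  \int[mu F]_(t in `]0, z]) expR (- V F t) by [].
have eqV b : b <= h -> \int[mu F]_(t in `]0, b]) expR (- V F' t) =
    \int[mu F]_(t in `]0, b]) expR (- V F t).
  move=> bh; apply: eq_Rintegral => t; rewrite inE/= in_itv/= => /andP[_ tb].
  by rewrite add_atom_cone_volume// (le_trans tb).
have [zh|hz] := leP z h; first exact: eqV.
have tail F1 : \int[mu F]_(t in `]h, z]) expR (- V F1 t) = 0.
  apply/eqP; rewrite eq_le; apply/andP; split; last first.
    by apply: Rintegral_ge0 => t _; exact: expR_ge0.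
  have <- : \int[mu F]_(t in `]h, z]) 1 = 0.
    by rewrite stieltjes_cst ?(ltW hz)// Fcst ?(ltW hz)// subrr mulr0.
  apply: (@stieltjes_le _ _ _ _ _ _ 1) => //; first exact: measurable_expN.
  - by move=> t _; exact: expN_le1.
  - by move=> t _; rewrite normr1.
  - by move=> t _; exact: le_trans (ler_norm _) (expN_le1 d_ge2 _ _).
have intF F1 : (mu F).-integrable `]0, z] (EFin \o (fun t => expR (- V F1 t))).
  apply: (@stieltjes_integrable _ _ _ _ _ 1); first exact: measurable_expN.
  by move=> t _; exact: expN_le1.
rewrite (stieltjes_itv_split (ltW h0) (ltW hz) (intF _)) tail eqV// addr0.
by rewrite (stieltjes_itv_split (ltW h0) (ltW hz) (intF _)) tail addr0.
Qed.

Let zero (z : R) : R := 0.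
Let zero_nd : nondecreasing zero. Proof. by []. Qed.
Let zero_rc : right_continuous zero. Proof. by move=> x; exact: cvg_cst. Qed.
HB.instance Definition _ := isCumulative.Build R _ R zero zero_nd zero_rc.

Lemma G_of_zero z : G_of d zero z = 0.
Proof.
have [z0|z0] := leP 0 z; last first.
  by rewrite G_ofE set_itv_ge ?Rintegral_set0// -leNgt bnd_simp ltW.
apply/eqP; rewrite eq_le; apply/andP; split.
  by have := G_of_diff_le d_ge2 zero (lexx 0) z0; rewrite G_of0 subr0 subrr.
by have := G_of_diff_ge0 d_ge2 zero (lexx 0) z0; rewrite G_of0 subr0.
Qed.

(** Atoms are added in increasing order of weight, so each new one leaves the earlier part of G
    untouched. This is the recursion that computes the estimator; repeated weights are allowed. *)
Lemma step_solution (s : seq (R * R)) : all (fun p => (0 < p.1) && (0 <= p.2)) s ->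
  exists F : cumulative R R, distribution_function F /\
    forall z, G_of d F z = \sum_(p <- s) p.2 * (p.1 <= z)%R%:R.
Proof.
pose leT (p q : R * R) := p.1 <= q.1.
have leT_tr : transitive leT by move=> p q r; exact: le_trans.
have leT_tot : total leT by move=> p q; exact: le_total.
(* The induction also carries that [F] is constant beyond the weights already treated. *)
suff S s' : sorted leT s' -> all (fun p => (0 < p.1) && (0 <= p.2)) s' ->
    exists F : cumulative R R, [/\ distribution_function F,
      forall b, all (fun p => p.1 <= b) s' -> forall z, b <= z -> F z = F b &
      forall z, G_of d F z = \sum_(p <- s') p.2 * (p.1 <= z)%R%:R].
  move=> s_pos; have [||F [F0 _ GF]] := S (sort leT s).
  - exact: sort_sorted.
  - by rewrite all_sort.
  exists F; split => // z; rewrite GF; apply: perm_big; exact/permEl/perm_sort.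
elim/last_ind: s' => [_ _|s' [h g] ih].
  exists zero; split => // z; by rewrite big_nil G_of_zero.
rewrite (sorted_pairwise leT_tr) pairwise_rcons -(sorted_pairwise leT_tr).
rewrite all_rcons/= => /andP[s'h s's] /andP[/andP[h0 g0] s'_pos].
have [F [F0 Fcst GF]] := ih s's s'_pos.
(* The factor [expR (V F h)] cancels the discount of the new atom, so that G jumps by exactly
   [g]. *)
have f0 : 0 <= g * expR (V F h) by rewrite mulr_ge0//; exact: expR_ge0.
exists (add_atom F h f0); split.
- move=> z z0; rewrite [LHS](add_atomE F h f0 z) F0// add0r leNgt (le_lt_trans z0 h0)/= mulr0//.
- move=> b; rewrite all_rcons/= => /andP[hb s'b] z bz.
  by rewrite (Fcst _ s'b _ bz) hb (le_trans hb bz).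
move=> z; rewrite G_of_add_atom//; last by move=> t; exact: Fcst.
rewrite GF -cats1 big_cat big_seq1/=; congr (_ + _ * _).
by rewrite -mulrA -expRD subrr expR0 mulr1.
Qed.

End step_solution.

(** * Poisson processes *)

Section counting.
Context {R : realType} {T : choiceType}.
Implicit Types A B : set T.
Local Notation count := (@counting T R).
Local Open Scope ereal_scope.

Lemma counting_esum A : count A = \esum_(x in A) 1.
Proof.
rewrite /counting; case: asboolP => [finA|infA].
  rewrite esum_fset// fsbig_finite//= big_const_seq count_predT iter_addr adde0.
  by rewrite EFin_natmul.
apply/esym/eqyP => x _.
have [B BA xB] := infinite_set_fset (Num.truncn x).+1 infA.
apply: (@le_trans _ _ (size (finmap.enum_fset B))%:R%:E).
  by rewrite lee_fin (le_trans (ltW (truncnS_gt x)))// ler_nat.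
apply: esum_ge; exists [set` finmap.enum_fset B].
  by split; [exact: finite_seq|exact: BA].
rewrite -fsbig_seq ?finmap.fset_uniq//= big_const_seq count_predT iter_addr adde0.
by rewrite EFin_natmul.
Qed.

Lemma counting_setID A B : count A = count (A `&` B) + count (A `&` ~` B).
Proof. by rewrite !counting_esum (esumID B). Qed.

Lemma counting_ge0 A : 0 <= count A.
Proof. by rewrite counting_esum; apply: esum_ge0. Qed.

Lemma counting_le A B : A `<=` B -> count A <= count B.
Proof.
move=> AB; rewrite (counting_setID B A) (_ : B `&` A = A); last exact/setIidPr.
by rewrite leeDl// counting_ge0.
Qed.

Lemma counting_fin_num A : count A \is a fin_num -> finite_set A.
Proof. by rewrite /counting; case: asboolP. Qed.

Lemma counting_card_ge (I : finType) (Q : {pred I}) (f : I -> T) A :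
  (forall i, i \in Q -> A (f i)) -> {in Q &, injective f} ->
  (#|Q|%:R)%:E <= count A.
Proof.
move=> QA finj.
pose s := [seq f i | i in Q].
have us : uniq s.
  by apply/dinjectiveP => i j iQ jQ; exact: finj.
rewrite counting_esum; apply: esum_ge; exists [set` s].
  split; first exact: finite_seq.
  by move=> x /= /mapP[i]; rewrite mem_enum => iQ ->; exact: QA.
rewrite -fsbig_seq//= big_const_seq count_predT iter_addr adde0 EFin_natmul.
by rewrite size_image.
Qed.

End counting.

(** * Intensities of paraboloids *)

Section cone_measure.
Context {R : realType}.
Variable d : nat.
Hypothesis d_ge2 : (2 <= d)%N.
Implicit Types (F : cumulative R R) (c : 'rV[R]_d) (psi : R -> R) (a b rho : R).
Local Notation mu := lebesgue_stieltjes_measure.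
Local Notation kappa := (@unit_ball_volume R d).
Local Notation V := (cone_volume d).

Let d_gt0 : (0 < d)%N := ltnW d_ge2.

Definition intensity F : set ('rV[R]_d * measurableTypeR R) -> \bar R :=
  (@lebesgue_rV R d \x mu F)%E.

HB.instance Definition _ F := Measure.on (intensity F).

Definition solid (a b : R) (psi : R -> R) c : set ('rV[R]_d * measurableTypeR R) :=
  [set p | a < p.2 <= b /\ enorm (p.1 - c) <= psi p.2].

Lemma measurable_solid a b psi c : measurable_fun setT psi -> measurable (solid a b psi c).
Proof.
move=> mpsi.
rewrite (_ : solid a b psi c = (snd @^-1` `]a, b]) `&`
   ((fun p : 'rV[R]_d * measurableTypeR R => psi p.2 - enorm (p.1 - c)) @^-1` `[0, +oo[)).
  apply: measurableI; rewrite -[X in measurable X]setTI.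
    exact: measurable_snd.
  apply: measurable_funB => //.
    by apply: measurableT_comp => //; exact: measurable_snd.
  apply: (measurableT_comp (f := fun x : 'rV[R]_d => enorm (x - c))); last exact: measurable_fst.
  by apply: measurableT_comp; [exact: measurable_enorm|exact: measurable_rV_fun_add].
by apply/seteqP; split => -[x t]; rewrite /solid/= !in_itv/= andbT subr_ge0.
Qed.

(** Slicing by weight: each slice is a ball of radius [psi t]. The intensity is defined by the other
    order of integration, hence the passage through uniqueness of the product measure. *)
Lemma intensity_solid F a b psi c : measurable_fun setT psi ->
  (forall t, a < t <= b -> 0 <= psi t) ->
  intensity F (solid a b psi c) =
  (\int[mu F]_(t in `]a, b]) (kappa * psi t ^+ d)%:E)%E.
Proof.
move=> mpsi psi0; have mA := measurable_solid a b c mpsi.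
have -> : intensity F (solid a b psi c) = (@lebesgue_rV R d \x^ mu F)%E (solid a b psi c).
  apply: product_measure_unique => // A1 A2 mA1 mA2.
  exact: product_measure2E.
rewrite /product_measure2 [RHS]integral_mkcond; apply: eq_integral => t _ /=.
rewrite patchE; case: ifPn => [|].
  rewrite inE/= in_itv/= => tab; rewrite -(lebesgue_ceball d_gt0 c) ?psi0//.
  congr lebesgue_rV; apply/seteqP; split => x /=; rewrite /ysection/= inE/=.
    by case.
  by move=> xc; split.
rewrite notin_setE/= in_itv/= => tab.
rewrite (_ : ysection _ _ = set0) ?measure0//.
by apply/seteqP; split => x //=; rewrite /ysection/= inE => -[/tab].
Qed.

Lemma intensity_rect F (A : set 'rV[R]_d) a b : measurable A -> a <= b ->
  intensity F (A `*` `]a, b]) = (lebesgue_rV A * (F b - F a)%:E)%E.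
Proof.
move=> mA ab; rewrite -(stieltjes_ocitv F ab).
by apply: product_measure1E => //; exact: measurable_itv.
Qed.

(* A point of weight [b] within [rho] of [c] can only be hidden by a point of
   [upper_cone b rho c]; every point of [lower_cone a rho c] hides all points of
   weight above [a] within [rho] of [c]. *)
Definition upper_cone b rho c := solid 0 b (fun t => Num.sqrt (b - t) + rho) c.

Definition lower_cone a rho c :=
  solid 0 (Num.max 0 (a - rho ^+ 2)) (fun t => Num.sqrt (a - t) - rho) c.

(** A Lipschitz constant in rho, for rho <= 1, of the intensities of the widened and narrowed cones:
    the radii involved are at most [Num.sqrt b + 1]. *)
Definition cone_slope F b : R := kappa * (d%:R * (Num.sqrt b + 1) ^+ d.-1 * (F b - F 0)).

Lemma cone_slope_ge0 F b : 0 <= b -> 0 <= cone_slope F b.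
Proof.
move=> b0; apply: mulr_ge0; first exact: unit_ball_volume_ge0.
by apply: mulr_ge0; [apply: mulr_ge0|rewrite subr_ge0 cumulative_nd].
Qed.

Lemma measurable_sqrt_sub b rho : measurable_fun setT (fun t : R => Num.sqrt (b - t) + rho).
Proof.
apply: measurable_funD => //.
exact: (continuous_measurable_fun (@continuous_sqrt_sub R b)).
Qed.

Lemma measurable_upper_cone b rho c : measurable (upper_cone b rho c).
Proof. by apply: measurable_solid; exact: measurable_sqrt_sub. Qed.

Lemma measurable_lower_cone a rho c : measurable (lower_cone a rho c).
Proof. by apply: measurable_solid; exact: measurable_sqrt_sub. Qed.

Lemma EFin_Rintegral dd (T : measurableType dd) (m : {measure set T -> \bar R}) (D : set T)
  (f : T -> R) : measurable D -> m.-integrable D (EFin \o f) ->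
  (\int[m]_(t in D) (f t)%:E)%E = (\int[m]_(t in D) f t)%:E.
Proof. by move=> mD intf; rewrite /Rintegral fineK//; exact: integrable_fin_num. Qed.

Lemma pow_integrable F (g : R -> R) a b M : measurable_fun setT g ->
  (forall t, a < t <= b -> 0 <= g t <= M) ->
  (mu F).-integrable `]a, b] (EFin \o (fun t => kappa * g t ^+ d)).
Proof.
move=> mg gM; apply: (@stieltjes_integrable _ _ _ _ _ (kappa * M ^+ d)).
  by apply: measurable_funM => //; exact: measurable_funX.
move=> t /gM/andP[g0 gM']; rewrite ger0_norm ?mulr_ge0 ?unit_ball_volume_ge0 ?exprn_ge0//.
rewrite ler_wpM2l ?unit_ball_volume_ge0// lerXn2r// nnegrE//.
exact: le_trans gM'.
Qed.

Lemma cone_volume_EFin F b : (V F b)%:E =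
  (\int[mu F]_(t in `]0%R, b]) (kappa * Num.sqrt (b - t) ^+ d)%:E)%E.
Proof.
have H : forall t, 0 < t <= b -> 0 <= Num.sqrt (b - t) <= Num.sqrt b.
  by move=> t /andP[t0 _]; rewrite sqrtr_ge0 ler_wsqrtr// gerBl ltW.
have mS : measurable_fun setT (fun t : R => Num.sqrt (b - t)).
  exact: (continuous_measurable_fun (@continuous_sqrt_sub R b)).
rewrite EFin_Rintegral//; last exact: (pow_integrable _ mS H).
rewrite cone_volumeE -stieltjesZl//; exact: cone_kernel_integrable.
Qed.

Lemma intensity_upper_cone_le F b rho c : 0 <= b -> 0 <= rho -> rho <= 1 ->
  (intensity F (upper_cone b rho c) <= (V F b + cone_slope F b * rho)%:E)%E.
Proof.
move=> b0 r0 r1.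
rewrite /upper_cone intensity_solid; last 2 first.
- exact: measurable_sqrt_sub.
- by move=> t _; rewrite addr_ge0 ?sqrtr_ge0.
have mS : measurable_fun setT (fun t : R => Num.sqrt (b - t)).
  exact: (continuous_measurable_fun (@continuous_sqrt_sub R b)).
have sb t : 0 < t <= b -> Num.sqrt (b - t) <= Num.sqrt b.
  by move=> /andP[t0 _]; rewrite ler_wsqrtr// gerBl ltW.
have H1 : forall t, 0 < t <= b -> 0 <= Num.sqrt (b - t) + rho <= Num.sqrt b + 1.
  by move=> t /sb tb; rewrite addr_ge0 ?sqrtr_ge0//= lerD.
have H2 : forall t, 0 < t <= b -> 0 <= Num.sqrt (b - t) <= Num.sqrt b.
  by move=> t /sb ->; rewrite sqrtr_ge0.
pose K := d%:R * (Num.sqrt b + 1) ^+ d.-1 * rho.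
have K0 : 0 <= K by rewrite mulr_ge0// mulr_ge0// exprn_ge0// addr_ge0.
rewrite EFinD cone_volume_EFin.
have -> : (cone_slope F b * rho)%:E = (\int[mu F]_(t in `]0%R, b]) (kappa * K)%:E)%E.
  rewrite EFin_Rintegral//; last first.
    apply: (@stieltjes_integrable _ _ _ _ _ (kappa * K)) => // t _.
    by rewrite ger0_norm// mulr_ge0// unit_ball_volume_ge0.
  rewrite stieltjes_cst//; congr EFin; rewrite /cone_slope /K; ring.
rewrite -ge0_integralD//; last 3 first.
- by move=> t _; rewrite lee_fin mulr_ge0 ?unit_ball_volume_ge0// exprn_ge0.
- apply/measurable_EFinP; apply: measurable_funTS; apply: measurable_funM => //.
  exact: measurable_funX.
- by move=> t _; rewrite lee_fin mulr_ge0 ?unit_ball_volume_ge0.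
apply: ge0_le_integral => //.
- by move=> t /=; rewrite in_itv => /H1/andP[h _]; rewrite lee_fin mulr_ge0 ?unit_ball_volume_ge0// exprn_ge0.
- apply/measurable_EFinP; apply: measurable_funTS; apply: measurable_funM => //.
  by apply: measurable_funX; exact: measurable_sqrt_sub.
- apply/measurable_EFinP; apply: measurable_funTS; apply: measurable_funD => //.
  by apply: measurable_funM => //; exact: measurable_funX.
move=> t /=; rewrite in_itv => tb; rewrite lee_fin -mulrDr ler_wpM2l ?unit_ball_volume_ge0//.
rewrite -lerBlDl.
apply: le_trans (@lipschitz_expr R d (Num.sqrt (b - t)) (Num.sqrt (b - t) + rho) (Num.sqrt b + 1) _ _ _) _.
- exact: sqrtr_ge0.
- by rewrite lerDl.
- by have /andP[] := H1 _ tb.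
- by rewrite /K addrAC subrr add0r.
Qed.

(** Below [a'] each radius shrinks by [rho]; above [a'] the slices are missing, but there
    [Num.sqrt (a - t) <= rho]. In both ranges the loss per slice is at most the same slope term. *)
Lemma intensity_lower_cone_ge F a rho c : 0 <= a -> 0 <= rho -> rho <= 1 ->
  ((V F a - cone_slope F a * rho)%:E <= intensity F (lower_cone a rho c))%E.
Proof.
move=> a0 r0 r1; rewrite /lower_cone; set a' := Num.max 0 _.
have a'0 : 0 <= a' by rewrite le_max lexx.
have a'a : a' <= a by rewrite ge_max a0 gerBl sqr_ge0.
have rs t : t <= a' -> 0 < t -> rho <= Num.sqrt (a - t).
  rewrite le_max => /orP[/le_lt_trans/[apply]|ta t0]; first by rewrite ltxx.
  by rewrite -[rho]ger0_norm// -sqrtr_sqr ler_wsqrtr// lerBrDl -lerBrDr.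
have sr t : a' < t -> Num.sqrt (a - t) <= rho.
  rewrite gt_max => /andP[t0 ta].
  by rewrite -[rho]ger0_norm// -sqrtr_sqr ler_wsqrtr// lerBlDl -lerBlDr ltW.
rewrite intensity_solid; last 2 first.
- exact: measurable_sqrt_sub.
- by move=> t /andP[t0 ta']; rewrite subr_ge0 rs.
have mS : measurable_fun setT (fun t : R => Num.sqrt (a - t)).
  exact: (continuous_measurable_fun (@continuous_sqrt_sub R a)).
have sa t : 0 < t -> Num.sqrt (a - t) <= Num.sqrt a.
  by move=> t0; rewrite ler_wsqrtr// gerBl ltW.
have H2 u v : 0 <= u -> forall t, u < t <= v -> 0 <= Num.sqrt (a - t) <= Num.sqrt a.
  by move=> u0 t /andP[ut _]; rewrite sqrtr_ge0 sa// (le_lt_trans u0).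
have H3 : forall t, 0 < t <= a' -> 0 <= Num.sqrt (a - t) - rho <= Num.sqrt a.
  move=> t /andP[t0 ta]; rewrite subr_ge0 rs//=.
  by rewrite lerBlDr (le_trans (sa _ t0))// lerDl.
pose K := d%:R * (Num.sqrt a + 1) ^+ d.-1 * rho.
have K0 : 0 <= K by rewrite mulr_ge0// mulr_ge0// exprn_ge0// addr_ge0.
have kap0 := @unit_ball_volume_ge0 R d d_gt0.
have iS u v : 0 <= u -> (mu F).-integrable `]u, v] (EFin \o (fun t => kappa * Num.sqrt (a - t) ^+ d)).
  by move=> u0; exact: (pow_integrable _ mS (H2 u v u0)).
have mSr : measurable_fun setT (fun t : R => Num.sqrt (a - t) - rho) by exact: measurable_sqrt_sub.
rewrite EFin_Rintegral//; last exact: (pow_integrable _ mSr H3).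
have -> : V F a = \int[mu F]_(t in `]0, a]) (kappa * Num.sqrt (a - t) ^+ d).
  by apply/EFin_inj; rewrite cone_volume_EFin EFin_Rintegral//; exact: iS.
rewrite lee_fin (stieltjes_itv_split a'0 a'a (iS _ _ (lexx 0))).
have -> : cone_slope F a * rho = kappa * K * (F a' - F 0) + kappa * K * (F a - F a').
  by rewrite /cone_slope /K; ring.
have mk : measurable_fun setT (fun t : R => kappa * Num.sqrt (a - t) ^+ d).
  by apply: measurable_funM => //; exact: measurable_funX.
have bk u v : 0 <= u -> forall t, u < t <= v -> `|kappa * Num.sqrt (a - t) ^+ d| <= kappa * Num.sqrt a ^+ d.
  move=> u0 t /andP[ut tv]; rewrite ger0_norm ?mulr_ge0 ?exprn_ge0//.
  by rewrite ler_wpM2l// lerXn2r ?nnegrE ?sqrtr_ge0// sa// (le_lt_trans u0).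
have I1 : \int[mu F]_(t in `]a', a]) (kappa * Num.sqrt (a - t) ^+ d) <= kappa * K * (F a - F a').
  rewrite -stieltjes_cst//.
  apply: (@stieltjes_le _ _ _ _ _ _ (kappa * Num.sqrt a ^+ d + kappa * K)) => //.
  - by move=> t th; rewrite (le_trans (bk _ _ a'0 _ th))// lerDl mulr_ge0.
  - by move=> t _; rewrite ger0_norm ?mulr_ge0// lerDr mulr_ge0// exprn_ge0.
  move=> t /andP[ta' ta]; rewrite ler_wpM2l//.
  have := @lipschitz_expr R d 0 (Num.sqrt (a - t)) (Num.sqrt a + 1) (lexx _) (sqrtr_ge0 _) _.
  rewrite expr0n gtn_eqF// !subr0 => /(_ _)/le_trans; apply.
    by rewrite (le_trans (sa _ (le_lt_trans a'0 ta')))// lerDl.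
  by rewrite /K ler_wpM2l ?sr// mulr_ge0// exprn_ge0// addr_ge0.
have I2 : \int[mu F]_(t in `]0, a']) (kappa * Num.sqrt (a - t) ^+ d) <=
    \int[mu F]_(t in `]0, a']) (kappa * (Num.sqrt (a - t) - rho) ^+ d) + kappa * K * (F a' - F 0).
  have iK : (mu F).-integrable `]0, a'] (EFin \o cst (kappa * K)).
    by apply: (@stieltjes_integrable _ _ _ _ _ (kappa * K)) => // t _; rewrite ger0_norm// mulr_ge0.
  rewrite -[X in _ + X]stieltjes_cst// -RintegralD//; last exact: (pow_integrable _ mSr H3).
  apply: (@stieltjes_le _ _ _ _ _ _ (kappa * Num.sqrt a ^+ d + kappa * K)) => //.
  - by apply: measurable_funD => //; apply: measurable_funM => //; exact: measurable_funX.
  - by move=> t th; rewrite (le_trans (bk _ _ (lexx _) _ th))// lerDl mulr_ge0.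
  - move=> t /H3/andP[h1 h2]; rewrite ger0_norm ?addr_ge0 ?mulr_ge0 ?exprn_ge0// lerD2r ler_wpM2l//.
    by rewrite lerXn2r// nnegrE.
  move=> t /[dup] /H3/andP[h1 h2] /andP[t0 ta]; rewrite -mulrDr ler_wpM2l// -lerBlDl.
  apply: le_trans (@lipschitz_expr R d (Num.sqrt (a - t) - rho) (Num.sqrt (a - t)) (Num.sqrt a + 1) _ _ _) _ => //.
  - by rewrite gerBl.
  - by rewrite (le_trans (sa _ t0))// lerDl.
  - by rewrite /K opprB addrCA subrr addr0.
by move: I1 I2; lra.
Qed.

End cone_measure.

(** * Void probabilities and independence of counts *)

Section poisson_events.
Context {R : realType} {d d'} {Omega : measurableType d} {E : measurableType d'}.
Variables (P : probability Omega R) (eta : Omega -> set E).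
Variable Lam : {measure set E -> \bar R}.
Hypothesis etaP : poisson_process P eta Lam.
Implicit Types (A B : set E) (S : set (\bar R)).

Definition count_in B S : set Omega := point_count eta B @^-1` S.

Lemma measurable_count_in B S : measurable B -> measurable S -> measurable (count_in B S).
Proof.
have [mcount _ _ _] := etaP; move=> mB mS.
by rewrite -[X in measurable X]setTI; exact: mcount.
Qed.

Lemma prob_count_eq B (k : nat) : measurable B -> (Lam B < +oo)%E ->
  P (count_in B [set k%:R%:E]) = poisson_prob (fine (Lam B)) 0 [set k].
Proof. by move=> mB Boo; have [_ + _ _] := etaP; exact. Qed.

Lemma poisson_prob0 (r : R) : 0 <= r -> poisson_prob r 0 [set 0%N] = (expR (- r))%:E.
Proof.
rewrite /poisson_prob le_eqVlt => /predU1P[<-|r0].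
  by rewrite ltxx diracE mem_set// oppr0 expR0.
rewrite r0 esum_set1 ?lee_fin ?poisson_pmf_ge0// /poisson_pmf r0.
by rewrite expr0 fact0 invr1 !mul1r.
Qed.

Lemma poisson_prob1 (r : R) : 0 <= r -> poisson_prob r 0 [set 1%N] = (r * expR (- r))%:E.
Proof.
rewrite /poisson_prob le_eqVlt => /predU1P[<-|r0].
  by rewrite ltxx diracE memNset// mul0r.
rewrite r0 esum_set1 ?lee_fin ?poisson_pmf_ge0// /poisson_pmf r0.
by rewrite expr1 invr1 mulr1.
Qed.

Lemma prob_void B : measurable B -> (Lam B < +oo)%E ->
  P (count_in B [set 0%E]) = (expR (- fine (Lam B)))%:E.
Proof.
move=> mB Boo; rewrite -poisson_prob0 ?fine_ge0//.
by have := prob_count_eq 0 mB Boo.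
Qed.

Lemma prob_single B : measurable B -> (Lam B < +oo)%E ->
  P (count_in B [set 1%E]) = (fine (Lam B) * expR (- fine (Lam B)))%:E.
Proof.
move=> mB Boo; rewrite -poisson_prob1 ?fine_ge0//.
by have := prob_count_eq 1 mB Boo.
Qed.

Lemma prob_nonvoid B : measurable B -> (Lam B < +oo)%E ->
  P (count_in B (~` [set 0%E])) = (1 - expR (- fine (Lam B)))%:E.
Proof.
move=> mB Boo; rewrite /count_in -preimage_setC probability_setC//.
  by rewrite prob_void.
exact: measurable_count_in.
Qed.

(** The event of one cube involves the counts of two disjoint regions, so independence of the events
    of two cubes is a statement about four. *)
Lemma count_in_indep4 B1 B2 B3 B4 S1 S2 S3 S4 :
  measurable B1 -> measurable B2 -> measurable B3 -> measurable B4 ->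
  measurable S1 -> measurable S2 -> measurable S3 -> measurable S4 ->
  B1 `&` B2 = set0 -> B1 `&` B3 = set0 -> B1 `&` B4 = set0 ->
  B2 `&` B3 = set0 -> B2 `&` B4 = set0 -> B3 `&` B4 = set0 ->
  P (count_in B1 S1 `&` count_in B2 S2 `&` (count_in B3 S3 `&` count_in B4 S4)) =
  (P (count_in B1 S1) * P (count_in B2 S2) * (P (count_in B3 S3) * P (count_in B4 S4)))%E.
Proof.
move=> mB1 mB2 mB3 mB4 mS1 mS2 mS3 mS4 d12 d13 d14 d23 d24 d34.
have [_ _ _ indep] := etaP.
pose B (i : 'I_4) : set E := nth set0 [:: B1; B2; B3; B4] i.
pose S (i : 'I_4) : set (\bar R) := nth set0 [:: S1; S2; S3; S4] i.
have mB i : measurable (B i) by rewrite /B; case: i => -[|[|[|[|//]]]].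
have mS i : measurable (S i) by rewrite /S; case: i => -[|[|[|[|//]]]].
have tB : trivIset setT B.
  apply/trivIsetP => -[[|[|[|[|//]]]] i4] [[|[|[|[|//]]]] j4] _ _ //= _;
  by rewrite /B//= setIC.
have := indep _ B mB tB S mS; rewrite !big_ord_recl big_ord0 mule1 muleA => <-.
congr (P _); apply/seteqP; split => w /=.
  move=> [[h1 h2] [h3 h4]] i _; rewrite /B /S; by case: i => -[|[|[|[|//]]]].
move=> H; split; split.
- exact: (H ord0 I).
- exact: (H (Ordinal (isT : 1 < 4)%N) I).
- exact: (H (Ordinal (isT : 2 < 4)%N) I).
- exact: (H (Ordinal (isT : 3 < 4)%N) I).
Qed.

Lemma count_in_indep2 B1 B2 S1 S2 :
  measurable B1 -> measurable B2 -> measurable S1 -> measurable S2 -> B1 `&` B2 = set0 ->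
  P (count_in B1 S1 `&` count_in B2 S2) = (P (count_in B1 S1) * P (count_in B2 S2))%E.
Proof.
move=> mB1 mB2 mS1 mS2 d12.
(* The list is padded with empty regions and the trivial condition. *)
have := count_in_indep4 mB1 mB2 measurable0 measurable0 mS1 mS2 measurableT measurableT
  d12 (setI0 _) (setI0 _) (setI0 _) (setI0 _) (setI0 _).
by rewrite /count_in !preimage_setT setTI setIT probability_setT !mule1.
Qed.

End poisson_events.

(** * Chebyshev's inequality for events with finite range of dependence *)

Section chebyshev_events.
Context {R : realType} {d} {Omega : measurableType d} (P : probability Omega R).
Local Open Scope ereal_scope.

Lemma prob_fineK (A : set Omega) : measurable A -> (fine (P A))%:E = P A.
Proof.
by move=> mA; rewrite fineK// ge0_fin_numE// (le_lt_trans (probability_le1 _ _))// ltry.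
Qed.

Lemma prob_fin_num (A : set Omega) : measurable A -> P A \is a fin_num.
Proof.
by move=> mA; rewrite ge0_fin_numE// (le_lt_trans (probability_le1 _ _))// ltry.
Qed.

(** Independent pairs contribute nothing to the variance. Each [i] has at most [K] neighbours, each
    with covariance at most [P (A i)], so the variance is at most [K] times the mean. *)
Lemma chebyshev_events (T : finType) (A : T -> set Omega) (nb : rel T) (K : nat) (t : R) :
  (forall i, measurable (A i)) -> (forall i, #|nb i| <= K)%N ->
  (forall i j, ~~ nb i j -> P (A i `&` A j) = P (A i) * P (A j)) -> (0 < t)%R ->
  P [set w | (\sum_i (\1_(A i) w : R) <= \sum_i fine (P (A i)) - t)%R] <=
    (K%:R * (\sum_i fine (P (A i))) / t ^+ 2)%:E.
Proof.
move=> mA nbK indep t0.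
pose p i : R := fine (P (A i)); pose m : R := (\sum_i p i)%R.
pose X w : R := (\sum_i (\1_(A i) w : R))%R.
have mX : measurable_fun setT X by apply: measurable_sum => i; exact: measurable_indic.
have p0 i : (0 <= p i)%R by rewrite fine_ge0.
have m0 : (0 <= m)%R by apply: sumr_ge0 => i _.
have mB : measurable [set w | (X w <= m - t)%R].
  rewrite (_ : [set _ | _] = X @^-1` `]-oo, (m - t)%R]); last first.
    by apply/seteqP; split => w /=; rewrite in_itv.
  by rewrite -[X in measurable X]setTI; exact: mX.
set B := [set w | _] in mB *.
have intX2 : \int[P]_w ((X w) ^+ 2)%:E = (\sum_i \sum_j fine (P (A i `&` A j)))%:E.
  transitivity (\int[P]_w (\sum_i \sum_j (\1_(A i `&` A j) w)%:E)).
    apply: eq_integral => w _; rewrite expr2 big_distrlr/= -sumEFin.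
    apply: eq_bigr => i _; rewrite -sumEFin; apply: eq_bigr => j _.
    by rewrite indicI.
  rewrite ge0_integral_sum//; last 2 first.
  - by move=> i; apply: emeasurable_sum => j; apply/measurable_EFinP; apply: measurable_indic; exact: measurableI.
  - by move=> i w _; apply: sume_ge0 => j _; rewrite lee_fin.
  rewrite -sumEFin; apply: eq_bigr => i _.
  rewrite ge0_integral_sum//; last first.
    by move=> j; apply/measurable_EFinP; apply: measurable_indic; exact: measurableI.
  rewrite -sumEFin; apply: eq_bigr => j _.
  rewrite integral_indic//; last exact: measurableI.
  by rewrite setIT prob_fineK//; exact: measurableI.
have intX : \int[P]_w (X w)%:E = m%:E.
  transitivity (\int[P]_w (\sum_i (\1_(A i) w)%:E)).
    by apply: eq_integral => w _; rewrite -sumEFin.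
  rewrite ge0_integral_sum//; last by move=> i; apply/measurable_EFinP; exact: measurable_indic.
  rewrite -sumEFin; apply: eq_bigr => i _.
  by rewrite integral_indic// setIT prob_fineK.
have X0 w : (0 <= X w)%R by apply: sumr_ge0 => i _.
(* The cross term is added on the left, so that only integrals of nonnegative functions are
   split. *)
have S1 : \int[P]_w ((X w - m) ^+ 2)%:E + (2 * m * m)%:E =
    (\sum_i \sum_j fine (P (A i `&` A j)) + m ^+ 2)%:E.
  have -> : (2 * m * m)%:E = \int[P]_w (2 * m * X w)%:E.
    under eq_integral do rewrite EFinM.
    rewrite ge0_integralZl ?intX ?EFinM ?lee_fin ?mulr_ge0//.
      exact/measurable_EFinP.
    by move=> w _; rewrite lee_fin.
  rewrite -ge0_integralD//; last 4 first.
  - by move=> w _; rewrite lee_fin sqr_ge0.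
  - by apply/measurable_EFinP; apply: measurable_funX; exact: measurable_funB.
  - by move=> w _; rewrite lee_fin !mulr_ge0.
  - by apply/measurable_EFinP; exact: measurable_funM.
  transitivity (\int[P]_w (((X w) ^+ 2)%:E + (m ^+ 2)%:E)).
    by apply: eq_integral => w _; rewrite -!EFinD; congr EFin; ring.
  rewrite ge0_integralD//; last 3 first.
  - by move=> w _; rewrite lee_fin sqr_ge0.
  - by apply/measurable_EFinP; exact: measurable_funX.
  - by move=> w _; rewrite lee_fin sqr_ge0.
  have -> : \int[P]_w (m ^+ 2)%:E = (m ^+ 2)%:E.
    transitivity ((m ^+ 2)%:E * P setT); first exact: integral_cst.
    by rewrite probability_setT mule1.
  by rewrite intX2 EFinD.
have var_le : \int[P]_w ((X w - m) ^+ 2)%:E <= (K%:R * m)%:E.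
  have -> : \int[P]_w ((X w - m) ^+ 2)%:E =
      (\sum_i \sum_j fine (P (A i `&` A j)) - m ^+ 2)%:E.
    have := congr1 (fun x => x - (2 * m * m)%:E) S1; rewrite addeK// -EFinB => ->.
    by congr EFin; ring.
  rewrite lee_fin {1}/m expr2 big_distrlr/= -sumrB mulr_sumr; apply: ler_sum => i _.
  rewrite -sumrB (bigID (nb i))/= [X in (_ + X)%R]big1 ?addr0; last first.
    move=> j nij; rewrite indep// fineM ?prob_fin_num//.
    by rewrite subrr.
  apply: (@le_trans _ _ (\sum_(j | nb i j) p i)%R).
    apply: ler_sum => j _; rewrite lerBlDr (le_trans (_ : _ <= p i)%R)//.
      have mAij : measurable (A i `&` A j) by exact: measurableI.
      by rewrite fine_le ?prob_fin_num//; apply: le_measure; rewrite ?inE//; exact: subIsetl.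
    by rewrite lerDl mulr_ge0.
  rewrite sumr_const -[leLHS]mulr_natl ler_wpM2r// ler_nat.
  exact: nbK.
have t20 : (0 < t ^+ 2)%R by rewrite exprn_gt0.
rewrite -(@lee_pmul2r _ (t ^+ 2)%:E)// -EFinM divfK ?gt_eqF//.
apply: le_trans var_le; rewrite muleC.
have -> : (t ^+ 2)%:E * P B = \int[P]_w ((t ^+ 2)%:E * (\1_B w)%:E).
  rewrite ge0_integralZl ?lee_fin ?sqr_ge0 ?integral_indic ?setIT//.
  by apply/measurable_EFinP; exact: measurable_indic.
apply: ge0_le_integral => //.
- by move=> w _; rewrite mule_ge0 ?lee_fin ?sqr_ge0.
- by apply: measurable_funeM; apply/measurable_EFinP; exact: measurable_indic.
- by apply/measurable_EFinP; apply: measurable_funX; exact: measurable_funB.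
move=> w _; rewrite -EFinM lee_fin indicE; case: (boolP (w \in B)) => [|_].
  rewrite inE /B/= mulr1 => wB.
  have : (t <= m - X w)%R by move: wB; lra.
  by move=> tm; rewrite -[leRHS]sqrrN opprB lerXn2r ?nnegrE// ?(le_trans _ tm) ?ltW.
by rewrite mulr0 sqr_ge0.
Qed.

End chebyshev_events.

(** * Borel-Cantelli along geometric levels *)

Section geometric_levels.
Context {R : realType} {d} {Omega : measurableType d} (P : probability Omega R).
Variables (v : nat -> R) (a : R).
Hypothesis v_oo : forall M : R, \forall n \near \oo, M <= v n.
Hypothesis a_gt1 : 1 < a.

Let a_gt0 : 0 < a := lt_trans ltr01 a_gt1.

Let bernoulli k : 1 + k%:R * (a - 1) <= a ^+ k.
Proof.
elim: k => [|k ih]; first by rewrite mul0r addr0 expr0.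
rewrite exprS (le_trans _ (ler_wpM2l (ltW a_gt0) ih))//.
rewrite -natr1 -subr_ge0.
have -> : a * (1 + k%:R * (a - 1)) - (1 + (k%:R + 1) * (a - 1)) = k%:R * (a - 1) ^+ 2 by ring.
by rewrite mulr_ge0// sqr_ge0.
Qed.

Let pow_unbounded (x : R) : exists k, x < a ^+ k.
Proof.
have a10 : 0 < a - 1 by rewrite subr_gt0.
exists (Num.truncn (x / (a - 1))).+1; apply: lt_le_trans (bernoulli _).
have := truncnS_gt (x / (a - 1)); rewrite ltr_pdivrMr// => /lt_trans; apply.
by rewrite ltrDr.
Qed.

Lemma geometric_level (k0 : nat) (x : R) : a ^+ k0 <= x ->
  exists k, [/\ (k0 <= k)%N, a ^+ k <= x & x < a ^+ k.+1].
Proof.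
move=> k0x; have [k xk] := pow_unbounded x.
pose Q k := (x < a ^+ k.+1).
have exQ : exists k, Q k.
  by exists k; rewrite /Q (lt_le_trans xk)// ler_eXn2l.
case: (ex_minnP exQ) => m Qm minm; exists m; split => //.
  rewrite leqNgt; apply/negP => mk0.
  by have := lt_le_trans Qm (ler_weXn2l (ltW a_gt1) mk0); rewrite ltNge k0x.
case: m Qm minm => [|m] Qm minm; last first.
  by rewrite leNgt; apply/negP => /minm; rewrite ltnn.
by rewrite expr0 (le_trans _ k0x)// exprn_ege1// ltW.
Qed.

Section borel_cantelli.
Variables (Bad : nat -> set Omega) (K : R) (idx : nat -> nat).
Hypothesis mBad : forall n, measurable (Bad n).
Hypothesis K0 : 0 <= K.
Hypothesis PBad : forall n, 0 < v n -> (P (Bad n) <= (K / v n)%:E)%E.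
Hypothesis idx_ge : forall k, a ^+ k <= v (idx k).

(** Along indices of volume at least [a ^+ k] the failure probabilities are dominated by a geometric
    series. *)
Lemma geometric_borel_cantelli :
  {ae P, forall w, \forall k \near \oo, ~ Bad (idx k) w}.
Proof.
have PB k : (P (Bad (idx k)) <= (K * a^-1 ^+ k)%:E)%E.
  have ak0 : 0 < a ^+ k by rewrite exprn_gt0.
  have vk0 : 0 < v (idx k) := lt_le_trans ak0 (idx_ge k).
  apply: le_trans (PBad vk0) _; rewrite lee_fin ler_wpM2l//.
  by rewrite exprVn lef_pV2// posrE.
pose q := a^-1; have q0 : 0 <= q by rewrite invr_ge0 ltW.
have q1 : 0 < 1 - q by rewrite subr_gt0 invf_lt1.
have sumq n : \sum_(k < n) q ^+ k <= (1 - q)^-1.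
  rewrite -[leRHS]mul1r ler_pdivlMr// mulrC.
  by rewrite -opprB mulNr -subrX1 opprB gerBl exprn_ge0.
have sumP : (\sum_(k <oo) P (Bad (idx k)) < +oo)%E.
  apply: (@le_lt_trans _ _ (K * (1 - q)^-1)%:E); last exact: ltry.
  apply: lime_le; first exact: is_cvg_nneseries.
  apply: nearW => n; rewrite big_mkord.
  apply: (@le_trans _ _ (\sum_(k < n) (K * q ^+ k)%:E)%E).
    by apply: lee_sum => k _; exact: PB.
  by rewrite sumEFin lee_fin -mulr_sumr ler_wpM2l.
have lim0 := lim_sup_set_cvg0 (fun k => mBad (idx k)) sumP.
exists (lim_sup_set (fun k => Bad (idx k))); split => //.
  apply: bigcap_measurable => // n _; apply: bigcup_measurable => k _; exact: mBad.
move=> w /= Hw n _; apply: contrapT => Hn; apply: Hw.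
exists n => // k /= nk Bk; apply: Hn; by exists k.
Qed.

End borel_cantelli.

(* Between two geometric levels, monotonicity of [N] loses only a factor [a]. *)
Lemma geometric_lower (N : nat -> Omega -> \bar R) (Bad : nat -> set Omega) (K c : R) :
  (forall n w, N n w <= N n.+1 w)%E -> (forall n, measurable (Bad n)) -> 0 <= K -> 0 <= c ->
  (forall n, 0 < v n -> (P (Bad n) <= (K / v n)%:E)%E) ->
  (forall n w, ~ Bad n w -> ((c * v n)%:E <= N n w)%E) ->
  {ae P, forall w, \forall n \near \oo, ((c / a * v n)%:E <= N n w)%E}.
Proof.
move=> N_nd mBad K0 c0 PBad NBad.
have N_le n m w : (n <= m)%N -> (N n w <= N m w)%E.
  by elim: m => [|m ih]; rewrite leq_eqVlt => /predU1P[->//|]//; rewrite ltnS => /ih/le_trans; apply.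
(* The least index of volume at least [a ^+ k]: it precedes every index on level [k], so
   monotonicity carries its lower bound to all of them. *)
have /choice[idx idxP] : forall k, exists i, a ^+ k <= v i /\ forall n, a ^+ k <= v n -> (i <= n)%N.
  move=> k; have exk : exists n, a ^+ k <= v n.
    by have [n _ Hn] := v_oo (a ^+ k); exists n; exact: (Hn n (leqnn n)).
  by case: (ex_minnP exk) => m Qm minm; exists m.
have := geometric_borel_cantelli mBad K0 PBad (fun k => (idxP k).1).
apply: filterS => w [k0 _ Hk0]; have := v_oo (a ^+ k0).
apply: filterS => n /geometric_level[k [k0k akn nak]].
apply: le_trans (N_le _ _ w ((idxP k).2 _ akn)).
apply: le_trans (NBad _ _ (Hk0 k k0k)); rewrite lee_fin.
rewrite -mulrA ler_wpM2l// ler_pdivrMl//.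
apply: le_trans (ltW nak) _; rewrite exprS ler_wpM2l ?(ltW a_gt0)//.
exact: (idxP k).1.
Qed.

(** For an upper bound each level is represented by its last index, which exists because the volumes
    tend to infinity. An empty level receives an arbitrary index of large enough volume. *)
Lemma geometric_upper (N : nat -> Omega -> \bar R) (Bad : nat -> set Omega) (K c : R) :
  (forall n w, N n w <= N n.+1 w)%E -> (forall n, measurable (Bad n)) -> 0 <= K -> 0 <= c ->
  (forall n, 0 < v n -> (P (Bad n) <= (K / v n)%:E)%E) ->
  (forall n w, ~ Bad n w -> (N n w <= (c * v n)%:E)%E) ->
  {ae P, forall w, \forall n \near \oo, (N n w <= (c * a * v n)%:E)%E}.
Proof.
move=> N_nd mBad K0 c0 PBad NBad.
have N_le n m w : (n <= m)%N -> (N n w <= N m w)%E.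
  by elim: m => [|m ih]; rewrite leq_eqVlt => /predU1P[->//|]//; rewrite ltnS => /ih/le_trans; apply.
have /choice[idx idxP] : forall k, exists i, a ^+ k <= v i /\
    forall n, a ^+ k <= v n < a ^+ k.+1 -> (n <= i)%N /\ v i < a ^+ k.+1.
  move=> k; have [n0 _ Hn0] := v_oo (a ^+ k.+1).
  have [exk|nexk] := pselect (exists n, a ^+ k <= v n < a ^+ k.+1).
    have bnd n : a ^+ k <= v n < a ^+ k.+1 -> (n <= n0)%N.
      move=> /andP[_ vn]; rewrite leqNgt; apply/negP => /ltnW/Hn0/= H.
      by move: (lt_le_trans vn H); rewrite ltxx.
    case: (ex_maxnP exk bnd) => m Qm maxm; exists m; split; first by case/andP: Qm.
    by move=> n /maxm nm; split => //; case/andP: Qm.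
  exists n0; split; last by move=> n Hn; case: nexk; exists n.
  by apply: le_trans (Hn0 n0 (leqnn n0)); rewrite ler_weXn2l// ltW.
have := geometric_borel_cantelli mBad K0 PBad (fun k => (idxP k).1).
apply: filterS => w [k0 _ Hk0]; have := v_oo (a ^+ k0).
apply: filterS => n /geometric_level[k [k0k akn nak]].
have [|ni vi] := (idxP k).2 n; first by rewrite akn.
apply: le_trans (N_le _ _ w ni) _.
apply: le_trans (NBad _ _ (Hk0 k k0k)) _; rewrite lee_fin.
rewrite -mulrA ler_wpM2l// (le_trans (ltW vi))// exprS ler_wpM2l// ltW//.
Qed.

End geometric_levels.

(** * Poisson tail bounds *)

Section poisson_tail.
Context {R : realType}.

Lemma poisson_prob_series (r : R) (A : set nat) : 0 < r ->
  (poisson_prob r 0 A = \sum_(k <oo | k \in A) (poisson_pmf r k)%:E)%E.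
Proof.
move=> r0; rewrite /poisson_prob r0 nneseries_esum ?set_mem_set// => k _.
by rewrite lee_fin poisson_pmf_ge0.
Qed.

(** Chernoff's bound by change of measure: for k > x the Poisson weight of mean [r] is at most the
    stated constant times that of mean [r * expR s], whose total mass is 1. *)
Lemma poisson_prob_tail (r x s : R) : 0 <= r -> 0 <= x -> 0 <= s ->
  (poisson_prob r 0 [set k | (x < k%:R)%R] <= (expR (r * (expR s - 1) - s * x))%:E)%E.
Proof.
move=> + x0 s0; rewrite le_eqVlt => /predU1P[<-|r0].
  rewrite /poisson_prob ltxx diracE memNset ?lee_fin ?expR_ge0//=.
  by rewrite ltNge x0.
set A := [set k | _]; set C := expR _.
have r's0 : 0 < r * expR s by rewrite mulr_gt0// expR_gt0.
apply: (@le_trans _ _ (C%:E * poisson_prob (r * expR s) 0 A)%E); last first.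
  rewrite -[leRHS]mule1; apply: lee_wpmul2l; first by rewrite lee_fin expR_ge0.
  exact: (@probability_le1 _ _ _ (poisson_prob (r * expR s) 0)).
rewrite !poisson_prob_series// -nneseriesZl; last first.
  by move=> k _; rewrite lee_fin poisson_pmf_ge0.
apply: lee_nneseries => k; first by rewrite lee_fin poisson_pmf_ge0.
rewrite inE /A/= => xk; rewrite -EFinM lee_fin /poisson_pmf r0 r's0.
rewrite exprMn -expRM_natl.
have -> : C * (r ^+ k * expR (k%:R * s) / k`!%:R * expR (- (r * expR s))) =
    r ^+ k / k`!%:R * (C * expR (k%:R * s) * expR (- (r * expR s))) by ring.
rewrite ler_wpM2l//.
  by rewrite divr_ge0// exprn_ge0// ltW.
rewrite /C -!expRD ler_expR.
have : 0 <= s * (k%:R - x) by rewrite mulr_ge0// subr_ge0 ltW.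
lra.
Qed.

End poisson_tail.

Lemma measurable_ereal_gt (R : realType) (x : R) : measurable [set y : \bar R | (x%:E < y)%E].
Proof.
rewrite (_ : [set y | _] = [set` `]x%:E, +oo[%R]); first exact: emeasurable_itv.
by apply/seteqP; split => y /=; rewrite in_itv/= andbT.
Qed.

Section poisson_upper.
Context {R : realType} {d d'} {Omega : measurableType d} {E : measurableType d'}.
Variables (P : probability Omega R) (eta : Omega -> set E).
Variable Lam : {measure set E -> \bar R}.
Hypothesis etaP : poisson_process P eta Lam.
Implicit Types (B : set E).

Lemma prob_count_in_nat B (S : set nat) : measurable B -> (Lam B < +oo)%E ->
  measurable (\bigcup_(k in S) count_in (R := R) eta B [set k%:R%:E]) /\
  P (\bigcup_(k in S) count_in (R := R) eta B [set k%:R%:E]) = poisson_prob (fine (Lam B)) 0 S.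
Proof.
move=> mB Boo.
have mC k : measurable (count_in (R := R) eta B [set k%:R%:E]).
  by apply: (measurable_count_in etaP) => //.
split; first exact: bigcup_measurable.
rewrite measure_bigcup//; last first.
  move=> i j _ _ [w []]; rewrite /count_in/= => -> /eqP.
  by rewrite eqe eqr_nat => /eqP.
have ES : S = \bigcup_(k in S) [set k].
  by apply/seteqP; split => [k Sk|k [j Sj ->//]]; exists k.
rewrite [X in poisson_prob _ _ X]ES measure_bigcup//; last by move=> i j _ _ [w [/= -> ->]].
apply: eq_eseriesr => k _.
exact: (prob_count_eq etaP).
Qed.

Lemma prob_count_gt_le B (x s : R) : measurable B -> (Lam B < +oo)%E -> 0 <= x -> 0 <= s ->
  (P (count_in eta B [set y | x%:E < y]) <=
    (expR (fine (Lam B) * (expR s - 1) - s * x))%:E)%E.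
Proof.
move=> mB Boo x0 s0.
(* The event also contains the value [+oo], so it is enclosed in the complement of the finite values
   up to [x]. *)
have [mU PU] := prob_count_in_nat [set k | (k%:R <= x)%R] mB Boo.
apply: le_trans (poisson_prob_tail _ x0 s0); last by rewrite fine_ge0.
have -> : [set k : nat | x < k%:R] = ~` [set k | k%:R <= x].
  by apply/seteqP; split => k /=; rewrite ltNge => /negP.
have -> : (poisson_prob (fine (Lam B)) 0 (~` [set k : nat | (k%:R <= x)%R]) =
    1 - poisson_prob (fine (Lam B)) 0 [set k : nat | (k%:R <= x)%R])%E.
  exact: probability_setC.
rewrite -PU -probability_setC//.
apply: le_measure; rewrite ?inE.
- apply: (measurable_count_in etaP) => //.
  exact: measurable_ereal_gt.
- exact: measurableC.
move=> w /= xw [k /= kx]; rewrite /count_in/= => wk; move: xw.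
by rewrite /count_in/= wk lte_fin ltNge kx.
Qed.

Lemma point_count_fin_ae B : measurable B -> (Lam B < +oo)%E ->
  {ae P, forall w, (point_count eta B w : \bar R) \is a fin_num}.
Proof.
move=> mB Boo.
have [mU PU] := prob_count_in_nat [set: nat] mB Boo.
exists (~` \bigcup_(k in [set: nat]) count_in (R := R) eta B [set k%:R%:E]); split.
- exact: measurableC.
- rewrite probability_setC// PU.
  have -> : poisson_prob (fine (Lam B)) 0 setT = 1%E :> \bar R by exact: probability_setT.
  by rewrite subee.
move=> w /= Hw [k _]; rewrite /count_in/= => wk; apply: Hw; by rewrite wk.
Qed.

Variables (v : nat -> R) (B : nat -> set E) (f : R).
Hypothesis f0 : 0 <= f.
Hypothesis v0 : forall n, 0 <= v n.
Hypothesis v_oo : forall M : R, \forall n \near \oo, M <= v n.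
Hypothesis mB : forall n, measurable (B n).
Hypothesis B_nd : forall n, B n `<=` B n.+1.
Hypothesis LamB : forall n, Lam (B n) = (f * v n)%:E.

Lemma point_count_nd n w : (point_count eta (B n) w <= point_count eta (B n.+1) w :> \bar R)%E.
Proof.
by apply: counting_le; exact: setIS.
Qed.

(** Half of the slack [e] goes into the Poisson tail, half into the factor [a] lost between levels.
    The tail is at most expR (- g v_n) for some g > 0, weakened to 1/(g v_n) to fit the common form
    of the failure bounds. *)
Lemma point_count_limsup (e : R) : 0 < e ->
  {ae P, forall w, \forall n \near \oo, (point_count eta (B n) w <= ((f + e) * v n)%:E)%E}.
Proof.
move=> e0; pose c := f + e / 2; pose a := (f + e) / c.
have c0 : 0 < c by rewrite ltr_wpDl// divr_gt0.
have a1 : 1 < a by rewrite ltr_pdivlMr// mul1r /c ltrD2l ltr_pdivrMr// ltr_pMr// ltr1n.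
have ca : c * a = f + e by rewrite /a mulrC divfK// gt_eqF.
(* With this tilt, expR s - 1 <= s / (1 - s) turns the exponent f (expR s - 1) - s c into at most
   [- g], where [g] is positive because c > f. *)
pose s := (c - f) / (2 * c).
have cf : 0 < c - f by rewrite /c addrAC subrr add0r divr_gt0.
have s0 : 0 < s by rewrite divr_gt0// mulr_gt0.
have s1 : 1 - s = (c + f) / (2 * c) by rewrite /s; field; rewrite gt_eqF.
have cpf : 0 < c + f by rewrite ltr_pwDl.
have s10 : 0 < 1 - s by rewrite s1 divr_gt0// mulr_gt0.
pose g := s * c * (c - f) / (c + f).
have g0 : 0 < g by apply: divr_gt0 => //; apply: mulr_gt0 => //; exact: mulr_gt0.
have exps : expR s - 1 <= s / (1 - s).
  rewrite lerBlDr; have -> : s / (1 - s) + 1 = (1 - s)^-1.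
    by field; rewrite gt_eqF.
  rewrite -[expR s]invrK -expRN lef_pV2 ?posrE ?expR_gt0//.
  exact: expR_ge1Dx.
have fg : f * (expR s - 1) - s * c <= - g.
  apply: (@le_trans _ _ (f * (s / (1 - s)) - s * c)).
    by rewrite lerB// ler_wpM2l.
  rewrite s1 le_eqVlt; apply/orP; left; apply/eqP; rewrite /g; field.
  by rewrite !gt_eqF.
rewrite -ca.
apply: (geometric_upper v_oo a1 (K := g^-1) (N := fun n => point_count eta (B n))
  (Bad := fun n => count_in eta (B n) [set y | (c * v n)%:E < y]%E)).
- by move=> n w; exact: point_count_nd.
- move=> n; apply: (measurable_count_in etaP) => //.
  exact: measurable_ereal_gt.
- by rewrite invr_ge0 ltW.
- exact: ltW.
- move=> n vn0; have Boo : (Lam (B n) < +oo)%E by rewrite LamB ltry.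
  apply: le_trans (prob_count_gt_le (mB n) Boo _ (ltW s0)) _.
    by rewrite mulr_ge0// ltW.
  rewrite LamB/= lee_fin.
  have -> : f * v n * (expR s - 1) - s * (c * v n) =
    (f * (expR s - 1) - s * c) * v n by ring.
  apply: (@le_trans _ _ (expR (- (g * v n)))).
    by rewrite ler_expR -[leRHS]mulNr ler_wpM2r.
  have gv0 : 0 < g * v n by exact: mulr_gt0.
  rewrite -invfM expRN lef_pV2 ?posrE ?expR_gt0//.
  by apply: le_trans (expR_ge1Dx _); rewrite lerDr.
- by move=> n w /negP; rewrite /count_in/= -leNgt.
Qed.

End poisson_upper.

(** * Exposed and hidden points *)

Section event_liminf.
Context {R : realType} {d} {Omega : measurableType d} (P : probability Omega R).
Variables (v : nat -> R) (T : nat -> finType) (A : forall n, T n -> set Omega).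
Variables (nb : forall n, rel (T n)) (K : nat) (u : forall n, T n -> R) (c C : R).
Variable N : nat -> Omega -> \bar R.
Hypothesis v_oo : forall M : R, \forall n \near \oo, M <= v n.
Hypothesis mA : forall n i, measurable (@A n i).
Hypothesis nbK : forall n i, (#|@nb n i| <= K)%N.
Hypothesis indep : forall n i j, ~~ @nb n i j ->
  P (@A n i `&` @A n j) = (P (@A n i) * P (@A n j))%E.
Hypothesis u_sum : forall n, \sum_i @u n i = v n.
Hypothesis PA_ge : forall n i, ((c * @u n i)%:E <= P (@A n i))%E.
Hypothesis PA_le : forall n i, (P (@A n i) <= (C * @u n i)%:E)%E.
Hypothesis C0 : 0 <= C.
Hypothesis v0 : forall n, 0 <= v n.
Hypothesis N_nd : forall n w, (N n w <= N n.+1 w)%E.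
Hypothesis AN : forall n w, ((\sum_i (\1_(@A n i) w : R))%:E <= N n w)%E.

(** Half of [e] pays for the Chebyshev deviation [t n], the other half for the factor [a] between
    geometric levels. If c <= e there is nothing to prove. *)
Lemma event_liminf (e : R) : 0 < e ->
  {ae P, forall w, \forall n \near \oo, (((c - e) * v n)%:E <= N n w)%E}.
Proof.
move=> e0.
have [ce0|ce0] := leP (c - e) 0.
  apply: aeW => w; apply: nearW => n; apply: le_trans (AN n w); rewrite lee_fin.
  apply: (@le_trans _ _ 0); last by apply: sumr_ge0 => i _.
  by rewrite mulr_le0_ge0.
pose t n := e / 2 * v n.
have c'0 : 0 < c - e / 2.
  by rewrite (lt_trans ce0)// ltrD2l ltrN2 ltr_pdivrMr// ltr_pMr// ltr1n.
pose a := (c - e / 2) / (c - e).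
have a1 : 1 < a.
  rewrite ltr_pdivlMr// mul1r ltrD2l ltrN2.
  by rewrite ltr_pdivrMr// ltr_pMr// ltr1n.
have ca : (c - e / 2) / a = c - e by rewrite /a invf_div mulrCA divff ?mulr1// gt_eqF.
have mX n : measurable_fun setT (fun w => \sum_i (\1_(@A n i) w : R)).
  by apply: measurable_sum => i; exact: measurable_indic.
rewrite -ca.
apply: (geometric_lower v_oo a1 (K := K%:R * C / (e / 2) ^+ 2) (N := N) (Bad := fun n =>
   [set w | \sum_i (\1_(@A n i) w : R) <= \sum_i fine (P (@A n i)) - t n])).
- exact: N_nd.
- move=> n; set y := _ - t n.
  rewrite (_ : [set _ | _] = (fun w => \sum_i (\1_(@A n i) w : R)) @^-1` `]-oo, y]); last first.
    by apply/seteqP; split => w /=; rewrite in_itv.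
  by rewrite -[X in measurable X]setTI; exact: mX.
- by apply: divr_ge0; [exact: mulr_ge0|exact: sqr_ge0].
- exact: ltW.
- move=> n vn0; have tn0 : 0 < t n by rewrite mulr_gt0// divr_gt0.
  apply: le_trans (chebyshev_events (@mA n) (@nbK n) (@indep n) tn0) _.
  rewrite lee_fin /t exprMn.
  have -> : K%:R * C / (e / 2) ^+ 2 / v n = K%:R * (C * v n) / ((e / 2) ^+ 2 * v n ^+ 2).
    by field; rewrite !gt_eqF.
  apply: ler_wpM2r; first by rewrite invr_ge0; apply: mulr_ge0; exact: sqr_ge0.
  apply: ler_wpM2l => //; rewrite -u_sum mulr_sumr.
  apply: ler_sum => i _; rewrite -lee_fin prob_fineK//.
- move=> n w /= /negP; rewrite -ltNge => H; apply: le_trans (AN n w).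
  rewrite lee_fin (le_trans _ (ltW H))// /t mulrBl lerB// -u_sum mulr_sumr.
  by apply: ler_sum => i _; rewrite -lee_fin prob_fineK.
Qed.

End event_liminf.

(** * Half-open cubes *)

Section cube_grid.
Context {R : realType}.
Variables (d N : nat) (delta : R).
Hypothesis delta_gt0 : 0 < delta.

(** Coordinates are shifted by [N], so that the cubes filling the box from -delta N to delta N form
    a finite type. *)
Definition grid_index := {ffun 'I_d -> 'I_(2 * N)}.

Implicit Type q : grid_index.

Definition cube_corner q : 'rV[R]_d := \row_l (delta * ((q l : nat)%:R - N%:R)).

Definition cube q : set 'rV[R]_d := [set x | forall l,
  `[cube_corner q ord0 l, cube_corner q ord0 l + delta[%classic (x ord0 l)].

Lemma measurable_cube_grid q : measurable (cube q).
Proof. exact: (@measurable_cube R d (fun l => `[cube_corner q ord0 l, cube_corner q ord0 l + delta[%classic)). Qed.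

Lemma cube_near_corner q x : cube q x -> enorm (x - cube_corner q) <= d%:R * delta.
Proof.
move=> xq; apply: enorm_le_coord => l; have := xq l; rewrite /= in_itv/= => /andP[h1 h2].
by rewrite !mxE; move: h1 h2; rewrite !mxE => h1 h2; rewrite ger0_norm ?subr_ge0// lerBlDl ltW.
Qed.

Lemma cube_trivIset : trivIset setT cube.
Proof.
move=> q q' _ _ [x [xq xq']]; apply/ffunP => l; apply/val_inj/eqP; rewrite /= eqn_leq.
have := xq l; have := xq' l; rewrite /= !in_itv/= !mxE => /andP[h1 h2] /andP[h3 h4].
have H (m n : nat) : delta * (m%:R - N%:R) < delta * (n%:R - N%:R) + delta -> (m <= n)%N.
  have -> : delta * (n%:R - N%:R) + delta = delta * (n%:R - N%:R + 1) by ring.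
  rewrite ltr_pM2l// => h; rewrite -ltnS -(ltr_nat R) -natr1; lra.
by rewrite !H// ?(le_lt_trans h1)// (le_lt_trans h3).
Qed.

Lemma cube_cover (x : 'rV[R]_d) : (forall l, `|x ord0 l| < delta * N%:R) -> exists q, cube q x.
Proof.
move=> xN; pose y l := x ord0 l / delta + N%:R.
have y0 l : 0 <= y l.
  have := xN l; rewrite ltr_norml => /andP[h _].
  by rewrite /y -lerBlDr sub0r ler_pdivlMr// mulNr mulrC ltW.
have yN l : (Num.truncn (y l) < 2 * N)%N.
  have := xN l; rewrite ltr_norml => /andP[_ h].
  have /andP[tl _] := truncn_itv (y0 l).
  rewrite -(ltr_nat R) (le_lt_trans tl)// /y natrM mulr2n mulrDl mul1r ltrD2r.
  by rewrite ltr_pdivrMr// mulrC.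
exists [ffun l => Ordinal (yN l)] => l; rewrite /= in_itv/= !mxE !ffunE/=.
have /andP[h1 h2] := truncn_itv (y0 l).
have -> : x ord0 l = delta * (y l - N%:R).
  by rewrite /y addrK mulrC divfK// gt_eqF.
have -> : delta * ((Num.truncn (y l))%:R - N%:R) + delta =
  delta * ((Num.truncn (y l))%:R - N%:R + 1) by ring.
rewrite ler_pM2l// ltr_pM2l//; move: h1 h2; rewrite -natr1 => h1 h2.
by apply/andP; split; lra.
Qed.

Definition cube_nb (k : nat) : rel grid_index :=
  fun q q' => [forall l, (q l <= q' l + k)%N && (q' l <= q l + k)%N].

Lemma card_cube_nb k q : (#|cube_nb k q| <= (2 * k).+1 ^ d)%N.
Proof.
(* For neighbours the truncated subtraction is exact and at most [2 * k], so the offset determines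
   [q']. *)
pose f (q' : grid_index) : {ffun 'I_d -> 'I_(2 * k).+1} :=
  [ffun l => inord (q' l + k - q l)].
have finj : {in cube_nb k q &, injective f}.
  move=> q1 q2 /forallP h1 /forallP h2 /ffunP E; apply/ffunP => l; apply/val_inj => /=.
  have /(congr1 val) := E l; rewrite !ffunE.
  have /andP[a1 a2] := h1 l; have /andP[b1 b2] := h2 l.
  by rewrite /= !inordK; lia.
by rewrite -(card_in_image finj) (leq_trans (max_card _))// card_ffun !card_ord.
Qed.

Lemma cube_far k q q' : ~~ cube_nb k q q' ->
  delta * k.+1%:R <= enorm (cube_corner q - cube_corner q').
Proof.
rewrite negb_forall => /existsP[l]; rewrite negb_and -!ltnNge => H.
apply: le_trans (coord_le_enorm _ l); rewrite !mxE.
have -> : delta * ((q l : nat)%:R - N%:R) - delta * ((q' l : nat)%:R - N%:R) =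
  delta * ((q l : nat)%:R - (q' l : nat)%:R) by ring.
rewrite normrM gtr0_norm// ler_pM2l//.
case/orP: H => H.
  by rewrite ler_normr lerBrDr -natrD ler_nat; apply/orP; left; lia.
by rewrite ler_normr opprB !lerBrDr -!natrD !ler_nat; apply/orP; right; lia.
Qed.

Lemma cube_measure_sum (W : set 'rV[R]_d) : measurable W ->
  (forall x, W x -> forall l, `|x ord0 l| < delta * N%:R) ->
  lebesgue_rV W = (\sum_(q : grid_index) lebesgue_rV (W `&` cube q))%E.
Proof.
move=> mW WN.
have {1}-> : W = \bigcup_(q in [set: grid_index]) (W `&` cube q).
  apply/seteqP; split => [x Wx|x [q _ []//]].
  by have [q xq] := cube_cover (WN x Wx); exists q.
rewrite measure_fin_bigcup//=.
- rewrite (_ : [set: grid_index] = [set` index_enum grid_index]).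
    by rewrite -fsbig_seq ?index_enum_uniq.
  by apply/seteqP; split => q _ //=; rewrite mem_index_enum.
- apply/trivIsetP => q q' _ _ qq'; have /trivIsetP/(_ q q' I I qq') H := cube_trivIset.
  by rewrite setIACA H setI0.
- by move=> q _; apply: measurableI => //; exact: measurable_cube_grid.
Qed.

Lemma cube_measure_le (W : set 'rV[R]_d) q : measurable W ->
  (lebesgue_rV (W `&` cube q) <= (delta ^+ d)%:E)%E.
Proof.
move=> mW.
have cE : cube q = (fun x => 1 *: x + - cube_corner q) @^-1` [set x | forall l, `[0, delta[%classic (x ord0 l)].
  apply/seteqP; split => x H l; have := H l; rewrite /= !in_itv/= scale1r !mxE;
  by rewrite subr_ge0 ltrBlDl.
apply: (@le_trans _ _ (lebesgue_rV (cube q))).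
  apply: le_measure; rewrite ?inE; last exact: subIsetr.
    by apply: measurableI => //; exact: measurable_cube_grid.
  exact: measurable_cube_grid.
rewrite cE lebesgue_rV_affine//; last exact: (@measurable_cube R d (fun=> `[0, delta[%classic)).
rewrite invr1 expr1n mul1e lebesgue_rV_cube// lebesgue_measure_itv/= lte_fin delta_gt0.
by rewrite -EFinB subr0 -EFin_expe.
Qed.

End cube_grid.

Section cells.
Context {R : realType} {d : nat} {disp} {Omega : measurableType disp}.
Variables (P : probability Omega R) (F : cumulative R R).
Local Notation point := ('rV[R]_d * measurableTypeR R)%type.
Variables (eta : Omega -> set point) (W : nat -> set 'rV[R]_d) (v : nat -> R).
Hypothesis etaP : poisson_process P eta (@intensity R d F).
Hypothesis mW : forall n, measurable (W n).
Hypothesis W_nd : forall n, W n `<=` W n.+1.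
Hypothesis W_bnd : forall n, exists M : R, forall x, W n x -> forall l, `|x ord0 l| <= M.
Hypothesis Wv : forall n, lebesgue_rV (W n) = (v n)%:E.
Hypothesis v_oo : forall M : R, \forall n \near \oo, M <= v n.

Section cells_liminf.
Variables (a b delta r : R) (D : 'rV[R]_d -> set point) (S1 S2 : set (\bar R)).
Variables (Z : Omega -> set point) (c C : R).
Hypothesis ab : a <= b.
Hypothesis delta_gt0 : 0 < delta.
Hypothesis dr : d%:R * delta <= r.
Hypothesis mD : forall x, measurable (D x).
Hypothesis Dr : forall x p, D x p -> enorm (p.1 - x) <= r.
Hypothesis mS1 : measurable S1.
Hypothesis mS2 : measurable S2.
Hypothesis C0 : 0 <= C.

Definition cell (B : set 'rV[R]_d) : set point := B `*` `]a, b].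

(** A common form for both kinds of points: one point in the cell and an empty rest of the upper
    cone force an exposed point; nonempty cell and lower cone force a hidden one. Removing the cell
    from [D x] makes the two counts independent. *)
Definition cell_event (B : set 'rV[R]_d) (x : 'rV[R]_d) : set Omega :=
  count_in eta (cell B) S1 `&` count_in eta (D x `\` cell B) S2.

Hypothesis P_ge : forall (B : set 'rV[R]_d) x (u : R), measurable B ->
  B `<=` ceball x (d%:R * delta) -> lebesgue_rV B = u%:E -> u <= delta ^+ d ->
  ((c * u)%:E <= P (cell_event B x))%E.
Hypothesis P_le : forall (B : set 'rV[R]_d) x (u : R), measurable B ->
  lebesgue_rV B = u%:E -> (P (cell_event B x) <= (C * u)%:E)%E.
Hypothesis cell_point : forall (B : set 'rV[R]_d) x w, B `<=` ceball x (d%:R * delta) ->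
  cell_event B x w -> exists p, [/\ eta w p, cell B p & Z w p].

Lemma measurable_cell B : measurable B -> measurable (cell B).
Proof. by move=> mB; apply: measurableX => //; exact: measurable_itv. Qed.

(** Cubes cut by the boundary of the window are kept as smaller pieces, so the volumes add up to
    [v n] exactly and no boundary term arises; hence the hypotheses on probabilities concern
    arbitrary measurable [B]. Pieces are disjoint, so events in different cubes yield different
    points. *)
Lemma cells_liminf (e : R) : 0 < e ->
  {ae P, forall w, \forall n \near \oo,
    (((c - e) * v n)%:E <= counting (eta w `&` cell (W n) `&` Z w))%E}.
Proof.
move=> e0; have /choice[M WM] := W_bnd.
pose N n := (Num.truncn (M n / delta)).+1.
have WN n x : W n x -> forall l, `|x ord0 l| < delta * (N n)%:R.
  move=> Wx l; apply: le_lt_trans (WM n x Wx l) _.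
  by rewrite mulrC -ltr_pdivrMr// truncnS_gt.
pose T n : finType := grid_index d (N n).
pose Q n (q : T n) := W n `&` cube delta q.
have mQ n (q : T n) : measurable (Q n q).
  by apply: measurableI => //; exact: measurable_cube_grid.
pose u n (q : T n) : R := fine (lebesgue_rV (Q n q)).
have Qu n (q : T n) : lebesgue_rV (Q n q) = (u n q)%:E.
  by rewrite fineK// ge0_fin_numE// (le_lt_trans (cube_measure_le delta_gt0 q (mW n)))// ltry.
have u_le n (q : T n) : u n q <= delta ^+ d.
  by rewrite -lee_fin -Qu; exact: cube_measure_le.
have Qball n (q : T n) : Q n q `<=` ceball (cube_corner delta q) (d%:R * delta).
  by move=> x [_ xq]; exact: cube_near_corner.
(* Corners of cubes that are not [k]-neighbours are more than [2 * r] apart, so the regions within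
   [r] of them are disjoint. *)
pose k := Num.truncn (2 * r / delta).
have k_gt : 2 * r < delta * k.+1%:R.
  by rewrite [ltRHS]mulrC -ltr_pdivrMr//; exact: truncnS_gt.
have v0 n : 0 <= v n by rewrite -lee_fin -Wv measure_ge0.
apply: (@event_liminf _ _ _ P v T (fun n q => cell_event (Q n q) (cube_corner delta q))
  (fun n => @cube_nb d (N n) k) ((2 * k).+1 ^ d)%N u c C
  (fun n w => counting (eta w `&` cell (W n) `&` Z w))) => //.
- move=> n q; apply: measurableI; apply: (measurable_count_in etaP) => //.
    exact: measurable_cell.
  by apply: measurableD => //; exact: measurable_cell.
- by move=> n q; exact: card_cube_nb.
- move=> n q q' /(cube_far delta_gt0) far.
  have near_corner (X : T n) p : cell (Q n X) p -> enorm (p.1 - cube_corner delta X) <= r.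
    by move=> [Qp _]; apply: le_trans dr; exact: (Qball n X).
  have dis (X Y : set point) : (forall p, X p -> enorm (p.1 - cube_corner delta q) <= r) ->
      (forall p, Y p -> enorm (p.1 - cube_corner delta q') <= r) -> X `&` Y = set0.
    move=> Xr Yr; apply/seteqP; split => p //= [Xp Yp].
    have := enorm_dist_triangle p.1 (cube_corner delta q) (cube_corner delta q').
    rewrite (enorm_distC (cube_corner delta q) p.1) => /(le_trans far).
    rewrite leNgt (le_lt_trans _ k_gt)// mulr2n mulrDl mul1r lerD//; [exact: Xr|exact: Yr].
  have DrD (x : 'rV[R]_d) (X : set point) p : (D x `\` X) p -> enorm (p.1 - x) <= r.
    by move=> [/Dr].
  have mC (X : T n) : measurable (cell (Q n X)) by exact: measurable_cell.
  have mDC (X : T n) : measurable (D (cube_corner delta X) `\` cell (Q n X)).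
    exact: measurableD.
  rewrite /cell_event (count_in_indep4 etaP)//.
  + rewrite (count_in_indep2 etaP)// ?(count_in_indep2 etaP)//; exact: setDIK.
  + exact: setDIK.
  + apply: dis => p; exact: near_corner.
  + by apply: dis => p; [exact: near_corner|exact: DrD].
  + by apply: dis => p; [exact: DrD|exact: near_corner].
  + by apply: dis => p; exact: DrD.
  + exact: setDIK.
- move=> n; have := cube_measure_sum delta_gt0 (mW n) (WN n); rewrite Wv.
  under eq_bigr do rewrite (Qu n). by rewrite sumEFin => -[].
- by move=> n q; exact: (P_ge (mQ n q) (Qball n q) (Qu n q) (u_le n q)).
- by move=> n q; exact: (P_le _ (mQ n q) (Qu n q)).
- move=> n w; apply: counting_le => p [[ep [Wp pI]] Zp]; split => //; split => //.
  by split => //; exact: W_nd.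
move=> n w.
pose A (q : T n) := cell_event (Q n q) (cube_corner delta q).
(* One point is selected per successful cube; the default (0, 0) occurs only for the others. *)
pose f (q : T n) : point := xget (0, 0) [set p | [/\ eta w p, cell (Q n q) p & Z w p]].
have fP (q : T n) : A q w -> [/\ eta w (f q), cell (Q n q) (f q) & Z w (f q)].
  by move=> Aq; apply: (@xgetPex _ (0, 0) [set p | [/\ eta w p, cell (Q n q) p & Z w p]]);
     exact: cell_point (Qball n q) Aq.
pose Q1 := [pred q : T n | w \in A q].
have -> : \sum_(q : T n) (\1_(A q) w : R) = #|Q1|%:R.
  rewrite -sum1_card natr_sum [RHS]big_mkcond/=; apply: eq_bigr => q _.
  by rewrite indicE inE; case: (w \in A q).
apply: (@counting_card_ge _ _ _ Q1 f).
  move=> q /set_mem/fP[h1 [h2 h3] h4]; split => //; split => //.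
  by split => //; case: h2.
move=> q q' /set_mem/fP[_ [[_ h1] _] _] /set_mem/fP[_ [[_ h2] _] _] E.
by apply: (@cube_trivIset R d (N n) delta delta_gt0 q q' I I); exists (f q).1; split => //; rewrite E.
Unshelve. all: exact: R.
Qed.

End cells_liminf.

End cells.

Section counting_points.
Context {R : realType} {T : choiceType}.
Implicit Types A : set T.
Local Open Scope ereal_scope.

Lemma counting_set1 (x : T) : counting [set x] = 1 :> \bar R.
Proof. by rewrite counting_esum esum_set1. Qed.

Lemma counting_eq0 A : counting A = 0 :> \bar R -> A = set0.
Proof.
move=> A0; apply/seteqP; split => x //= Ax.
have : counting [set x] <= counting A :> \bar R by apply: counting_le => y ->.
by rewrite counting_set1 A0 lee_fin ler10.
Qed.

Lemma counting_neq0 A : counting A <> 0 :> \bar R -> A !=set0.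
Proof.
by move=> A0; apply/set0P/eqP => AE; apply: A0; rewrite AE counting_esum esum_set0.
Qed.

Lemma counting_eq1 A : counting A = 1 :> \bar R -> exists x, A = [set x].
Proof.
move=> A1; have [|x Ax] := @counting_neq0 A.
  by rewrite A1 => /eqP; rewrite onee_eq0.
exists x; move: A1; rewrite (counting_setID A [set x]).
have -> : A `&` [set x] = [set x] by apply/setIidPr => y ->.
rewrite counting_set1 => A1.
apply/seteqP; split => [y Ay|y ->//]; apply: contrapT => yx.
have : counting [set y] <= counting (A `&` ~` [set x]) :> \bar R.
  by apply: counting_le => z ->.
rewrite counting_set1 => /(leeD2l 1).
by rewrite A1 -EFinD lee_fin gerDl ler10.
Qed.

End counting_points.

Lemma laguerre_cell_center {R : realType} {d : nat} (p : 'rV[R]_d * R) eta :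
  laguerre_cell p eta p.1 <->
  forall q, eta q -> p.2 <= enorm (p.1 - q.1) ^+ 2 + q.2.
Proof.
rewrite /laguerre_cell/= subrr.
have -> : enorm (0 : 'rV[R]_d) = 0.
  by rewrite /enorm big1 ?sqrtr0// => i _; rewrite mxE expr0n.
by rewrite expr0n/= add0r.
Qed.

(** * Lower bounds for exposed and for hidden points *)

Section exposed_points.
Context {R : realType} {d : nat} {disp} {Omega : measurableType disp}.
Variables (P : probability Omega R) (F : cumulative R R).
Local Notation point := ('rV[R]_d * measurableTypeR R)%type.
Variables (eta : Omega -> set point) (W : nat -> set 'rV[R]_d) (v : nat -> R).
Hypothesis d_ge2 : (2 <= d)%N.
Hypothesis eta_pos : forall w p, eta w p -> 0 < p.2.
Hypothesis etaP : poisson_process P eta (@intensity R d F).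
Hypothesis mW : forall n, measurable (W n).
Hypothesis W_nd : forall n, W n `<=` W n.+1.
Hypothesis W_bnd : forall n, exists M : R, forall x, W n x -> forall l, `|x ord0 l| <= M.
Hypothesis Wv : forall n, lebesgue_rV (W n) = (v n)%:E.
Hypothesis v_oo : forall M : R, \forall n \near \oo, M <= v n.
Local Notation V := (cone_volume d).

Let d_gt0 : (0 < d)%N := ltnW d_ge2.

Definition exposed w : set point := [set p | laguerre_cell p (eta w) p.1].

Lemma exposedP w p : exposed w p <->
  forall q, eta w q -> p.2 <= enorm (p.1 - q.1) ^+ 2 + q.2.
Proof. exact: laguerre_cell_center. Qed.

(** Side of the cubes: the diameter bound [d%:R * delta] must not exceed 1, the range of
    [cone_slope], and the linear error [K * delta] has to be absorbed by [e]. *)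
Lemma small_step (K e : R) : 0 <= K -> 0 < e ->
  exists delta : R, [/\ 0 < delta, delta <= 1, d%:R * delta <= 1 & K * delta <= e].
Proof.
move=> K0 e0; have d0 : 0 < d%:R :> R by rewrite ltr0n.
have K10 : 0 < K + 1 by rewrite ltr_wpDl.
exists (Num.min d%:R^-1 (e / (K + 1))); split.
- by rewrite lt_min invr_gt0 d0 divr_gt0.
- by rewrite ge_min invf_le1// ler1n d_gt0.
- by rewrite -ler_pdivlMl// mulr1 ge_min lexx.
- apply: (@le_trans _ _ (K * (e / (K + 1)))).
    by rewrite ler_wpM2l// ge_min lexx orbT.
  by rewrite mulrA ler_pdivrMr// mulrC ler_pM2l// lerDl.
Qed.

Let v0 n : 0 <= v n.
Proof. by rewrite -lee_fin -Wv measure_ge0. Qed.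

Section interval.
Variables a b : R.
Hypothesis a0 : 0 <= a.
Hypothesis ab : a <= b.
Local Notation f := (F b - F a).
Local Notation cell := (@cell R d a b).

Let b0 : 0 <= b := le_trans a0 ab.

Let f0 : 0 <= f.
Proof. by rewrite subr_ge0 cumulative_nd. Qed.

Let Lam_cell (B : set 'rV[R]_d) (u : R) : measurable B -> lebesgue_rV B = u%:E ->
  intensity F (cell B) = (f * u)%:E.
Proof. by move=> mB Bu; rewrite intensity_rect// Bu -EFinM mulrC. Qed.

Let cell_lty (B : set 'rV[R]_d) (u : R) : measurable B -> lebesgue_rV B = u%:E ->
  (intensity F (cell B) < +oo)%E.
Proof. by move=> mB Bu; rewrite (Lam_cell mB Bu) ltry. Qed.

Let single_cell (B : set 'rV[R]_d) (u : R) : measurable B -> lebesgue_rV B = u%:E ->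
  P (count_in eta (cell B) [set 1%E : \bar R]) = (f * u * expR (- (f * u)))%:E.
Proof.
move=> mB Bu; transitivity ((fine (intensity F (cell B)) *
  expR (- fine (intensity F (cell B))))%:E); last by rewrite (Lam_cell mB Bu).
by apply: (prob_single etaP); [exact: measurable_cell|exact: cell_lty Bu].
Qed.

Let nonvoid_cell (B : set 'rV[R]_d) (u : R) : measurable B -> lebesgue_rV B = u%:E ->
  P (count_in eta (cell B) (~` [set 0%E : \bar R])) = (1 - expR (- (f * u)))%:E.
Proof.
move=> mB Bu; transitivity ((1 - expR (- fine (intensity F (cell B))))%:E); last first.
  by rewrite (Lam_cell mB Bu).
by apply: (prob_nonvoid etaP); [exact: measurable_cell|exact: cell_lty Bu].
Qed.

Let void_set (B : set point) : measurable B -> (intensity F B < +oo)%E ->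
  P (count_in eta B [set 0%E : \bar R]) = (expR (- fine (intensity F B)))%:E.
Proof. by move=> mB Boo; exact: (prob_void etaP). Qed.

Let nonvoid_set (B : set point) : measurable B -> (intensity F B < +oo)%E ->
  P (count_in eta B (~` [set 0%E : \bar R])) = (1 - expR (- fine (intensity F B)))%:E.
Proof. by move=> mB Boo; exact: (prob_nonvoid etaP). Qed.

Let u0 (B : set 'rV[R]_d) (u : R) : lebesgue_rV B = u%:E -> 0 <= u.
Proof. by move=> Bu; rewrite -lee_fin -Bu measure_ge0. Qed.

Let expN_ge (x : R) : 1 - x <= expR (- x).
Proof. exact: expR_ge1Dx. Qed.

(** The cone around the corner, widened by [rho], serves all positions of the single point within
    its cube; the widening costs at most [s * rho] in the exponent. *)
Lemma exposed_liminf (e : R) : 0 < e ->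
  {ae P, forall w, \forall n \near \oo,
    (((f * expR (- V F b) - e) * v n)%:E <=
       counting (eta w `&` cell (W n) `&` exposed w))%E}.
Proof.
move=> e0; have e20 : 0 < e / 2 by rewrite divr_gt0.
pose s := @cone_slope R d F b; have s0 : 0 <= s by exact: cone_slope_ge0.
have [|delta [delta0 delta1 rho1 Kd]] := @small_step (f * (s * d%:R)) (e / 2) _ e20.
  by rewrite mulr_ge0// mulr_ge0.
pose rho := d%:R * delta.
have rho0 : 0 <= rho by rewrite mulr_ge0// ltW.
pose c := f * expR (- (V F b + s * rho)).
have c_ge : f * expR (- V F b) - e / 2 <= c.
  rewrite /c opprD expRD lerBlDr -lerBlDl mulrA -{1}[f * expR _]mulr1 -mulrBr.
  apply: (@le_trans _ _ (f * (s * rho))); last by rewrite /rho (mulrA s) mulrA.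
  rewrite -mulrA ler_wpM2l//.
  apply: (@le_trans _ _ (1 * (s * rho))); last by rewrite mul1r.
  apply: ler_pM.
  - exact: expR_ge0.
  - by rewrite subr_ge0 -expR0 ler_expR oppr_le0 mulr_ge0.
  - by rewrite -expR0 ler_expR oppr_le0 cone_volume_ge0.
  - by rewrite lerBlDl -lerBlDr expN_ge.
have mU (x : 'rV[R]_d) : measurable (upper_cone b rho x) by exact: measurable_upper_cone.
have U_lty (x : 'rV[R]_d) : (intensity F (upper_cone b rho x) < +oo)%E.
  by rewrite (le_lt_trans (intensity_upper_cone_le d_ge2 F x b0 rho0 rho1))// ltry.
have cell_U B (x : 'rV[R]_d) : B `<=` ceball x rho -> cell B `<=` upper_cone b rho x.
  move=> Bx p [Bp]; rewrite /= in_itv/= => /andP[ap pb]; split.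
    by rewrite pb (le_lt_trans a0).
  by rewrite (le_trans (Bx _ Bp))// lerDr sqrtr_ge0.
have ae_liminf : {ae P, forall w, \forall n \near \oo,
    (((c - e / 2) * v n)%:E <= counting (eta w `&` cell (W n) `&` exposed w))%E}.
  apply: (@cells_liminf _ _ _ _ P F eta W v etaP mW W_nd W_bnd Wv v_oo a b delta
     (Num.sqrt b + rho) (fun x => upper_cone b rho x) [set 1%E] [set 0%E] exposed c f) => //.
  - by rewrite lerDr sqrtr_ge0.
  - move=> x p [/andP[p0 pb] px]; rewrite (le_trans px)// lerD2r ler_wsqrtr// gerBl.
    exact: ltW.
  - move=> B x u mB Bx Bu _; rewrite /cell_event.
    have mcell := @measurable_cell R d a b B mB.
    have mD : measurable (upper_cone b rho x `\` cell B) by exact: measurableD.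
    have LamD : (intensity F (upper_cone b rho x) =
        intensity F (upper_cone b rho x `\` cell B) + (f * u)%:E)%E.
      rewrite -(Lam_cell mB Bu) -measureU//; last exact: setDKI.
      by rewrite setDKU//; exact: cell_U.
    have D_lty : (intensity F (upper_cone b rho x `\` cell B) < +oo)%E.
      by apply: le_lt_trans (U_lty x); rewrite LamD leeDl// lee_fin mulr_ge0// (u0 Bu).
    rewrite (count_in_indep2 etaP)//; last exact: setDIK.
    rewrite (single_cell mB Bu) (void_set mD D_lty) -EFinM lee_fin.
    (* The exponential from the single point and the void probability of the rest combine into the
       void probability of the whole cone, which contains the cell. *)
    rewrite -[leRHS]mulrA -expRD -opprD.
    have D_fin : intensity F (upper_cone b rho x `\` cell B) \is a fin_num.
      by rewrite ge0_fin_numE.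
    have -> : f * u + fine (intensity F (upper_cone b rho x `\` cell B)) =
        fine (intensity F (upper_cone b rho x)).
      rewrite LamD addrC; apply: esym; exact: (fineD D_fin (isT : (f * u)%:E \is a fin_num)).
    rewrite /c -mulrA [expR _ * u]mulrC mulrA; apply: ler_wpM2l.
      by rewrite mulr_ge0// (u0 Bu).
    rewrite ler_expR lerN2 -lee_fin fineK ?ge0_fin_numE//.
    exact: intensity_upper_cone_le.
  - move=> B x u mB Bu; have mcell := @measurable_cell R d a b B mB.
    apply: (@le_trans _ _ (P (count_in eta (cell B) [set 1%E]))).
      apply: le_measure; rewrite ?inE; last exact: subIsetl.
        apply: measurableI; apply: (measurable_count_in etaP) => //.
        exact: measurableD.
      exact: (measurable_count_in etaP).
    rewrite (single_cell mB Bu) lee_fin.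
    apply: ler_piMr; first by rewrite mulr_ge0// (u0 Bu).
    by rewrite -expR0 ler_expR oppr_le0 mulr_ge0// (u0 Bu).
  - move=> B x w Bx [/= /counting_eq1[p pE] /counting_eq0 DE].
    have [ep cp] : (eta w `&` cell B) p by rewrite pE.
    exists p; split => //; apply/exposedP => q eq_.
    have [qU|qU] := pselect (upper_cone b rho x q).
      have [qc|qc] := pselect (cell B q).
        have : (eta w `&` cell B) q by [].
        by rewrite pE => ->; rewrite lerDr sqr_ge0.
      have : (eta w `&` (upper_cone b rho x `\` cell B)) q by [].
      by rewrite DE.
    (* A point outside the cone either weighs more than [b], and is harmless, or is further than
       Num.sqrt (b - q.2) + rho from [x], hence further than Num.sqrt (b - q.2) from [p]. *)
    have q0 := eta_pos eq_.
    have [_ ] := cp; rewrite /= in_itv/= => /andP[_ pb].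
    have [qb|bq] := leP q.2 b; last first.
      by rewrite (le_trans pb)// (le_trans (ltW bq))// lerDr sqr_ge0.
    have qx : Num.sqrt (b - q.2) + rho < enorm (q.1 - x).
      by rewrite ltNge; apply/negP => qx; apply: qU; split => //; rewrite q0.
    have px : enorm (p.1 - x) <= rho by apply: Bx; case: cp.
    have : Num.sqrt (b - q.2) <= enorm (p.1 - q.1).
      have := enorm_dist_triangle p.1 q.1 x; rewrite (enorm_distC q.1 p.1) => h.
      rewrite -(lerD2r rho) (le_trans (ltW qx))// (le_trans h)// lerD2l//.
    move=> /(lerXn2r 2 _ _); rewrite !nnegrE sqrtr_ge0 enorm_ge0 => /(_ isT isT).
    by rewrite sqr_sqrtr ?subr_ge0// lerBlDr; exact: le_trans.
apply: filterS ae_liminf => w; apply: filterS => n; apply: le_trans.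
rewrite lee_fin ler_wpM2r//.
by move: c_ge; move: (f * _) => x; lra.
Qed.

(** A point q of the narrowed cone is within Num.sqrt (a - q.2) of every p in the cell, so |p - q|^2
    + q.2 <= a < p.2. The cell lies above weight [a] and the cone below it, which makes them
    disjoint. *)
Lemma hidden_liminf (e : R) : 0 < e ->
  {ae P, forall w, \forall n \near \oo,
    (((f * (1 - expR (- V F a)) - e) * v n)%:E <=
       counting (eta w `&` cell (W n) `&` ~` exposed w))%E}.
Proof.
move=> e0; have e20 : 0 < e / 2 by rewrite divr_gt0.
pose s := @cone_slope R d F a; have s0 : 0 <= s by exact: cone_slope_ge0.
(* Two errors of order delta: [s * d%:R] from narrowing the cone, [f] from counting a cell with
   several points only once. *)
have [|delta [delta0 delta1 rho1 Kd]] := @small_step (f * (s * d%:R + f)) (e / 2) _ e20.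
  by rewrite mulr_ge0// addr_ge0// mulr_ge0.
pose rho := d%:R * delta.
have rho0 : 0 <= rho by rewrite mulr_ge0// ltW.
pose y0 := 1 - expR (- V F a) - s * rho.
pose c := f * (y0 - delta * f).
have c_ge : f * (1 - expR (- V F a)) - e / 2 <= c.
  rewrite /c /y0; move: Kd; rewrite /rho; move: (expR _) => x Kd.
  have -> : f * (1 - x - s * (d%:R * delta) - delta * f) =
     f * (1 - x) - f * (s * d%:R + f) * delta by ring.
  by rewrite lerB.
have mL (x : 'rV[R]_d) : measurable (lower_cone a rho x) by exact: measurable_lower_cone.
have L_le (x : 'rV[R]_d) p : lower_cone a rho x p ->
    [/\ 0 < p.2, p.2 <= a & enorm (p.1 - x) <= Num.sqrt (a - p.2) - rho].
  move=> [/andP[p0 pa] px]; split => //; rewrite (le_trans pa)//.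
  by rewrite ge_max a0 gerBl sqr_ge0.
have L_lty (x : 'rV[R]_d) : (intensity F (lower_cone a rho x) < +oo)%E.
  apply: le_lt_trans (_ : (intensity F (upper_cone a rho x) < +oo)%E).
    apply: le_measure; rewrite ?inE//; first exact: measurable_upper_cone.
    move=> p /L_le[p0 pa px]; split; first by rewrite p0.
    by rewrite (le_trans px)// lerD2l ge0_cp.
  by rewrite (le_lt_trans (intensity_upper_cone_le d_ge2 F x a0 rho0 rho1))// ltry.
have ae_liminf : {ae P, forall w, \forall n \near \oo,
    (((c - e / 2) * v n)%:E <= counting (eta w `&` cell (W n) `&` ~` exposed w))%E}.
  apply: (@cells_liminf _ _ _ _ P F eta W v etaP mW W_nd W_bnd Wv v_oo a b delta
     (Num.sqrt a + rho) (fun x => lower_cone a rho x) (~` [set 0%E]) (~` [set 0%E])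
     (fun w => ~` exposed w) c f) => //.
  - by rewrite lerDr sqrtr_ge0.
  - move=> x p /L_le[p0 pa px]; rewrite (le_trans px)// lerD//.
      by rewrite ler_wsqrtr// gerBl ltW.
    by rewrite (le_trans _ rho0)// oppr_le0.
  - exact: measurableC.
  - exact: measurableC.
  - move=> B x u mB Bx Bu udelta; rewrite /cell_event.
    have mcell := @measurable_cell R d a b B mB.
    have -> : lower_cone a rho x `\` cell B = lower_cone a rho x.
      apply/seteqP; split => p [] // p1 p2; split => //.
      move=> [_]; rewrite /= in_itv/= => /andP[ap _].
      by have [_ pa _] := L_le x p (conj p1 p2); move: (lt_le_trans ap pa); rewrite ltxx.
    rewrite (count_in_indep2 etaP) //; [|exact: measurableC|exact: measurableC|]; last first.
      apply/seteqP; split => p //= [[_ ]]; rewrite /= in_itv/= => /andP[ap _] /L_le[_ pa _].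
      by move: (lt_le_trans ap pa); rewrite ltxx.
    rewrite (nonvoid_cell mB Bu) (nonvoid_set (mL x) (L_lty x)) -EFinM lee_fin.
    have := intensity_lower_cone_ge d_ge2 F x a0 rho0 rho1.
    rewrite -[X in (_ <= X)%E]fineK ?ge0_fin_numE// lee_fin.
    have : 0 <= fine (intensity F (lower_cone a rho x)) by rewrite fine_ge0.
    move: (fine _) => L L0 LV.
    have uu := u0 Bu.
    have lam_le : f * u <= delta * f.
      rewrite mulrC ler_wpM2r// (le_trans udelta)//.
      by rewrite -(prednK d_gt0) exprS ler_piMr ?(ltW delta0)// exprn_ile1// ltW.
    have lam0 : 0 <= f * u by rewrite mulr_ge0.
    have eL0 := expR_ge0 (- L).
    have eL1 : expR (- L) <= 1 by rewrite -expR0 ler_expR oppr_le0.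
    have y0L : y0 <= 1 - expR (- L).
      have h1 : expR (- L) * expR (- (s * rho)) <= expR (- V F a).
        by rewrite -expRD ler_expR -opprD lerN2 -lerBlDr.
      have h2 : expR (- L) * (1 - s * rho) <= expR (- L) * expR (- (s * rho)).
        by rewrite ler_wpM2l// expN_ge.
      have h3 : expR (- L) * (s * rho) <= s * rho by rewrite ler_piMl// mulr_ge0.
      have := le_trans h2 h1; rewrite mulrBr mulr1 lerBlDr => h12.
      rewrite /y0 -addrA lerD2l -opprD lerN2 (le_trans h12)//.
      by rewrite lerD2l.
    (* With y = f u, 1 - e^(-y) = e^(-y) (e^y - 1) >= (1 - y) y, and y <= delta f. *)
    have lam_ge : f * u * (1 - delta * f) <= 1 - expR (- (f * u)).
      have -> : 1 - expR (- (f * u)) = expR (- (f * u)) * (expR (f * u) - 1).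
        by rewrite mulrBr -expRD addNr expR0 mulr1.
      apply: (@le_trans _ _ (expR (- (f * u)) * (f * u))); last first.
        rewrite ler_wpM2l ?expR_ge0// lerBrDl; exact: expR_ge1Dx.
      rewrite mulrC ler_wpM2r// (le_trans _ (expN_ge _))// lerB//.
    rewrite /c; have -> : f * (y0 - delta * f) * u = f * u * (y0 - delta * f) by ring.
    apply: (@le_trans _ _ (f * u * (1 - delta * f) * (1 - expR (- L)))); last first.
      by rewrite ler_wpM2r// subr_ge0.
    rewrite -[leRHS]mulrA ler_wpM2l//.
    have : delta * f * (1 - expR (- L)) <= delta * f.
      by rewrite ler_piMr ?mulr_ge0 ?(ltW delta0)// gerBl.
    by move=> h; rewrite mulrBl mul1r; exact: lerB.
  - move=> B x u mB Bu; have mcell := @measurable_cell R d a b B mB.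
    apply: (@le_trans _ _ (P (count_in eta (cell B) (~` [set 0%E])))).
      apply: le_measure; rewrite ?inE; last exact: subIsetl.
        apply: measurableI; apply: (measurable_count_in etaP) => //.
        * exact: measurableC.
        * exact: measurableD.
        * exact: measurableC.
      by apply: (measurable_count_in etaP) => //; exact: measurableC.
    rewrite (nonvoid_cell mB Bu) lee_fin.
    by rewrite lerBlDl -lerBlDr expN_ge.
  - move=> B x w Bx [/= /counting_neq0[p [ep cp]] /counting_neq0[q [eq_ [qL _]]]].
    exists p; split => // /exposedP/(_ q eq_); apply/negP; rewrite -ltNge.
    have [q0 qa qx] := L_le _ _ qL.
    have [_ ] := cp; rewrite /= in_itv/= => /andP[ap _].
    have px : enorm (p.1 - x) <= rho by apply: Bx; case: cp.
    apply: le_lt_trans ap; rewrite -lerBrDr -[leRHS]sqr_sqrtr ?subr_ge0//.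
    rewrite lerXn2r ?nnegrE ?sqrtr_ge0 ?enorm_ge0//.
    apply: le_trans (enorm_dist_triangle x p.1 q.1) _; rewrite (enorm_distC x q.1).
    by move: px qx; move: (enorm _) (enorm _) => x1 x2; lra.
apply: filterS ae_liminf => w; apply: filterS => n; apply: le_trans.
rewrite lee_fin ler_wpM2r//.
by move: c_ge; move: (f * _) => x; lra.
Qed.

End interval.

End exposed_points.

(** * The limit of the number of exposed points *)

Section exposed_limit.
Context {R : realType} {d : nat} {disp} {Omega : measurableType disp}.
Variables (P : probability Omega R) (F : cumulative R R).
Local Notation point := ('rV[R]_d * measurableTypeR R)%type.
Variables (eta : Omega -> set point) (W : nat -> set 'rV[R]_d) (v : nat -> R).
Hypothesis d_ge2 : (2 <= d)%N.
Hypothesis eta_pos : forall w p, eta w p -> 0 < p.2.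
Hypothesis etaP : poisson_process P eta (@intensity R d F).
Hypothesis mW : forall n, measurable (W n).
Hypothesis W_nd : forall n, W n `<=` W n.+1.
Hypothesis W_bnd : forall n, exists M : R, forall x, W n x -> forall l, `|x ord0 l| <= M.
Hypothesis Wv : forall n, lebesgue_rV (W n) = (v n)%:E.
Hypothesis v_oo : forall M : R, \forall n \near \oo, M <= v n.
Local Notation V := (cone_volume d).
Local Notation G := (G_of d F).

Let v0 n : 0 <= v n.
Proof. by rewrite -lee_fin -Wv measure_ge0. Qed.

Definition exposed_count w n (a b : R) : \bar R :=
  counting (eta w `&` cell a b (W n) `&` exposed eta w).

Lemma exposed_count_grid w n z m : 0 <= z ->
  exposed_count w n 0 z =
  (\sum_(i < m.+1) exposed_count w n (grid z m i) (grid z m i.+1))%E.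
Proof.
move=> z0; rewrite -{1}(grid_last z m); elim: m.+1 => [|k ih].
  rewrite big_ord0 grid0 /exposed_count counting_esum.
  rewrite (_ : _ `&` _ = set0) ?esum_set0//.
  apply/seteqP; split => p //= [[_ [_ /=]]]; rewrite in_itv/= => /andP[].
  by move=> /lt_le_trans/[apply]; rewrite ltxx.
rewrite big_ord_recr/= -ih /exposed_count.
have gk : grid z m k <= grid z m k.+1 by exact: grid_nd.
have gk0 : 0 <= grid z m k by exact: grid_ge0.
rewrite (counting_setID _ [set p | p.2 <= grid z m k]); congr (_ + _)%E; congr counting.
  apply/seteqP; split => p; rewrite /cell/= !in_itv/=.
    by move=> [[[ep [Wp /andP[p0 _]]] xp] pk]; rewrite p0 pk.
  by move=> [[ep [Wp /andP[p0 pk]]] xp]; rewrite p0 pk (le_trans pk).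
apply/seteqP; split => p; rewrite /cell/= !in_itv/=.
  by move=> [[[ep [Wp /andP[p0 pk']]] xp] /negP]; rewrite -ltNge => pk; rewrite pk pk'.
move=> [[ep [Wp /andP[kp pk]]] xp]; rewrite pk (le_lt_trans gk0 kp).
by do !split => //; apply/negP; rewrite -ltNge.
Qed.

Lemma expN_diff_le (x y : R) : 0 <= x -> x <= y -> expR (- x) - expR (- y) <= y - x.
Proof.
move=> x0 xy; have yx : - y <= - x by rewrite lerN2.
apply: le_trans (expR_sub_le yx) _; rewrite opprK addrC.
by rewrite ler_piMl ?subr_ge0// -expR0 ler_expR oppr_le0.
Qed.

(** The count per unit volume and the increment of G lie, up to [e], between the same bounds f expR
    (- V b) and f expR (- V a). Their gap is at most a product of increments of F and V, hence
    remains small when summed over a fine grid. The bound on the total count also supplies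
    finiteness, which permits the subtraction. *)
Lemma exposed_count_itv (a b e : R) : 0 <= a -> a <= b -> 0 < e ->
  {ae P, forall w, \forall n \near \oo, exposed_count w n a b \is a fin_num /\
    `|fine (exposed_count w n a b) - (G b - G a) * v n| <=
      ((F b - F a) * (V F b - V F a) + e) * v n}.
Proof.
move=> a0 ab e0; pose f := F b - F a.
have f0 : 0 <= f by rewrite subr_ge0 cumulative_nd.
have e20 : 0 < e / 2 by rewrite divr_gt0.
have V0 : 0 <= V F a by rewrite cone_volume_ge0 ?(ltnW d_ge2).
have Vab : V F a <= V F b by exact: cone_volume_ndT.
have mC n : measurable (cell a b (W n)) by exact: measurable_cell.
have C_nd n : cell a b (W n) `<=` cell a b (W n.+1).
  by move=> p [Wp pI]; split => //; exact: W_nd.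
have LamC n : intensity F (cell a b (W n)) = (f * v n)%:E.
  by rewrite intensity_rect// Wv -EFinM mulrC.
have Gge : f * expR (- V F b) <= G b - G a.
  rewrite G_of_diff// mulrC -stieltjes_cst//.
  apply: (@stieltjes_le _ _ _ _ _ _ 1) => //.
  - exact: measurable_expN.
  - by move=> t _; exact: expN_le1.
  - by move=> t _; exact: expN_le1.
  - by move=> t /andP[_ tb]; rewrite ler_expR lerN2 cone_volume_ndT.
have Gle : G b - G a <= f * expR (- V F a).
  rewrite G_of_diff// mulrC -stieltjes_cst//.
  apply: (@stieltjes_le _ _ _ _ _ _ 1) => //.
  - exact: measurable_expN.
  - by move=> t _; exact: expN_le1.
  - by move=> t _; exact: expN_le1.
  - by move=> t /andP[at_ _]; rewrite ler_expR lerN2 cone_volume_ndT// ltW.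
have gap : f * expR (- V F a) - f * expR (- V F b) <= f * (V F b - V F a).
  by rewrite -mulrBr ler_wpM2l// expN_diff_le.
have H1 := exposed_liminf d_ge2 eta_pos etaP mW W_nd W_bnd Wv v_oo a0 ab e20.
have H2 := hidden_liminf d_ge2 etaP mW W_nd W_bnd Wv v_oo a0 ab e20.
have H3 := point_count_limsup etaP f0 v0 v_oo mC C_nd LamC e20.
apply: filterS3 H1 H2 H3 => w; apply: filterS3 => n.
pose X := exposed_count w n a b; rewrite -/X.
pose M : \bar R := counting (eta w `&` cell a b (W n) `&` ~` exposed eta w).
have XM : point_count eta (cell a b (W n)) w = (X + M)%E by exact: counting_setID.
move=> h1 h2; rewrite [leLHS]XM => h3.
have X0 : (0 <= X)%E by exact: counting_ge0.
have M0 : (0 <= M)%E by exact: counting_ge0.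
have Xfin : X \is a fin_num.
  by rewrite ge0_fin_numE// (le_lt_trans _ (le_lt_trans h3 (ltry _)))// leeDl.
have Mfin : M \is a fin_num.
  by rewrite ge0_fin_numE// (le_lt_trans _ (le_lt_trans h3 (ltry _)))// leeDr.
split => //; move: (h1 : _ <= X)%E (h2 : _ <= M)%E h3 => {h1 h2}.
rewrite -(fineK Xfin) -(fineK Mfin) -EFinD !lee_fin [fine _%:E]/=; move: (fine X) (fine M) => x m.
have k1 : 0 <= (G b - G a - f * expR (- V F b)) * v n by rewrite mulr_ge0// subr_ge0.
have k2 : 0 <= (f * expR (- V F a) - (G b - G a)) * v n by rewrite mulr_ge0// subr_ge0.
have k3 : 0 <= (f * (V F b - V F a) - (f * expR (- V F a) - f * expR (- V F b))) * v n.
  by rewrite mulr_ge0// subr_ge0.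
have k4 := mulr_ge0 (ltW e0) (v0 n).
move: k1 k2 k3 k4; rewrite [f * (1 - _)]mulrBr mulr1 ler_norml.
rewrite -/f; move: (f * expR (- V F b)) (f * expR (- V F a)) (G b - G a) (f * (_ - _)) (v n) => A B D g u.
move=> k1 k2 k3 k4 h1 h2 h3; apply/andP; split; lra.
Qed.

Lemma cumulative_grid_telescope h m :
  \sum_(i < m.+1) (F (grid h m i.+1) - F (grid h m i)) = F h - F 0.
Proof.
rewrite -(big_mkord xpredT (fun i => F (grid h m i.+1) - F (grid h m i))).
by rewrite (telescope_sumr (fun i => F (grid h m i)))// grid_last grid0.
Qed.

Lemma exposed_count_approx z e : 0 <= z -> 0 < e ->
  {ae P, forall w, \forall n \near \oo,
    `|fine (exposed_count w n 0 z) - G z * v n| <= e * v n}.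
Proof.
move=> z0 e0; have e20 : 0 < e / 2 by rewrite divr_gt0.
pose C := unit_ball_volume d * (d%:R * Num.sqrt z ^+ d.-1 * (F z - F 0)).
(* The mesh makes the oscillation of [V F] times the total mass at most e/2; the other half of [e]
   is shared equally by the intervals. *)
have [m Cm] := cvg_sqrt_grid ((F z - F 0) * C) z0 e20.
have m0 : 0 < m.+1%:R :> R by rewrite ltr0n.
have e'0 : 0 < e / 2 / m.+1%:R by rewrite divr_gt0.
have H0 : {ae P, forall w, forall i : 'I_m.+1, \forall n \near \oo,
    exposed_count w n (grid z m i) (grid z m i.+1) \is a fin_num /\
    `|fine (exposed_count w n (grid z m i) (grid z m i.+1)) -
      (G (grid z m i.+1) - G (grid z m i)) * v n| <=
      ((F (grid z m i.+1) - F (grid z m i)) * (V F (grid z m i.+1) - V F (grid z m i)) +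
       e / 2 / m.+1%:R) * v n}.
  apply: filter_forall => i; apply: exposed_count_itv e'0; [exact: grid_ge0|exact: grid_nd].
apply: filterS H0 => w /filter_forall; apply: filterS => n H.
rewrite (exposed_count_grid w n m z0).
rewrite (eq_bigr (fun i : 'I_m.+1 => (fine (exposed_count w n (grid z m i) (grid z m i.+1)))%:E)); last first.
  by move=> i _; rewrite fineK//; have [] := H i.
rewrite sumEFin/= -(G_grid_telescope d F z m) mulr_suml -sumrB.
apply: le_trans (ler_norm_sum _ _ _) _.
pose osc := C * Num.sqrt (z / m.+1%:R).
apply: (@le_trans _ _ (\sum_(i < m.+1)
    ((F (grid z m i.+1) - F (grid z m i)) * osc + e / 2 / m.+1%:R) * v n)).
  apply: ler_sum => i _; have [_ /le_trans] := H i; apply.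
  rewrite ler_wpM2r// lerD2r ler_wpM2l//; last exact: cone_volume_grid.
  by rewrite subr_ge0 cumulative_nd// grid_nd.
rewrite -mulr_suml big_split/= -mulr_suml cumulative_grid_telescope sumr_const card_ord.
rewrite ler_wpM2r// -[X in _ + X <= _]mulr_natr divfK ?gt_eqF// /osc mulrA.
by move: (_ * Num.sqrt _) Cm => x; lra.
Qed.

(** The exceptional set must not depend on the tolerance, so the countably many tolerances 1/(k+1)
    are treated together. *)
Lemma exposed_count_cvg z : 0 <= z ->
  {ae P, forall w, (v n)^-1 * fine (exposed_count w n 0 z) @[n --> \oo] --> G z}.
Proof.
move=> z0; have k0 (k : nat) : 0 < k.+1%:R^-1 :> R by rewrite invr_gt0.
apply: filterS (ae_foralln (fun k => exposed_count_approx z0 (k0 k))) => w H.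
apply/cvgrPdist_le => e e0; pose k := Num.truncn e^-1.
have ke : k.+1%:R^-1 <= e.
  by rewrite -[leRHS]invrK lef_pV2 ?posrE ?invr_gt0//; exact/ltW/truncnS_gt.
near=> n; have v1 : 1 <= v n by near: n; exact: v_oo.
have vn0 : 0 < v n by rewrite (lt_le_trans ltr01).
have -> : G z - (v n)^-1 * fine (exposed_count w n 0 z) =
    - ((v n)^-1 * (fine (exposed_count w n 0 z) - G z * v n)).
  by rewrite mulrBr mulrCA mulVf ?gt_eqF// mulr1 opprB.
rewrite normrN normrM gtr0_norm ?invr_gt0// ler_pdivrMl//.
rewrite [leRHS]mulrC; apply: (@le_trans _ _ (k.+1%:R^-1 * v n)); last by rewrite ler_wpM2r// ltW.
by near: n; exact: H.
Unshelve. all: by end_near.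
Qed.

Lemma G_hat_exposed w n z :
  G_hat (W n) (eta w) z = (v n)^-1 * fine (exposed_count w n 0 z).
Proof.
rewrite /G_hat Wv; congr (_ * fine _).
rewrite /exposed_count counting_esum -setIA esum_mkcondr; apply: eq_esum => p ep.
have -> : (p \in cell 0 z (W n) `&` exposed eta w) =
    (p.1 \in W n) && (p.2 \in `]0, z]%classic) && (p.1 \in laguerre_cell p (eta w)).
  apply/idP/idP => [/set_mem[[Wp Ip] Lp]|]; first by rewrite !mem_set.
  by move=> /andP[/andP[/set_mem Wp /set_mem Ip] /set_mem Lp]; apply/mem_set.
rewrite !indicE -!natrM !mulnb; case: (_ && _) => //.
Qed.

End exposed_limit.

(** * From countably many weights to all weights *)

Section monotone_convergence.
Context {R : realType}.
Implicit Types F : cumulative R R.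

(* Every [z >= 0] outside this countable set is a continuity point of [F]: a
   jump of [F] at [z] straddles some rational [r], whence
   [z = inf {y | r <= F y}]. *)
Definition dense_weights F (k : nat) : R :=
  match @choice.unpickle (rat + rat)%type k with
  | Some (inl r) => `|ratr r|
  | Some (inr r) => `|inf [set y | 0 <= y /\ ratr r <= F y]|
  | None => 0
  end.

Lemma dense_weights_ge0 F k : 0 <= dense_weights F k.
Proof. by rewrite /dense_weights; case: choice.unpickle => [[]|]. Qed.

Lemma dense_weights_rat F (r : rat) : 0 <= ratr r :> R ->
  exists k, dense_weights F k = ratr r.
Proof.
move=> r0; exists (choice.pickle (inl r : rat + rat)%type).
by rewrite /dense_weights choice.pickleK ger0_norm.
Qed.

(** On the right, right continuity provides a rational. On the left, take a rational r just below
    [F z]: if z is not in the sequence it exceeds inf {y | r <= F y}, and a rational between the two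
    has F-value at least r. *)
Lemma dense_weights_bracket F z e : 0 <= z -> 0 < e ->
  (exists k, dense_weights F k = z) \/
  exists i j, [/\ dense_weights F i <= z, z <= dense_weights F j &
    F (dense_weights F j) - F (dense_weights F i) <= e].
Proof.
move=> z0 e0; have [|nz] := pselect (exists k, dense_weights F k = z); [by left|right].
have e20 : 0 < e / 2 by rewrite divr_gt0.
have [i [iz Fi]] : exists i, dense_weights F i <= z /\ F z - F (dense_weights F i) <= e / 2.
  have [r /itvP rI] : exists r : rat, ratr r \in `]F z - e / 2, F z[.
    by apply: rat_in_itvoo; rewrite gtrBl.
  pose S := [set y : R | 0 <= y /\ ratr r <= F y].
  have Sz : S z by split => //; rewrite ltW// rI.
  have Slb : has_lbound S by exists 0 => y [].
  have S0 : 0 <= inf S by apply: lb_le_inf; [exists z|move=> y []].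
  have Sz' : inf S <= z by exact: ge_inf.
  have Sz_gt : 0 < z - inf S.
    rewrite subr_gt0 lt_neqAle Sz' andbT; apply/eqP => Sz_; apply: nz.
    exists (choice.pickle (inr r : rat + rat)%type).
    by rewrite /dense_weights choice.pickleK ger0_norm.
  have Sinf : has_inf S by split => //; exists z.
  have [y [y0 ry]] := inf_adherent Sz_gt Sinf; rewrite addrC subrK => yz.
  have [t /itvP tI] := rat_in_itvoo yz.
  have t0 : 0 <= ratr t :> R by rewrite (le_trans y0)// ltW// tI.
  have [i it] := dense_weights_rat F t0.
  exists i; rewrite it; split; first by rewrite ltW// tI.
  have yt : F y <= F (ratr t) by rewrite cumulative_nd// ltW// tI.
  have zr : F z - e / 2 <= ratr r by rewrite ltW// rI.
  by rewrite lerBlDr -lerBlDl (le_trans zr)// (le_trans ry).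
have [j [zj Fj]] : exists j, z <= dense_weights F j /\ F (dense_weights F j) - F z <= e / 2.
  have [b Fb] := nondecreasing_right_continuousP z F e20.
  have /rat_in_itvoo[t /itvP tI] : z < z + b%:num by rewrite ltrDl.
  have t0 : 0 <= ratr t :> R by rewrite (le_trans z0)// ltW// tI.
  have [j jt] := dense_weights_rat F t0.
  exists j; rewrite jt; split; first by rewrite ltW// tI.
  by rewrite lerBlDl (le_trans _ Fb)// cumulative_nd// ltW// tI.
by exists i, j; split => //; move: Fi Fj; move: (F _) (F _) (F z) => x y t; lra.
Qed.

(** Increments of [G] are dominated by those of [F], so bracketing [z] for [F] also brackets it for
    [G]; monotonicity of [g n] squeezes the middle value. *)
Lemma cvg_dense_weights F (G : R -> R) (g : nat -> R -> R) :
  (forall a b, 0 <= a -> a <= b -> 0 <= G b - G a <= F b - F a) ->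
  (forall n a b, 0 <= a -> a <= b -> g n a <= g n b) ->
  (forall k, g n (dense_weights F k) @[n --> \oo] --> G (dense_weights F k)) ->
  forall z, 0 <= z -> g n z @[n --> \oo] --> G z.
Proof.
move=> GF g_nd gq z z0; apply/cvgrPdist_le => e e0.
have e20 : 0 < e / 2 by rewrite divr_gt0.
have [[k <-]|[i [j [iz zj Fij]]]] := dense_weights_bracket F z0 e20.
  by move/cvgrPdist_le : (gq k); exact.
have i0 := dense_weights_ge0 F i.
have /andP[G1 _] := GF _ _ i0 iz; have /andP[G2 _] := GF _ _ z0 zj.
have /andP[_ G3] := GF _ _ i0 (le_trans iz zj).
move/cvgrPdist_le : (gq i) => /(_ _ e20); move/cvgrPdist_le : (gq j) => /(_ _ e20).
apply: filterS2 => n; have := g_nd n _ _ i0 iz; have := g_nd n _ _ z0 zj.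
move: (g n _) (g n _) (g n z) G1 G2 G3 Fij; move: (G _) (G _) (G z) (F _) (F _).
move=> Gi Gj Gz Fi Fj gi gj gz; rewrite !ler_norml.
by do 6 move=> ?; move=> /andP[? ?] /andP[? ?]; apply/andP; split; lra.
Qed.

End monotone_convergence.

(** * The estimator *)

Section distribution_of_measure.
Context {R : realType}.
Variable FF : {measure set R -> \bar R}.
Hypothesis FF_finite : locally_finite FF.
Hypothesis FF_pos : FF `]-oo, 0]%classic = 0%E.

Let dist (z : R) : R := fine (FF `]0, z]%classic).

Let FF_itv (a b : R) : FF `]a, b]%classic \is a fin_num.
Proof.
rewrite ge0_fin_numE ?measure_ge0// FF_finite//.
exists (`|a| + `|b|); split => // M abM t /=; rewrite in_itv/= => /andP[at_ tb].
apply: le_trans (ltW abM); rewrite ler_norml.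
have := lerNnormlW (lexx `|a|); have := ler_norm b.
have := normr_ge0 a; have := normr_ge0 b; move: (`|a|) (`|b|) => x y y0 x0 hb ha.
by apply/andP; split; lra.
Qed.

Let FF_le (A B : set R) : measurable A -> measurable B -> A `<=` B -> (FF A <= FF B)%E.
Proof. by move=> mA mB AB; apply: le_measure; rewrite ?inE. Qed.

Let dist_nd : {homo dist : x y / x <= y}.
Proof.
move=> x y xy; rewrite fine_le// FF_le// => t /=; rewrite !in_itv/= => /andP[-> tx].
exact: le_trans tx xy.
Qed.

(** Continuity from above along the intervals []0, x + 1/(n+1)]], which have finite mass;
    monotonicity passes from this sequence to all right neighbours. *)
Let dist_rc : right_continuous dist.
Proof.
move=> x; pose E n : set R := `]0, x + n.+1%:R^-1]%classic.
have n0 n : 0 < n.+1%:R^-1 :> R by rewrite invr_gt0.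
have capE : \bigcap_n E n = `]0, x]%classic.
  apply/seteqP; split => t.
    move=> tE; have := tE 0%N I; rewrite /E /= !in_itv/= => /andP[t0 _]; rewrite t0/=.
    apply/ler_addgt0Pr => e e0; pose k := Num.truncn e^-1.
    have := tE k I; rewrite /E/= in_itv/= => /andP[_ /le_trans]; apply; rewrite lerD2l.
    by rewrite -[leRHS]invrK lef_pV2 ?posrE ?invr_gt0//; exact/ltW/truncnS_gt.
  rewrite /= in_itv/= => /andP[t0 tx] n _; rewrite /E/= in_itv/= t0/=.
  by rewrite (le_trans tx)// lerDl ltW.
have cvgE : FF \o E @ \oo --> FF `]0, x]%classic.
  rewrite -capE; apply: nonincreasing_cvg_mu => //.
    by rewrite -ge0_fin_numE ?measure_ge0//; exact: FF_itv.
  - by move=> n; exact: measurable_itv.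
  - by rewrite capE; exact: measurable_itv.
  apply/nonincreasing_seqP => n; apply/subsetPset => t; rewrite /E /= !in_itv/= => /andP[-> tn].
  by rewrite (le_trans tn)// lerD2l lef_pV2 ?posrE// ler_nat.
have {}cvgE : dist (x + n.+1%:R^-1) @[n --> \oo] --> dist x.
  by apply: fine_cvg; rewrite fineK.
apply/cvgrPdist_le => e e0; move/cvgrPdist_le : cvgE => /(_ _ e0)[N _ /(_ N (leqnn N))].
have xN : dist x <= dist (x + N.+1%:R^-1) by apply: dist_nd; rewrite lerDl ltW.
rewrite distrC ger0_norm ?subr_ge0// => distN; near=> y.
have xy : x <= y by apply/ltW; near: y; exact: nbhs_right_gt.
have yN : y <= x + N.+1%:R^-1.
  by apply/ltW; near: y; apply: nbhs_right_lt; rewrite ltrDl.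
rewrite distrC ger0_norm ?subr_ge0 ?dist_nd//.
by apply: le_trans distN; rewrite lerD2r dist_nd.
Unshelve. all: by end_near.
Qed.

HB.instance Definition _ := isCumulative.Build _ _ _ dist dist_nd dist_rc.

(* The same measure, carried by the type whose sigma-algebra is the one of the
   Lebesgue-Stieltjes measures. *)
Let borelFF (A : set (measurableTypeR R)) : \bar R := FF A.

HB.instance Definition _ := isMeasure.Build _ _ _ borelFF (measure0 FF) (measure_ge0 FF)
  (measure_semi_sigma_additive (s := FF)).

Lemma measure_distribution : exists F : cumulative R R,
  [/\ distribution_function F, forall z, F z = fine (FF `]0, z]%classic) &
   forall A, measurable A -> lebesgue_stieltjes_measure F A = FF A].
Proof.
pose F : cumulative R R := dist; exists F; split => //.
  move=> z z0; rewrite /= /dist set_itv_ge ?measure0// -leNgt bnd_simp//.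
apply: (@lebesgue_stieltjes_measure_unique R F borelFF) => // _ [[a b] _ <-] /=.
change (lebesgue_stieltjes_measure F `]a, b]%classic = FF `]a, b]%classic).
have [ab|ba] := leP a b; last first.
  by rewrite set_itv_ge ?measure0// bnd_simp -leNgt ltW.
transitivity ((dist b - dist a)%:E); first exact: stieltjes_ocitv.
pose N : set R := `]-oo, 0]%classic; pose I : set R := `]a, b]%classic.
have mN : measurable N by exact: measurable_itv.
have mI : measurable I by exact: measurable_itv.
(* The interval may reach below 0; that part carries no mass and is cut off. *)
have ->: FF I = FF (I `\` N).
  rewrite (@measureDI _ _ _ FF I N)//.
  rewrite -[RHS]adde0; congr (_ + _)%E; apply/eqP; rewrite eq_le measure_ge0 andbT -FF_pos.
  by apply: FF_le => //; exact: measurableI.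
pose A : set R := `]0, a]%classic; pose B : set R := `]0, b]%classic.
have FFD : FF B = (FF (I `\` N) + FF A)%E.
  rewrite (@measureDI _ _ _ FF B A); [|exact: measurable_itv..].
  congr (FF _ + FF _)%E.
    apply/seteqP; split => t; rewrite /A /B /I /N /= !in_itv/=.
      by move=> [/andP[t0 ->] /negP]; rewrite t0 -ltNge => -> ; split => //; apply/negP; rewrite -ltNge.
    move=> [/andP[at_ ->] /negP]; rewrite -ltNge => t0; rewrite t0.
    by split => //; apply/negP; rewrite -ltNge.
  apply/seteqP; split => t; rewrite /A /B /= !in_itv/=; first by case.
  by move=> /andP[-> ta]; rewrite ta (le_trans ta).
rewrite EFinB /dist !fineK// -/A -/B FFD addeK//; exact: FF_itv.
Qed.

End distribution_of_measure.

Section poisson_transfer.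
Context {R : realType} {d : nat} {disp} {Omega : measurableType disp}.
Variables (P : probability Omega R) (eta : Omega -> set ('rV[R]_d * R)).
Variables (FF : {measure set R -> \bar R}) (F : cumulative R R).
Hypothesis FFE : forall A, measurable A -> lebesgue_stieltjes_measure F A = FF A.
Local Notation point := ('rV[R]_d * measurableTypeR R)%type.

Lemma product_intensity (A : set point) : measurable A ->
  (@lebesgue_rV R d \x FF)%E A = intensity F A.
Proof.
move=> mA; apply: eq_integral => x _ /=; apply/esym/FFE.
exact: measurable_xsection.
Qed.

Lemma poisson_process_intensity :
  poisson_process P eta (@lebesgue_rV R d \x FF)%E ->
  poisson_process P (eta : Omega -> set point) (@intensity R d F).
Proof.
move=> [H1 H2 H3 H4]; split.
- exact: H1.
- move=> B mB; rewrite -product_intensity//; exact: H2.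
- move=> B mB; rewrite -product_intensity//; exact: H3.
- exact: H4.
Qed.

End poisson_transfer.

Section estimator_solution.
Context {R : realType} {d : nat}.
Hypothesis d_ge2 : (2 <= d)%N.
Variables (W : set 'rV[R]_d) (eta : set ('rV[R]_d * R)).
Hypothesis eta_pos : forall p, eta p -> 0 < p.2.

Lemma G_hat_finite :
  finite_set (eta `&` [set p | W p.1 /\ laguerre_cell p eta p.1]) ->
  exists s : seq (R * R), all (fun p => (0 < p.1) && (0 <= p.2)) s /\
  forall z, 0 <= z -> G_hat W eta z = \sum_(p <- s) p.2 * (p.1 <= z)%R%:R.
Proof.
set A := _ `&` _ => finA.
(* For a window of volume 0 the inverse is 0 by convention, so the masses vanish and the
   construction still applies. *)
have v0 : 0 <= (fine (lebesgue_rV W))^-1 :> R by rewrite invr_ge0 fine_ge0.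
exists [seq (p.2, (fine (lebesgue_rV W))^-1) | p <- finmap.enum_fset (fset_set A)]; split.
  apply/allP => _ /mapP[p pA ->] /=; rewrite v0 andbT; apply: eta_pos.
  by move: pA; rewrite in_fset_set// inE => -[].
move=> z z0; rewrite big_map /G_hat -mulr_sumr/=; congr (_ * _).
have -> : (\esum_(p in eta)
    (\1_W p.1 * \1_(`]0%R, z]) p.2 * \1_(laguerre_cell p eta) p.1 : R)%:E)%E =
    (\esum_(p in A) ((p.2 <= z)%R%:R)%:E)%E.
  rewrite /A esum_mkcondr; apply: eq_esum => p ep; rewrite !indicE.
  have -> : (p.2 \in `]0, z]%classic) = (p.2 <= z).
    apply/idP/idP => [/set_mem|pz]; first by rewrite /= in_itv/= => /andP[].
    by apply/mem_set; rewrite /= in_itv/= pz eta_pos.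
  case: ifPn => [/set_mem[Wp lp]|/negP nWl]; first by rewrite !mem_set// mul1r mulr1.
  have [/set_mem Wp|_] := boolP (p.1 \in W); last by rewrite !mul0r.
  have [/set_mem lp|_] := boolP (p.1 \in laguerre_cell p eta); last by rewrite mulr0.
  by case: nWl; apply/mem_set.
by rewrite esum_fset// fsbig_finite//= sumEFin.
Qed.

(** Any single point of [eta] bounds the weights: an exposed point with position in the bounded set
    [W] weighs at most the squared distance to it plus its weight. *)
Lemma finite_exposed :
  (exists M : R, forall x, W x -> forall i, `|x ord0 i| <= M) ->
  (forall k : nat, finite_set (eta `&` cell 0 k%:R W)) ->
  finite_set (eta `&` [set p | W p.1 /\ laguerre_cell p eta p.1]).
Proof.
move=> [M WM] fin_cell.
have [[p0 ep0]|eta0] := pselect (exists p, eta p); last first.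
  rewrite (_ : _ `&` _ = set0); first exact: finite_set0.
  by apply/seteqP; split => p // [ep _]; case: eta0; exists p.
pose K := (d%:R * (M + enorm p0.1)) ^+ 2 + p0.2.
apply: sub_finite_set (fin_cell (Num.truncn K).+1) => p [ep [Wp /laguerre_cell_center pc]].
split => //; split => //=; rewrite in_itv/= eta_pos//= ltW//.
apply: le_lt_trans (truncnS_gt K); apply: le_trans (pc _ ep0) _.
have dist_le : enorm (p.1 - p0.1) <= d%:R * (M + enorm p0.1).
  apply: enorm_le_coord => i; rewrite !mxE (le_trans (ler_normB _ _))//.
  by rewrite lerD ?WM ?coord_le_enorm.
by rewrite /K lerD2r lerXn2r ?nnegrE ?enorm_ge0// (le_trans (enorm_ge0 _) dist_le).
Qed.

(** Existence by atoms and uniqueness by stability make the set in the definition of [F0_hat]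
    nonempty, so that [get] returns the solution. *)
Lemma F0_hat_solves :
  finite_set (eta `&` [set p | W p.1 /\ laguerre_cell p eta p.1]) ->
  exists F : cumulative R R, solves_G d (G_hat W eta) F /\ F0_hat W eta = F.
Proof.
move=> /G_hat_finite[s [s0 sE]]; have [F [F0 FE]] := step_solution d_ge2 s0.
have solF : solves_G d (G_hat W eta) F.
  by split => // z z0; rewrite FE sE.
have [] := @getPex _ [set f : R -> R | exists F : cumulative R R,
    [/\ f = F, solves_G d (G_hat W eta) F &
        forall F' : cumulative R R, solves_G d (G_hat W eta) F' -> F' =1 F]].
  exists (F : R -> R), F; split => // F' [F'0 F'E].
  have GE z : 0 <= z -> G_of d F' z = G_of d F z by move=> z0; rewrite F'E// FE sE.
  exact: (G_of_inj d_ge2 F0 F'0 GE).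
by move=> F' [h1 h2 _]; exists F'; split.
Qed.

End estimator_solution.

Theorem theorem8 (R : realType) (d : nat) (hd : (2 <= d)%N)
  (FF : {measure set R -> \bar R})
  (FF_neq0 : FF setT <> 0%E)
  (FF_locally_finite : locally_finite FF)
  (FF_concentrated : FF `]-oo, 0]%classic = 0%E)
  (disp : measure_display) (Omega : measurableType disp)
  (P : probability Omega R)
  (eta : Omega -> set ('rV[R]_d * R))
  (eta_pos : forall w p, eta w p -> 0 < p.2)
  (eta_poisson : poisson_process P eta (@lebesgue_rV R d \x FF)%E)
  (W : (set 'rV[R]_d)^nat) (hW : convex_averaging_sequence W) :
  {ae P, forall w, forall z, 0 <= z ->
    F0_hat (W n) (eta w) z @[n --> \oo] --> fine (FF `]0, z]%classic)}.
Proof.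
have [F [F0 FE FFE]] := measure_distribution FF_locally_finite FF_concentrated.
have etaP := poisson_process_intensity FFE eta_poisson.
have d_gt0 : (0 < d)%N := ltnW hd.
have [W_nd cW _ _] := hW.
have mW n : measurable (W n) by exact: compact_measurable_rV.
have W_bnd n : exists M : R, forall x, W n x -> forall i, `|x ord0 i| <= M.
  by have [M [_ WM]] := compact_coord_bounded (cW n); exists M.
pose v n : R := fine (lebesgue_rV (W n)).
have Wv n : lebesgue_rV (W n) = (v n)%:E.
  by rewrite fineK// ge0_fin_numE//; exact: compact_lty.
have v0 n : 0 <= v n by rewrite fine_ge0.
have v_oo M : \forall n \near \oo, M <= v n.
  by apply: filterS (volume_cvgy d_gt0 hW M) => n; rewrite Wv lee_fin.
have cell_lty n (k : nat) : (intensity F (cell 0 k%:R (W n)) < +oo)%E.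
  by rewrite intensity_rect// Wv -EFinM ltry.
have fin_ae : {ae P, forall w, forall n k : nat,
    (counting (eta w `&` cell 0 k%:R (W n)) : \bar R) \is a fin_num}.
  apply/ae_foralln => n; apply/ae_foralln => k; apply: (point_count_fin_ae etaP).
    exact: measurable_cell.
  exact: cell_lty.
(* Countably many weights share one null set; all others are reached by monotonicity. *)
have cvg_ae : {ae P, forall w, forall k,
    (v n)^-1 * fine (exposed_count eta W w n 0 (dense_weights F k))
      @[n --> \oo] --> G_of d F (dense_weights F k)}.
  apply/ae_foralln => k.
  exact: (exposed_count_cvg hd eta_pos etaP mW W_nd W_bnd Wv v_oo (dense_weights_ge0 F k)).
apply: filterS2 fin_ae cvg_ae => w fin_w cvg_w.
(* Finiteness matters for monotonicity in [z]: [fine] sends [+oo] to 0. *)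
have exposed_fin n z : exposed_count eta W w n 0 z \is a fin_num.
  rewrite ge0_fin_numE ?counting_ge0//.
  apply: (@le_lt_trans _ _ (counting (eta w `&` cell 0 (Num.truncn z).+1%:R (W n)))).
    apply: counting_le => p [[ep [Wp pz]] _]; split => //; split => //.
    move: pz; rewrite /= !in_itv/= => /andP[-> /le_trans]; apply.
    exact/ltW/truncnS_gt.
  by rewrite -ge0_fin_numE ?counting_ge0.
have G_hat_cvg z : 0 <= z -> G_hat (W n) (eta w) z @[n --> \oo] --> G_of d F z.
  move=> z0; under eq_fun do rewrite (G_hat_exposed eta Wv).
  apply: (@cvg_dense_weights _ F (G_of d F)
    (fun n z => (v n)^-1 * fine (exposed_count eta W w n 0 z))) => //.
  - by move=> a b a0 ab; rewrite G_of_diff_ge0// G_of_diff_le.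
  move=> n a b a0 ab; rewrite ler_wpM2l ?invr_ge0// fine_le//.
  apply: counting_le => p [[ep [Wp pa]] xp]; split => //; split => //; split => //.
  by move: pa; rewrite /= !in_itv/= => /andP[-> /le_trans]; apply.
have /choice[Fn FnP] n : exists Fn : cumulative R R,
    solves_G d (G_hat (W n) (eta w)) Fn /\ F0_hat (W n) (eta w) = Fn.
  apply: F0_hat_solves => //; first exact: eta_pos.
  apply: finite_exposed => //; first exact: eta_pos.
  by move=> k; apply: counting_fin_num; exact: fin_w.
move=> z z0; rewrite -FE.
under eq_fun do rewrite (proj2 (FnP _)).
apply: (cumulative_stability hd) => //; first by move=> n; case: (FnP n) => -[].
move=> y y0; under eq_fun => n do rewrite (proj2 (proj1 (FnP n)))//.
exact: G_hat_cvg.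
Qed.
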